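(* Let $(\mathcal M,\delta)$ be a metric space whose Borel probability measures under consideration are Radon, equip $\mathcal M\times\mathcal M$ with the Manhattan metric $d[(x,y),(u,v)]=\delta(x,u)+\delta(y,v)$, and consider nondegenerate $\mathcal M$-valued random variables with finite first moments. Then $\Delta(X,Y)=\mathrm{eCor}(X,Y)$ satisfies: (a) $\mathrm{eCor}(X,Y)=0$ if and only if $X$ and $Y$ are independent; (b* ) $\mathrm{eCor}(f(X),f(Y))=\mathrm{eCor}(X,Y)$ for every similarity transformation $f$ of $(\mathcal M,\delta)$; (c* ) $\mathrm{eCor}(X,Y)=1$ if $Y=f(X)$ with probability $1$ for some similarity transformation $f$ of $(\mathcal M,\delta)$; (d) continuity: if $(X_n,Y_n)$, $n\ge1$, and $(X,Y)$ are pairs of nondegenerate random variables, there exist $x_0,y_0\in\mathcal M$ and a constant $K>0$ with $\mathbb E\big(\delta^2(X_n,x_0)+\delta^2(Y_n,y_0)\big)\le K$ for all $n$, and $(X_n,Y_n)$ converges in distribution to $(X,Y)$, then $\mathrm{eCor}(X_n,Y_n)\to\mathrm{eCor}(X,Y)$.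
   Context: A map $f:\mathcal M\to\mathcal M$ is a similarity if there is $c>0$ with $\delta(f(x),f(y))=c\,\delta(x,y)$ for all $x,y$. A random variable is nondegenerate if it is not a.s. constant; finite first moment means $\mathbb E\,\delta(X,x_0)<\infty$ for some $x_0$. For probability measures $\mu,\nu$ with finite first moments on a metric space $(S,\rho)$, $e(\mu,\nu)=\inf_\gamma\int\rho\,d\gamma$ over all couplings $\gamma$ of $\mu,\nu$ (earth mover's / Wasserstein-1 distance). The earth mover's covariance is $\mathrm{eCov}(X,Y)=e\big[(X,Y),(X',Y')\big]$, the distance w.r.t. $d$ between the joint law of $(X,Y)$ and the product of its marginals (law of $(X',Y')$ with $X'\overset d=X$, $Y'\overset d=Y$, $X',Y'$ independent); $\mathrm{eVar}(X)=\mathrm{eCov}(X,X)$; $\mathrm{eCor}(X,Y)=\mathrm{eCov}(X,Y)/\min\{\mathrm{eVar}(X),\mathrm{eVar}(Y)\}$, defined when the denominator is positive. *)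

(* Defs.v *)
From HB Require Import structures.
From mathcomp Require Import all_boot all_order all_algebra.
From mathcomp Require Import all_classical all_reals all_analysis.
Set Implicit Arguments. Unset Strict Implicit. Unset Printing Implicit Defensive.
Import Order.TTheory GRing.Theory Num.Theory.
Import numFieldNormedType.Exports.
Local Open Scope classical_set_scope.
Local Open Scope ring_scope.

Section MetricDefs.
Context {R : realType} {M : pointedType}.

Definition is_metric (δ : M -> M -> R) : Prop :=
  [/\ forall x y, δ x y = 0 <-> x = y,
      forall x y, δ x y = δ y x &
      forall x y z, δ x z <= δ x y + δ y z].

Definition mopen (δ : M -> M -> R) (A : set M) : Prop :=
  forall x, A x -> exists r : R, 0 < r /\ forall y, δ x y < r -> A y.

Definition Borel (δ : M -> M -> R) := g_sigma_algebraType (mopen δ).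

Definition dman (δ : M -> M -> R) (p q : M * M) : R := δ p.1 q.1 + δ p.2 q.2.

Definition mcompact (δ : M -> M -> R) (K : set M) : Prop :=
  forall u : nat -> M, (forall n, K (u n)) ->
  exists (phi : nat -> nat) (x : M),
    {homo phi : m n / (m < n)%N >-> (m < n)%N} /\ K x /\
    (fun n => δ (u (phi n)) x) @ \oo --> 0.

Definition mcontinuous_pair (δ : M -> M -> R) (g : M * M -> R) : Prop :=
  forall z (e : R), 0 < e -> exists r : R, 0 < r /\
    forall z', dman δ z z' < r -> `|g z - g z'| < e.

Definition similarity (δ : M -> M -> R) (f : M -> M) : Prop :=
  exists c : R, 0 < c /\ forall x y, δ (f x) (f y) = c * δ x y.

End MetricDefs.

Section Wasserstein.
Context {R : realType} {d : measure_display} {S : measurableType d}.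

Definition is_coupling (mu nu : set S -> \bar R) (g : probability (S * S)%type R) :=
  forall A, measurable A ->
    g (fst @^-1` A) = mu A /\ g (snd @^-1` A) = nu A.

Definition emd (rho : S -> S -> R) (mu nu : set S -> \bar R) : \bar R :=
  ereal_inf [set (\int[g]_z (rho z.1 z.2)%:E)%E
            | g in [set g : probability (S * S)%type R | is_coupling mu nu g]].
End Wasserstein.

Section RV.
Context {R : realType} {M : pointedType} (δ : M -> M -> R).
Context {dO : measure_display} {Om : measurableType dO} (P : probability Om R).

Definition law (X : Om -> Borel δ) : set (Borel δ) -> \bar R :=
  fun A => P (X @^-1` A).

Definition joint_law (X Y : Om -> Borel δ) : set (Borel δ * Borel δ)%type -> \bar R :=
  fun A => P ((fun w => (X w, Y w)) @^-1` A).

(** [nu] is the law of (X',Y'), X' =d X, Y' =d Y, X' and Y' independent *)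
Definition indep_copy_law (X Y : Om -> Borel δ)
  (nu : probability (Borel δ * Borel δ)%type R) : Prop :=
  forall A B, measurable A -> measurable B ->
    nu (A `*` B) = (law X A * law Y B)%E.

Definition eCov (X Y : Om -> Borel δ) : \bar R :=
  ereal_inf [set @emd R _ (Borel δ * Borel δ)%type (dman δ) (joint_law X Y) nu
            | nu in [set nu | indep_copy_law X Y nu]].

Definition eVar (X : Om -> Borel δ) : \bar R := eCov X X.

Definition eCor (X Y : Om -> Borel δ) : R :=
  fine (eCov X Y) / Order.min (fine (eVar X)) (fine (eVar Y)).

Definition independent (X Y : Om -> Borel δ) : Prop :=
  forall A B, measurable A -> measurable B ->
    P (X @^-1` A `&` Y @^-1` B) = (P (X @^-1` A) * P (Y @^-1` B))%E.

Definition nondegenerate (X : Om -> Borel δ) : Prop :=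
  ~ exists c : M, {ae P, forall w, X w = c}.

Definition finite_first_moment (X : Om -> Borel δ) : Prop :=
  exists x0 : M, (\int[P]_w (δ (X w) x0)%:E < +oo)%E.

Definition radon_law (X : Om -> Borel δ) : Prop :=
  forall A, measurable A ->
    law X A = ereal_sup [set law X K | K in [set K | mcompact δ K /\ K `<=` A]].

Definition admissible (X : Om -> Borel δ) : Prop :=
  [/\ measurable_fun setT X, nondegenerate X, finite_first_moment X & radon_law X].

End RV.

Definition cvg_in_distribution {R : realType} {M : pointedType} (δ : M -> M -> R)
  (dn : nat -> measure_display) (On : forall n, measurableType (dn n))
  (Pn : forall n, probability (On n) R) (Zn : forall n, On n -> (M * M)%type)
  {d : measure_display} {Om : measurableType d} (P : probability Om R)
  (Z : Om -> (M * M)%type) : Prop :=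
  forall g : M * M -> R, mcontinuous_pair δ g -> (exists C : R, forall z, `|g z| <= C) ->
    (fun n => fine (\int[Pn n]_w (g (Zn n w))%:E)%E) @ \oo
      --> fine (\int[P]_w (g (Z w))%:E)%E.

(* Main.v *)
(* Write [V X] for the mean distance between two independent copies of [X]. Always [eCov X Y <=
   min (V X) (V Y)]: couple (X, Y) with an independent copy sharing its first, or its second,
   coordinate. If [Y = f X] with [f] a similarity of ratio [c], then under any coupling with
   (u, v) the point [f u] travels to [v] at cost at most [max 1 c] times the transport cost, so
   [eCov X (f X) = min 1 c * V X]; in particular [eVar X = V X], which gives (c) and the
   positivity of the denominators. For (a), a vanishing earth mover's distance forces the two
   laws to agree on open rectangles. For (b), transport plans are pushed forward by [f], and
   pulled back by a Borel left inverse of [f] on a sigma-compact set of full measure. For (d),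
   weakly close laws with bounded second moments are joined by a cheap coupling having a
   density [G] with respect to their product, built from a partition of unity by small tents
   plus a remainder. A plan from [be] to [nu] and a density [G] between [al] and [be] compose
   by weighting [al \x gamma] with [G (x, z.1)], so no disintegration, and hence no Polish
   assumption, is needed. *)
Require Import Defs.
From HB Require Import structures.
From mathcomp Require Import all_boot all_order all_algebra.
From mathcomp Require Import all_classical all_reals all_analysis.
From mathcomp Require Import measurable_realfun.
From mathcomp Require Import ring lra.
Import Order.TTheory GRing.Theory Num.Theory.
Import numFieldNormedType.Exports.
Local Open Scope classical_set_scope.
Local Open Scope ring_scope.

Set Implicit Arguments.
Unset Strict Implicit.
Unset Printing Implicit Defensive.

(** * Measures and densities *)

(** Two measurability obstacles shape the development: on a non-separable [M], neither [δ] nor the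
    open subsets of [M * M] need be measurable for the product sigma-algebra. The first is met by
    fixing one sequence [z] whose closure carries all the laws at hand, which are Radon and at most
    countably many, and by replacing [δ] with a measurable cost that agrees with it as soon as one
    argument lies in this closure. The second is met by comparing laws on open rectangles only. In
    (d), the second moments pay for the mass that the small cells fail to match. It is coupled
    independently; for mass [r] and any level [a > 0] this costs at most [2 * a * r + K / (2 * a)],
    which is small when [a] is chosen large first and [r] small afterwards. Convergence of the
    variances is convergence of covariances once more, applied to the pairs [(Xn, Xn)] and
    [(Yn, Yn)]. *)

Section Pushforward.
Context {d d' : measure_display} {T : measurableType d} {T' : measurableType d'}.
Context {R : realType}.

Definition push (P : probability T R) (f : T -> T') (mf : measurable_fun [set: T] f) :
  probability T' R := distribution P (mfun_Sub (mem_set mf)).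

Lemma pushE (P : probability T R) (f : T -> T') (mf : measurable_fun [set: T] f) A :
  push P mf A = P (f @^-1` A).
Proof. by []. Qed.

Lemma integral_push (P : probability T R) (f : T -> T') (mf : measurable_fun [set: T] f)
    (h : T' -> \bar R) :
  measurable_fun [set: T'] h -> (forall y, 0 <= h y)%E ->
  (\int[push P mf]_y h y = \int[P]_x h (f x))%E.
Proof. by move=> mh h0; rewrite /push ge0_integral_distribution. Qed.

End Pushforward.

Lemma preimage_measurable d d' (T : measurableType d) (T' : measurableType d')
  (f : T -> T') A : measurable_fun setT f -> measurable A -> measurable (f @^-1` A).
Proof. by move=> mf mA; rewrite -[X in measurable X]setTI; exact: mf. Qed.

Section LowerIntegral.
Local Open Scope ereal_scope.
Context {d : measure_display} {T : measurableType d} {R : realType}.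
Variable mu : {measure set T -> \bar R}.

Import HBNNSimple.

(* The integral of a nonnegative function is a supremum over simple minorants, so this needs no measurability of [f]. *)
Lemma integral_full_set (D : set T) (f : T -> \bar R) :
  measurable D -> mu (~` D) = 0 -> (forall x, 0 <= f x) ->
  \int[mu]_x f x = \int[mu]_(x in D) f x.
Proof.
move=> mD muD f0; apply/eqP; rewrite eq_le; apply/andP; split.
- rewrite ge0_integralTE//; apply: ge_ereal_sup => _ /= [h hf <-].
  (* Cutting a simple minorant down to [D] leaves its integral unchanged, and the result is a
     minorant of [f] restricted to [D]. *)
  have -> : sintegral mu h = sintegral mu (h \_ D).
    rewrite -integral_nnsfun//.
    have := @ge0_negligible_integral _ _ _ mu setT (~` D) (EFin \o h).
    rewrite setTD setCK => <- //.
    + by rewrite integral_nnsfun// patch_setT.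
    + exact: measurableC.
    + exact/measurable_EFinP.
    + by move=> x _; rewrite lee_fin; exact: fun_ge0.
  rewrite -integral_nnsfun// !ge0_integralE//; last first.
    by move=> x _; rewrite lee_fin; exact: fun_ge0.
  apply: ge_ereal_sup => _ /= [k kh <-]; apply: ereal_sup_ubound.
  exists k => // x; rewrite (le_trans (kh x))// /patch /=.
  by case: ifPn => // _; exact: hf.
- rewrite !ge0_integralE//; apply: ge_ereal_sup => _ /= [h hf <-].
  apply: ereal_sup_ubound; exists h => // x; rewrite (le_trans (hf x))// patch_setT.
  by rewrite /patch /=; case: ifPn => // _; exact: f0.
Qed.

(** Without measurability of [f] and [g], a cost built from [δ] can be exchanged for one built from
    [mmetric]. *)
Lemma eq_integral_full_set (D : set T) (f g : T -> \bar R) :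
  measurable D -> mu (~` D) = 0 -> (forall x, 0 <= f x) -> (forall x, 0 <= g x) ->
  (forall x, D x -> f x = g x) -> \int[mu]_x f x = \int[mu]_x g x.
Proof.
move=> mD muD f0 g0 fg; rewrite (integral_full_set mD muD f0).
rewrite (integral_full_set mD muD g0).
by apply: eq_integral => x; rewrite inE; exact: fg.
Qed.

End LowerIntegral.

Section Density.
Local Open Scope ereal_scope.
Context {d : measure_display} {T : measurableType d} {R : realType}.
Variables (mu : probability T R) (g : T -> R).
Hypothesis mg : measurable_fun [set: T] g.
Hypothesis g0 : (forall x, 0 <= g x)%R.
Hypothesis g1 : \int[mu]_x (g x)%:E = 1.

(** The proofs are carried in the term so that the probability instance declared below can be
    inferred from it. *)
Definition density (_ : measurable_fun [set: T] g) (_ : (forall x, 0 <= g x)%R)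
  (_ : \int[mu]_x (g x)%:E = 1) (A : set T) := \int[mu]_(x in A) (g x)%:E.

Local Notation m := (density mg g0 g1).

Let density0 : m set0 = 0.
Proof. exact: integral_set0. Qed.

Let density_ge0 A : 0 <= m A.
Proof. by apply: integral_ge0 => x _; rewrite lee_fin. Qed.

Let mEg A : measurable_fun A (fun x => (g x)%:E).
Proof. by apply/measurable_funTS/measurable_EFinP. Qed.

Let density_sigma_additive : semi_sigma_additive m.
Proof.
move=> F mF tF mUF; rewrite /density ge0_integral_bigcup//; last first.
  by move=> x _; rewrite lee_fin.
by apply: is_cvg_ereal_nneg_natsum => n _; apply: integral_ge0 => x _; rewrite lee_fin.
Qed.

HB.instance Definition _ := isMeasure.Build _ _ _ m density0 density_ge0
  density_sigma_additive.

Let density_setT : m setT = 1.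
Proof. by []. Qed.

HB.instance Definition _ := Measure_isProbability.Build _ _ _ m density_setT.

(** The density measure is dominated by [mu], so the change of variables holds with its
    Radon-Nikodym derivative. This derivative is a.e. [g], because both have the same integral over
    every measurable set. *)
Lemma integral_density (h : T -> \bar R) :
  measurable_fun [set: T] h -> (forall x, 0 <= h x) ->
  \int[m]_x h x = \int[mu]_x (h x * (g x)%:E).
Proof.
move=> mh h0.
have dom : m `<< mu.
  apply/null_content_dominatesP => A mA muA.
  rewrite /= /density; apply/eqP; rewrite eq_le density_ge0 andbT.
  have := @integral_abs_eq0 _ _ _ mu A (EFin \o g) mA (@mEg A) muA.
  move=> <-; apply: ge0_le_integral => //=.
  - by move=> x _; rewrite lee_fin.
  - by apply/measurable_EFinP; apply: measurable_funTS; exact: measurableT_comp.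
  - by move=> x _; rewrite lee_fin ler_norm.
have gi : mu.-integrable setT (fun x => (g x)%:E).
  apply/integrableP; split; first exact: (@mEg setT).
  rewrite (eq_integral (fun x => (g x)%:E)) ?g1 ?ltry// => x _.
  by rewrite /= ger0_norm.
have fi := Radon_Nikodym_SigmaFinite.f_integrable dom.
rewrite -(Radon_Nikodym_SigmaFinite.change_of_variables dom h0 measurableT mh).
have ae : ae_eq mu setT (Radon_Nikodym_SigmaFinite.f m mu) (fun x => (g x)%:E).
  apply: integral_ae_eq => // E _ mE.
  by rewrite -(Radon_Nikodym_SigmaFinite.f_integral dom mE).
apply: ge0_ae_eq_integral => //.
- by apply: emeasurable_funM => //; exact: measurable_int fi.
- exact: emeasurable_funM.
- by move=> x _; rewrite mule_ge0// Radon_Nikodym_SigmaFinite.f_ge0.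
- by move=> x _; rewrite mule_ge0// lee_fin.
- by apply: filterS ae => x /= H _; rewrite H.
Qed.

End Density.

(** * Metric spaces and tight laws *)

Section MetricTheory.
Context {R : realType} {M : pointedType} (δ : M -> M -> R).
Hypothesis Hδ : is_metric δ.

Lemma is_metric_xx x : δ x x = 0.
Proof. by case: Hδ => H _ _; apply/H. Qed.

Lemma is_metric_eq0 x y : δ x y = 0 -> x = y.
Proof. by case: Hδ => H _ _ /H. Qed.

Lemma is_metric_sym x y : δ x y = δ y x.
Proof. by case: Hδ. Qed.

Lemma is_metric_tri y x z : δ x z <= δ x y + δ y z.
Proof. by case: Hδ. Qed.

Lemma is_metric_ge0 x y : 0 <= δ x y.
Proof. have := is_metric_tri y x x; rewrite is_metric_xx (is_metric_sym y x); lra. Qed.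

Lemma mopen_ball a r : mopen δ [set x | δ x a < r].
Proof.
move=> x /= xr; exists (r - δ x a); split; first by lra.
by move=> y xy; have := is_metric_tri x y a; rewrite (is_metric_sym y x); lra.
Qed.

Lemma mopen_setT : mopen δ setT.
Proof. by move=> x _; exists 1; split. Qed.

Lemma mopen_setI : setI_closed (mopen δ).
Proof.
move=> A B oA oB x [/oA[r [r0 rA]] /oB[s [s0 sB]]]; exists (Num.min r s).
split; first by rewrite lt_min r0.
by move=> y; rewrite lt_min => /andP[/rA ? /sB ?].
Qed.

Lemma mopen_measurable (A : set M) : mopen δ A -> measurable (A : set (Borel δ)).
Proof. by move=> oA; exact: sub_sigma_algebra. Qed.

Lemma measurable_metric1 (a : M) :
  measurable_fun [set: Borel δ] (fun x : Borel δ => δ x a).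
Proof.
apply: (measurability _ (RGenInftyO.measurableE R)) => //.
move=> _ [_ [x ->] <-]; rewrite setTI; apply: mopen_measurable.
rewrite (_ : _ @^-1` _ = [set y | δ y a < x]); first exact: mopen_ball.
by apply/seteqP; split => y /=; rewrite in_itv.
Qed.

Definition mclosure (z : nat -> M) : set M :=
  [set x | forall e : R, 0 < e -> exists i, δ x (z i) < e].

Lemma mopen_setC_mclosure z : mopen δ (~` mclosure z).
Proof.
move=> x /existsNP[e /not_implyP[e0 /forallNP xe]]; exists (e / 2); split; first lra.
move=> y xy /(_ (e / 2)) []; first lra.
move=> i yi; apply: (xe i); have := is_metric_tri y x (z i); lra.
Qed.

Lemma measurable_mclosure z : measurable (mclosure z : set (Borel δ)).
Proof.
rewrite -[mclosure z]setCK; apply: measurableC; apply: mopen_measurable.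
exact: mopen_setC_mclosure.
Qed.

(* [δ] itself need not be measurable for the product sigma-algebra when [M] is not separable;
   this majorant always is, and it agrees with [δ] as soon as one argument lies in [mclosure z]. *)
Definition mmetric (z : nat -> M) (x y : M) : R :=
  infs (fun i => δ x (z i) + δ (z i) y) 0%N.

Lemma mmetric_le z i x y : mmetric z x y <= δ x (z i) + δ (z i) y.
Proof.
rewrite /mmetric /infs /=; apply: ge_inf; last by exists i.
by exists 0 => _ [j _ <-]; rewrite addr_ge0// is_metric_ge0.
Qed.

Lemma mmetric_glb z c x y :
  (forall i, c <= δ x (z i) + δ (z i) y) -> c <= mmetric z x y.
Proof.
move=> H; rewrite /mmetric /infs /=; apply: lb_le_inf.
  by exists (δ x (z 0%N) + δ (z 0%N) y), 0%N.
by move=> _ [j _ <-].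
Qed.

Lemma metric_le_mmetric z x y : δ x y <= mmetric z x y.
Proof. by apply: mmetric_glb => i; exact: is_metric_tri. Qed.

Lemma mmetric_ge0 z x y : 0 <= mmetric z x y.
Proof. exact: le_trans (is_metric_ge0 _ _) (metric_le_mmetric _ _ _). Qed.

Lemma mmetricC z x y : mmetric z x y = mmetric z y x.
Proof.
apply/eqP; rewrite eq_le; apply/andP; split; apply: mmetric_glb => i;
  rewrite addrC !(is_metric_sym (z i)) (is_metric_sym _ (z i)).
  by have := mmetric_le z i x y; rewrite !(is_metric_sym (z i)).
by have := mmetric_le z i y x; rewrite !(is_metric_sym (z i)).
Qed.

Lemma mmetric_tri z y x w : mmetric z x w <= mmetric z x y + mmetric z y w.
Proof.
rewrite -lerBlDr; apply: mmetric_glb => i.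
have := mmetric_le z i x w; have := is_metric_tri y (z i) w.
have := metric_le_mmetric z y w; lra.
Qed.

(** Off the closure the equality fails: [mmetric z x x] is twice the distance from [x] to the
    sequence. Each use therefore comes with a set of full measure on which one argument lies in
    [mclosure z]. *)
Lemma mmetricE z x y : mclosure z x -> mmetric z x y = δ x y.
Proof.
move=> zx; apply/eqP; rewrite eq_le metric_le_mmetric andbT.
apply/ler_addgt0Pr => e e0; have [i xi] := zx (e / 2) (ltac:(lra)).
have := mmetric_le z i x y; have := is_metric_tri x (z i) y.
rewrite (is_metric_sym (z i) x); lra.
Qed.

Lemma measurable_mmetric z :
  measurable_fun [set: Borel δ * Borel δ]
    (fun p : Borel δ * Borel δ => mmetric z p.1 p.2).
Proof.
apply: (@measurable_fun_infs _ _ R setT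
   (fun i (p : Borel δ * Borel δ) => δ p.1 (z i) + δ (z i) p.2)).
  by move=> p _; exists 0 => _ [j _ <-]; rewrite addr_ge0// is_metric_ge0.
move=> i; apply: measurable_funD.
  by apply: (measurableT_comp (measurable_metric1 (z i))); exact: measurable_fst.
under eq_fun do rewrite is_metric_sym.
by apply: (measurableT_comp (measurable_metric1 (z i))); exact: measurable_snd.
Qed.

Lemma countable_mclosure (I : countType) (F : I -> M) :
  exists z : nat -> M, forall x, (forall e : R, 0 < e -> exists i, δ x (F i) < e) ->
    mclosure z x.
Proof.
(* Integers that code no index are sent to [point], which can only enlarge the closure. *)
exists (fun n => if unpickle n is Some i then F i else point) => x xF e /xF[i xi].
by exists (pickle i); rewrite pickleK.
Qed.

(** Provides one sequence for all the laws in play. Finite families are passed as functions on [nat]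
    with a default branch. *)
Lemma mclosure_bigcup (Z : nat -> nat -> M) :
  exists z, forall n, mclosure (Z n) `<=` mclosure z.
Proof.
have [z Hz] := @countable_mclosure (nat * nat)%type (fun p => Z p.1 p.2).
by exists z => n x xZ; apply: Hz => e /xZ[i xi]; exists (n, i).
Qed.

(** If no finite net existed, greedy choice would give an [r]-separated sequence in [K], which has
    no convergent subsequence. *)
Lemma mcompact_net (K : set M) (r : R) : mcompact δ K -> 0 < r ->
  exists s : seq M, forall x, K x -> exists2 i, (i < size s)%N & δ x (nth point s i) < r.
Proof.
move=> cK r0; apply: contrapT => /forallNP noS.
have far s : exists x, K x /\ forall i, (i < size s)%N -> r <= δ x (nth point s i).
  have /existsNP[x /not_implyP[Kx Hx]] := noS s; exists x; split => // i si.
  by rewrite leNgt; apply/negP => xi; apply: Hx; exists i.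
have [F HF] := choice far.
(* [S n] lists the first [n] greedy points, and [F (S n)] is the next one. *)
pose S := fix S n := if n is m.+1 then rcons (S m) (F (S m)) else [::].
have sS n : size (S n) = n by elim: n => //= n IH; rewrite size_rcons IH.
have nS n m : (m < n)%N -> nth point (S n) m = F (S m).
  elim: n => //= n IH; rewrite ltnS nth_rcons sS leq_eqVlt => /orP[/eqP->|mn].
    by rewrite ltnn eqxx.
  by rewrite mn IH.
have sep m n : (m < n)%N -> r <= δ (F (S n)) (F (S m)).
  by move=> mn; rewrite -(nS n m mn); apply: (HF (S n)).2; rewrite sS.
have [phi [x [phi_inc [_ cvg]]]] := cK (fun n => F (S n)) (fun n => (HF (S n)).1).
have /cvgrPdist_lt/(_ (r / 2)) := cvg.
case; first lra.
move=> N _ HN.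
(* Two consecutive terms of the subsequence lie within [r / 2] of the limit, against the
   separation. *)
have h1 := HN N (leqnn _); have h2 := HN N.+1 (leqnSn _); move: h1 h2 => /=.
rewrite !sub0r !normrN !ger0_norm ?is_metric_ge0// => h1 h2.
have := sep _ _ (phi_inc N N.+1 (ltnSn N)).
have := is_metric_tri x (F (S (phi N.+1))) (F (S (phi N))).
rewrite (is_metric_sym x); lra.
Qed.

Lemma mcompact_separable (K : set M) : mcompact δ K ->
  exists z : nat -> M, K `<=` mclosure z.
Proof.
move=> cK.
have r0 (n : nat) : 0 < (n.+1%:R^-1 : R) by rewrite invr_gt0 ltr0Sn.
have net (n : nat) := mcompact_net cK (r0 n).
have {net}[S HS] := choice net.
have [z Hz] := @countable_mclosure (nat * nat)%type (fun p => nth point (S p.1) p.2).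
exists z => x Kx; apply: Hz => e e0.
have [n ne] : exists n : nat, n.+1%:R^-1 < e.
  have /cvgrPdist_lt/(_ e e0)[N _ HN] := @cvg_harmonic R.
  by exists N; have := HN N (leqnn _); rewrite /= sub0r normrN ger0_norm ?invr_ge0.
by have [i si xi] := HS n x Kx; exists (n, i); exact: lt_trans xi ne.
Qed.

Lemma mcompact_closed (K : set M) : mcompact δ K -> mopen δ (~` K).
Proof.
move=> cK x Kx; apply: contrapT => /forallNP H.
have near n : exists y, K y /\ δ x y < n.+1%:R^-1.
  have /not_andP[|/existsNP[y /not_implyP[xy Ky]]] := H n.+1%:R^-1.
    by rewrite invr_gt0 ltr0Sn.
  by exists y; split => //; exact: contrapT.
have {near}[u Hu] := choice near.
have [phi [y [phi_inc [Ky cvg]]]] := cK u (fun n => (Hu n).1).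
apply: Kx; suff -> : x = y by [].
(* Makes the bound on the distance from [x] to [u n] available along the subsequence. *)
have phi_ge n : (n <= phi n)%N.
  elim: n => // n IH; apply: leq_ltn_trans IH _; exact: phi_inc.
apply: is_metric_eq0; apply/eqP; rewrite eq_le is_metric_ge0 andbT.
apply/ler_addgt0Pr => e e0; rewrite add0r.
have e2 : 0 < e / 2 by lra.
have /cvgrPdist_lt/(_ (e / 2) e2)[N1 _ HN1] := cvg.
have /cvgrPdist_lt/(_ (e / 2) e2)[N2 _ HN2] := @cvg_harmonic R.
pose N := maxn N1 N2.
have h1 := HN1 N (leq_maxl _ _); have h2 := HN2 (phi N) (leq_trans (leq_maxr _ _) (phi_ge N)).
move: h1 h2 => /=; rewrite !sub0r !normrN !ger0_norm ?is_metric_ge0 ?invr_ge0// => h1 h2.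
have := lt_trans (Hu (phi N)).2 h2; have := is_metric_tri (u (phi N)) x y; move: h1.
set a := δ x y; set b := δ _ y; set c := δ x _; lra.
Qed.

Lemma mcompact_measurable (K : set M) : mcompact δ K -> measurable (K : set (Borel δ)).
Proof.
move=> cK; rewrite -[K]setCK; apply: measurableC; apply: mopen_measurable.
exact: mcompact_closed.
Qed.

End MetricTheory.

Section Tight.
Context {R : realType} {M : pointedType} (δ : M -> M -> R).
Hypothesis Hδ : is_metric δ.
Context {d : measure_display} {Om : measurableType d} (P : probability Om R).

(** Inner regularity of the whole space suffices: take a compact set of mass above [1 - 1 / (n + 1)]
    for each [n]. *)
Lemma radon_sigma_compact (X : Om -> Borel δ) : measurable_fun setT X -> radon_law P X ->
  exists K : nat -> set M, (forall n, mcompact δ (K n)) /\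
    P (X @^-1` (~` \bigcup_n K n)) = 0.
Proof.
move=> mX /(_ setT measurableT); rewrite /law preimage_setT probability_setT => /esym PX.
have ex (n : nat) : exists K, mcompact δ K /\ ((1 - n.+1%:R^-1)%R%:E < P (X @^-1` K))%E.
  have : ((1 - n.+1%:R^-1 : R)%:E < 1%:E)%E by rewrite lte_fin ltrBlDr ltrDl invr_gt0 ltr0Sn.
  rewrite -[1%:E]PX => /ereal_sup_gt[_ [K [cK _] <-] PK]; by exists K.
have [K HK] := choice ex.
have cK n := (HK n).1; have PK n := (HK n).2.
exists K; split => //.
have mK : measurable (\bigcup_n K n : set (Borel δ)).
  by apply: bigcupT_measurable => n; exact: mcompact_measurable.
have mXK := preimage_measurable mX mK.
rewrite preimage_setC probability_setC//.
suff -> : P (X @^-1` \bigcup_n K n) = 1%E by rewrite subee.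
apply/eqP; rewrite eq_le probability_le1//=; apply/lee_addgt0Pr => e e0.
have [n ne] : exists n : nat, n.+1%:R^-1 < e.
  have /cvgrPdist_lt/(_ e e0)[N _ HN] := @cvg_harmonic R.
  by exists N; have := HN N (leqnn _); rewrite /= sub0r normrN ger0_norm ?invr_ge0.
have : (P (X @^-1` K n) <= P (X @^-1` \bigcup_n K n))%E.
  apply: le_measure; rewrite ?inE//.
    by apply: preimage_measurable => //; exact: mcompact_measurable.
  by apply: preimage_subset; exact: bigcup_sup.
have fin := fin_num_measure P _ (preimage_measurable mX (mcompact_measurable Hδ (cK n))).
have : ((1 - n.+1%:R^-1)%:E < (fine (P (X @^-1` K n)))%:E)%E by rewrite fineK//; exact: PK.
rewrite -[X in (X <= _)%E -> _](fineK fin) lte_fin => rn h.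
by apply: le_trans _ (leeD2r _ h); rewrite -EFinD lee_fin; move: rn ne; set a := fine _; set b := _^-1; move: a b => a b h1 h2; lra.
Qed.

Lemma radon_separable (X : Om -> Borel δ) : measurable_fun setT X -> radon_law P X ->
  exists z : nat -> M, P (X @^-1` (~` mclosure δ z)) = 0.
Proof.
move=> mX rX; have [K [cK PK]] := radon_sigma_compact mX rX.
have [Z HZ] := choice (fun n => mcompact_separable Hδ (cK n)).
have [z Hz] := mclosure_bigcup δ Z.
exists z; apply: (subset_measure0 _ _ _ PK).
- apply: preimage_measurable => //; apply: measurableC; exact: measurable_mclosure.
- apply: preimage_measurable => //; apply: measurableC.
  by apply: bigcupT_measurable => n; exact: mcompact_measurable.
- move=> w /= nz [n _ Kn]; apply: nz; exact: (Hz n _ (HZ n _ Kn)).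
Qed.

End Tight.

(** * Couplings and the earth mover's distance *)

Section NonnegativeIntegrals.
Local Open Scope ereal_scope.
Context {d : measure_display} {T : measurableType d} {R : realType}.
Variable mu : {measure set T -> \bar R}.
Implicit Types f g : T -> R.

Lemma int_ge0 f : (forall x, (0 <= f x)%R) -> 0 <= \int[mu]_x (f x)%:E.
Proof. by move=> f0; apply: integral_ge0 => x _; rewrite lee_fin. Qed.

Lemma int_ge0D f g : measurable_fun [set: T] f -> measurable_fun [set: T] g ->
  (forall x, (0 <= f x)%R) -> (forall x, (0 <= g x)%R) ->
  \int[mu]_x (f x + g x)%:E = \int[mu]_x (f x)%:E + \int[mu]_x (g x)%:E.
Proof.
move=> mf mg f0 g0; rewrite -ge0_integralD//; last 4 first.
- by move=> x _; rewrite lee_fin.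
- exact/measurable_EFinP.
- by move=> x _; rewrite lee_fin.
- exact/measurable_EFinP.
Qed.

Lemma int_ge0Z f (c : R) : measurable_fun [set: T] f -> (forall x, (0 <= f x)%R) ->
  (0 <= c)%R -> \int[mu]_x (c * f x)%:E = c%:E * \int[mu]_x (f x)%:E.
Proof.
move=> mf f0 c0; rewrite -ge0_integralZl_EFin//.
- by move=> x _; rewrite lee_fin.
- exact/measurable_EFinP.
Qed.

Lemma int_ge0_le f g : measurable_fun [set: T] f -> measurable_fun [set: T] g ->
  (forall x, (0 <= f x)%R) -> (forall x, (f x <= g x)%R) ->
  \int[mu]_x (f x)%:E <= \int[mu]_x (g x)%:E.
Proof.
move=> mf mg f0 fg; apply: ge0_le_integral => //.
- by move=> x _; rewrite lee_fin.
- exact/measurable_EFinP.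
- exact/measurable_EFinP.
- by move=> x _; rewrite lee_fin.
Qed.

Lemma int_ge0_sum (I : Type) (s : seq I) (f : I -> T -> R) :
  (forall i, measurable_fun [set: T] (f i)) -> (forall i x, (0 <= f i x)%R) ->
  \int[mu]_x (\sum_(i <- s) f i x)%R%:E = \sum_(i <- s) \int[mu]_x (f i x)%:E.
Proof.
move=> mf f0; under eq_integral do rewrite -sumEFin.
rewrite ge0_integral_sum//; last by move=> i x _; rewrite lee_fin.
by move=> i; exact/measurable_EFinP.
Qed.

End NonnegativeIntegrals.

Lemma int_cst_prob d (T : measurableType d) (R : realType) (mu : probability T R) (c : R) :
  (\int[mu]_x c%:E = c%:E)%E.
Proof.
by rewrite integral_cst// [X in (_ * X)%E](_ : _ = 1%E) ?mule1//; exact: probability_setT.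
Qed.

Section Tonelli.
Local Open Scope ereal_scope.
Context {d1 d2 : measure_display} {T1 : measurableType d1} {T2 : measurableType d2}.
Context {R : realType} (m1 : probability T1 R) (m2 : probability T2 R).
Variable f : T1 * T2 -> R.
Hypothesis mf : measurable_fun [set: T1 * T2] f.
Hypothesis f0 : forall p, (0 <= f p)%R.

Lemma tonelli1 : \int[m1 \x m2]_p (f p)%:E = \int[m1]_x \int[m2]_y (f (x, y))%:E.
Proof.
by rewrite (fubini_tonelli1 (EFin \o f))//; exact/measurable_EFinP.
Qed.

Lemma tonelli2 : \int[m1 \x m2]_p (f p)%:E = \int[m2]_y \int[m1]_x (f (x, y))%:E.
Proof.
by rewrite (fubini_tonelli2 (EFin \o f))//; exact/measurable_EFinP.
Qed.

End Tonelli.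

Section EarthMover.
Local Open Scope ereal_scope.
Context {d : measure_display} {S : measurableType d} {R : realType}.
Implicit Types (mu nu : set S -> \bar R) (rho : S -> S -> R).

Lemma emd_ge0 rho mu nu : (forall x y, (0 <= rho x y)%R) -> 0 <= emd rho mu nu.
Proof.
by move=> r0; apply/ereal_infP => _ [g _ <-]; apply: int_ge0.
Qed.

Lemma emd_ext rho mu nu mu' nu' :
  (forall A, measurable A -> mu A = mu' A) -> (forall A, measurable A -> nu A = nu' A) ->
  emd rho mu nu = emd rho mu' nu'.
Proof.
move=> H K; rewrite /emd; congr (ereal_inf _); congr (_ @` _).
apply/seteqP; split => g gc A mA; have [] := gc A mA.
  by rewrite H// K.
by rewrite -H// -K.
Qed.

(** Upper bounds on [emd] are obtained by realising both laws on one probability space, here [T]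
    with [p] and [q]. *)
Lemma emd_le_push d' (T : measurableType d') (Q : probability T R) (p q : T -> S)
    rho mu nu :
  measurable_fun [set: T] p -> measurable_fun [set: T] q ->
  measurable_fun [set: S * S] (fun z : S * S => rho z.1 z.2) ->
  (forall x y, (0 <= rho x y)%R) ->
  (forall A, measurable A -> mu A = Q (p @^-1` A)) ->
  (forall A, measurable A -> nu A = Q (q @^-1` A)) ->
  emd rho mu nu <= \int[Q]_t (rho (p t) (q t))%:E.
Proof.
move=> mp mq mr r0 Hp Hq; pose mpq := measurable_fun_pair mp mq.
apply: ereal_inf_lbound; exists (push Q mpq).
  by move=> A mA; rewrite Hp// Hq.
rewrite (@integral_push _ _ _ _ _ Q _ mpq (fun z : S * S => (rho z.1 z.2)%:E))//.
  exact/measurable_EFinP.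
by move=> z; rewrite lee_fin.
Qed.

Lemma emd_sym rho mu nu :
  measurable_fun [set: S * S] (fun z : S * S => rho z.1 z.2) ->
  (forall x y, (0 <= rho x y)%R) -> (forall x y, rho x y = rho y x) ->
  emd rho mu nu = emd rho nu mu.
Proof.
move=> mr r0 rC.
have H mu' nu' : emd rho mu' nu' <= emd rho nu' mu'.
  apply/ereal_infP => _ [g gc <-]; under eq_integral do rewrite rC.
  apply: (@emd_le_push _ _ g snd fst) => //.
  - by move=> A mA; rewrite (gc A mA).2.
  - by move=> A mA; rewrite (gc A mA).1.
by apply/eqP; rewrite eq_le !H.
Qed.

(** Under every coupling the first point lies in [D] almost surely, so it is enough that the costs
    agree when their first argument is in [D]. The costs may be non-measurable. *)
Lemma emd_cost_ext rho rho' mu nu (D : set S) :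
  measurable D -> mu (~` D) = 0 ->
  (forall x y, (0 <= rho x y)%R) -> (forall x y, (0 <= rho' x y)%R) ->
  (forall x y, D x -> rho x y = rho' x y) ->
  emd rho mu nu = emd rho' mu nu.
Proof.
move=> mD muD r0 r0' rr; rewrite /emd; congr (ereal_inf _).
apply: eq_imagel => g gc; apply: (@eq_integral_full_set _ _ _ _ (fst @^-1` D)).
- by apply: preimage_measurable => //; exact: measurable_fst.
- by rewrite -muD -(gc _ (measurableC mD)).1.
- by move=> z; rewrite lee_fin.
- by move=> z; rewrite lee_fin.
- by move=> z /= Dz; rewrite rr.
Qed.

(* [G] is the density of a coupling of [al] and [be] with respect to [al \x be]. *)
Definition density_close rho (al be : probability S R) (e : R) : Prop :=
  exists G : S * S -> R, [/\ measurable_fun [set: S * S] G, forall z, (0 <= G z)%R,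
    forall x, \int[be]_y (G (x, y))%:E = 1,
    forall y, \int[al]_x (G (x, y))%:E = 1 &
    \int[al \x be]_z (rho z.1 z.2 * G z)%:E <= e%:E].

Lemma density_close_sym rho al be e :
  measurable_fun [set: S * S] (fun z : S * S => rho z.1 z.2) ->
  (forall x y, (0 <= rho x y)%R) -> (forall x y, rho x y = rho y x) ->
  density_close rho al be e -> density_close rho be al e.
Proof.
move=> mr r0 rC [G [mG G0 G1 G2 Ge]]; exists (fun z => G (z.2, z.1)).
have msw : measurable_fun [set: S * S] (fun z : S * S => (z.2, z.1)).
  by apply: measurable_fun_pair; [exact: measurable_snd | exact: measurable_fst].
have mGs : measurable_fun [set: S * S] (fun z : S * S => G (z.2, z.1)).
  exact: (measurableT_comp mG msw).
split => //; rewrite tonelli2/=.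
- move: Ge; rewrite tonelli1/=; first last.
  + by move=> z; rewrite mulr_ge0.
  + exact: measurable_funM.
  by under eq_integral do under eq_integral do rewrite rC.
- exact: measurable_funM.
- by move=> z; rewrite mulr_ge0.
Qed.

(** Gluing without disintegration. Under [Ga], of density [G (x, z.1)] with respect to [al \x g],
    the point [x] first travels to [z.1] according to the density [G], then to [z.2] according to
    the plan [g]. The cost is split by the triangle inequality. *)
Lemma emd_close rho (al be nu : probability S R) e :
  measurable_fun [set: S * S] (fun z : S * S => rho z.1 z.2) ->
  (forall x y, (0 <= rho x y)%R) ->
  (forall x y z, (rho x z <= rho x y + rho y z)%R) ->
  density_close rho al be e -> emd rho al nu <= emd rho be nu + e%:E.
Proof.
move=> mr r0 rtri [G [mG G0 G1 G2 Ge]].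
rewrite -leeBlDr//; apply/ereal_infP => _ [g gc <-]; rewrite leeBlDr//.
pose h (p : S * (S * S)) := G (p.1, p.2.1).
have mp1 : measurable_fun [set: S * (S * S)] (fun p : S * (S * S) => p.1).
  exact: measurable_fst.
have mp2 : measurable_fun [set: S * (S * S)] (fun p : S * (S * S) => p.2).
  exact: measurable_snd.
have mp21 : measurable_fun [set: S * (S * S)] (fun p : S * (S * S) => p.2.1).
  exact: (measurableT_comp (@measurable_fst _ _ _ _) mp2).
have mp22 : measurable_fun [set: S * (S * S)] (fun p : S * (S * S) => p.2.2).
  exact: (measurableT_comp (@measurable_snd _ _ _ _) mp2).
have mpair : measurable_fun [set: S * (S * S)] (fun p : S * (S * S) => (p.1, p.2.1)).
  exact: measurable_fun_pair.
have mh : measurable_fun [set: S * (S * S)] h by exact: (measurableT_comp mG mpair).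
have h0 p : (0 <= h p)%R by exact: G0.
have h1 : \int[al \x g]_p (h p)%:E = 1.
  rewrite tonelli2//= /h /=; under eq_integral do rewrite G2.
  by rewrite (int_cst_prob g 1).
pose Ga : probability (S * (S * S))%type R := density mh h0 h1.
have GaE (f : S * (S * S) -> R) : measurable_fun [set: S * (S * S)] f ->
    (forall p, (0 <= f p)%R) ->
    \int[Ga]_p (f p)%:E = \int[al \x g]_p (f p * h p)%:E.
  move=> mf f0; rewrite /Ga (integral_density mh h0 h1)//.
    exact/measurable_EFinP.
have mGx x : measurable_fun [set: S] (fun y => G (x, y)).
  exact: (measurableT_comp mG (pair1_measurable x)).
have mGy y : measurable_fun [set: S] (fun x => G (x, y)).
  exact: (measurableT_comp mG (pair2_measurable y)).
have gbe (f : S -> R) : measurable_fun [set: S] f -> (forall p, (0 <= f p)%R) ->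
    \int[g]_z (f z.1)%:E = \int[be]_y (f y)%:E.
  move=> mf f0; pose m1 := @measurable_fst _ _ S S.
  rewrite -(@integral_push _ _ _ _ _ g _ m1 (EFin \o f))//.
  - apply: eq_measure_integral => A mA _ /=.
    by rewrite [LHS]pushE (gc A mA).1.
  - exact/measurable_EFinP.
have Gaset (A : set (S * (S * S))) : measurable A ->
    Ga A = \int[al \x g]_p (\1_A p * h p)%:E.
  move=> mA; rewrite -(GaE (\1_A))//.
  by rewrite integral_indic// setIT.
have leG : emd rho al nu <= \int[Ga]_p (rho p.1 p.2.2)%:E.
  apply: (@emd_le_push _ _ Ga (fun p => p.1) (fun p => p.2.2)) => //.
  (* First marginal: for fixed [x], [G (x, z.1)] integrates to 1 over [g], because the first
     marginal of [g] is [be]. *)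
  - move=> A mA; rewrite Gaset; last exact: preimage_measurable.
    rewrite tonelli1/=; first last.
    + by move=> p; rewrite mulr_ge0.
    + apply: measurable_funM => //; apply: measurable_indic.
      exact: preimage_measurable.
    transitivity (\int[al]_x (\1_A x)%:E); first by rewrite integral_indic// setIT.
    apply: eq_integral => x _; rewrite /h /=.
    transitivity (\int[g]_z (\1_A x * G (x, z.1))%R%:E); last first.
      by apply: eq_integral => z _; rewrite !indicE.
    rewrite (@int_ge0Z _ _ _ g (fun z : S * S => G (x, z.1)) (\1_A x))//; last first.
      by exact: (measurableT_comp (mGx x) (@measurable_fst _ _ _ _)).
    by rewrite (gbe (fun y => G (x, y)))// G1 mule1.
  (* Second marginal: integrating over [x] first removes [G] and leaves the second marginal of
     [g]. *)
  - move=> A mA; rewrite Gaset; last exact: preimage_measurable.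
    rewrite tonelli2/=; first last.
    + by move=> p; rewrite mulr_ge0.
    + apply: measurable_funM => //; apply: measurable_indic.
      exact: preimage_measurable.
    rewrite -(gc A mA).2.
    transitivity (\int[g]_z (\1_(snd @^-1` A) z)%:E).
      rewrite integral_indic// ?setIT//; apply: preimage_measurable => //.
    apply: eq_integral => z _; rewrite /h /=.
    transitivity (\int[al]_x (\1_(snd @^-1` A) z * G (x, z.1))%R%:E); last first.
      by apply: eq_integral => x _; rewrite !indicE.
    by rewrite (@int_ge0Z _ _ _ al (fun x : S => G (x, z.1)) (\1_(snd @^-1` A) z))// G2 mule1.
apply: (le_trans leG).
have m1 : measurable_fun [set: S * (S * S)] (fun p => rho p.1 p.2.1).
  exact: (measurableT_comp mr mpair).
have m2 : measurable_fun [set: S * (S * S)] (fun p => rho p.2.1 p.2.2).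
  exact: (measurableT_comp mr mp2).
have m3 : measurable_fun [set: S * (S * S)] (fun p => rho p.1 p.2.2).
  by apply: (measurableT_comp mr (measurable_fun_pair mp1 mp22)).
apply: (@le_trans _ _ (\int[Ga]_p (rho p.1 p.2.1 + rho p.2.1 p.2.2)%R%:E)).
  by apply: int_ge0_le => //; exact: measurable_funD.
rewrite int_ge0D// addeC; apply: leeD.
  (* The leg from [z.1] to [z.2] does not involve [x]; integrating [x] out gives the cost of [g]. *)
  rewrite GaE// tonelli2/=; first last.
  - by move=> p; rewrite mulr_ge0.
  - exact: measurable_funM.
  rewrite le_eqVlt; apply/orP; left; apply/eqP.
  apply: eq_integral => z _; rewrite /h /=.
  by rewrite (@int_ge0Z _ _ _ al (fun x : S => G (x, z.1)) (rho z.1 z.2))// G2 mule1.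
(* The leg from [x] to [z.1] depends on [z] through its first coordinate only, of law [be]. *)
apply: le_trans Ge; rewrite GaE// !tonelli1/=; first last.
- by move=> p; rewrite mulr_ge0.
- exact: measurable_funM.
- by move=> p; rewrite mulr_ge0.
- exact: measurable_funM.
rewrite le_eqVlt; apply/orP; left; apply/eqP; apply: eq_integral => x _; rewrite /h /=.
rewrite (gbe (fun y => rho x y * G (x, y))%R)//.
  apply: measurable_funM => //.
  exact: (measurableT_comp mr (pair1_measurable x)).
by move=> y; rewrite mulr_ge0.
Qed.

End EarthMover.

(** * Soft couplings *)

Lemma int_compl d (T : measurableType d) (R : realType) (mu : probability T R)
    (f : T -> R) (c : R) :
  measurable_fun [set: T] f -> (forall x, 0 <= f x <= 1) ->
  (\int[mu]_x (f x)%:E = c%:E)%E -> (\int[mu]_x (1 - f x)%:E = (1 - c)%:E)%E.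
Proof.
move=> mf f01 fc.
have : (\int[mu]_x (1 - f x + f x)%:E = 1%:E)%E.
  by under eq_integral do rewrite subrK; rewrite int_cst_prob.
rewrite int_ge0D//.
- rewrite fc; case: (integral _ _ _) => // r; rewrite -EFinD => -[<-].
  by rewrite addrK.
- exact: measurable_funB.
- by move=> x; rewrite subr_ge0; case/andP: (f01 x).
- by move=> x; case/andP: (f01 x).
Qed.

Lemma int_prod d d' (T : measurableType d) (T' : measurableType d') (R : realType)
    (al : probability T R) (be : probability T' R) (u : T -> R) (v : T' -> R) :
  measurable_fun [set: T] u -> measurable_fun [set: T'] v ->
  (forall x, 0 <= u x) -> (forall y, 0 <= v y) ->
  (\int[al \x be]_p (u p.1 * v p.2)%:E =
   \int[al]_x (u x)%:E * \int[be]_y (v y)%:E)%E.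
Proof.
move=> mu mv u0 v0.
rewrite tonelli1/=; first last.
- by move=> p; rewrite mulr_ge0.
- apply: measurable_funM.
    exact: (measurableT_comp mu (@measurable_fst _ _ _ _)).
  exact: (measurableT_comp mv (@measurable_snd _ _ _ _)).
under eq_integral do rewrite int_ge0Z// muleC.
rewrite ge0_integralZl//; first by rewrite muleC.
- exact/measurable_EFinP.
- by move=> x _; rewrite lee_fin.
- exact: int_ge0.
Qed.

Section SoftCoupling.
Context {d : measure_display} {S : measurableType d} {R : realType}.
Variables (rho : S -> S -> R) (al be : probability S R).
Hypothesis mr : measurable_fun [set: S * S] (fun z : S * S => rho z.1 z.2).
Hypothesis r0 : forall x y, 0 <= rho x y.
Hypothesis rC : forall x y, rho x y = rho y x.
Hypothesis rtri : forall x y z, rho x z <= rho x y + rho y z.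
Variables (I : finType) (phi : I -> S -> R) (m m' : I -> R) (e : R).
Hypothesis mphi : forall i, measurable_fun [set: S] (phi i).
Hypothesis phi0 : forall i x, 0 <= phi i x.
Hypothesis phi1 : forall x, \sum_i phi i x <= 1.
Hypothesis phie : forall i x y, rho x y * (phi i x * phi i y) <= e * (phi i x * phi i y).
Hypothesis al_phi : forall i, (\int[al]_x (phi i x)%:E = (m i)%:E)%E.
Hypothesis be_phi : forall i, (\int[be]_x (phi i x)%:E = (m' i)%:E)%E.
Hypothesis e0 : 0 <= e.
Variables (x0 : S) (K a eta : R).
Hypothesis alK : (\int[al]_x ((rho x x0) ^+ 2)%:E <= K%:E)%E.
Hypothesis beK : (\int[be]_x ((rho x x0) ^+ 2)%:E <= K%:E)%E.
Hypothesis a0 : 0 < a.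
Hypothesis eta0 : 0 < eta.
Hypothesis eta1 : eta <= 1.

Let m0 i : 0 <= m i.
Proof. by rewrite -lee_fin -al_phi; exact: int_ge0. Qed.

Let m'0 i : 0 <= m' i.
Proof. by rewrite -lee_fin -be_phi; exact: int_ge0. Qed.

Let ceta : 0 <= 1 - eta.
Proof. by rewrite subr_ge0. Qed.

(** The intended weight is [(1 - eta)] over the maximum of [m i] and [m' i]. Cell [i] then matches
    the mass [c i * m i * m' i], that is, up to the factor [1 - eta], the smaller of its two
    masses. *)
Variables (c : I -> R) (r : R).
Hypothesis c0 : forall i, 0 <= c i.
Hypothesis cm_le : forall i, c i * m i <= 1 - eta.
Hypothesis cm'_le : forall i, c i * m' i <= 1 - eta.
Hypothesis cmm : forall i, c i * m i * m' i = (1 - eta) * Num.min (m i) (m' i).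
Hypothesis rE : r = 1 - (1 - eta) * \sum_i Num.min (m i) (m' i).

Let ok (t : I -> R) := forall i, 0 <= t i /\ c i * t i <= 1 - eta.

(* [c i] weighs the part of the cell [phi i] that is coupled within the cell; [kap] is the density
   of what is left, of mass [r] on both sides, which is coupled independently. Taking [eta > 0]
   keeps [r] away from [0], so that [G] below is normalised. *)
Let kap (t : I -> R) x := 1 - \sum_i c i * t i * phi i x.

Let mkap0 t : measurable_fun [set: S] (fun x => \sum_i c i * t i * phi i x).
Proof. by apply: measurable_sum => i; apply: measurable_funM. Qed.

Let kap01 t x : ok t ->
  0 <= \sum_i c i * t i * phi i x <= 1 - eta.
Proof.
move=> ti; apply/andP; split.
  by apply: sumr_ge0 => i _; rewrite !mulr_ge0//; case: (ti i).
apply: (@le_trans _ _ (\sum_i (1 - eta) * phi i x)).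
  by apply: ler_sum => i _; rewrite ler_wpM2r//; case: (ti i).
by rewrite -mulr_sumr ler_piMr.
Qed.

Let tm : ok m. Proof. by []. Qed.
Let tm' : ok m'. Proof. by []. Qed.

Let r_ge : eta <= r.
Proof.
have : (\int[be]_x (\sum_i c i * m i * phi i x)%:E <= (1 - eta)%:E)%E.
  rewrite -(int_cst_prob be (1 - eta)); apply: int_ge0_le => //.
  - by move=> x; case/andP: (kap01 x tm).
  - by move=> x; case/andP: (kap01 x tm).
rewrite int_ge0_sum//; last 2 first.
- by move=> i; exact: measurable_funM.
- by move=> i x; rewrite !mulr_ge0.
under eq_bigr do rewrite int_ge0Z ?mulr_ge0// be_phi -EFinM cmm.
by rewrite sumEFin lee_fin -mulr_sumr rE lerBrDr addrC -lerBrDr.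
Qed.

Let r_gt0 : 0 < r. Proof. exact: lt_le_trans r_ge. Qed.

(** The remainder on one side is built from the cell masses [t] of the other side. This cross
    pairing makes both remainders have mass [r]. *)
Let int_kap (mu : probability S R) (t w : I -> R) :
  ok t ->
  (forall i, (\int[mu]_x (phi i x)%:E = (w i)%:E)%E) ->
  (forall i, t i * w i = m i * m' i) ->
  (\int[mu]_x (kap t x)%:E = r%:E)%E.
Proof.
move=> ti wi tw; rewrite rE /kap; apply: int_compl => //.
  move=> x; have /andP[h1 h2] := kap01 x ti; by rewrite h1/= (le_trans h2)// gerBl ltW.
rewrite int_ge0_sum//; last 2 first.
- by move=> i; exact: measurable_funM.
- by move=> i x; rewrite !mulr_ge0//; case: (ti i).
under eq_bigr => i _.
  rewrite int_ge0Z//; last by rewrite mulr_ge0//; case: (ti i).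
  rewrite wi -EFinM -mulrA tw mulrA cmm; over.
by rewrite sumEFin -mulr_sumr.
Qed.

Let int_kap_al : (\int[al]_x (kap m' x)%:E = r%:E)%E.
Proof. by apply: (int_kap tm' al_phi) => i; rewrite mulrC. Qed.

Let int_kap_be : (\int[be]_x (kap m x)%:E = r%:E)%E.
Proof. by apply: (int_kap tm be_phi) => i. Qed.

Let kap_ge0 t x : ok t -> 0 <= kap t x.
Proof. move=> ti; have /andP[h1 h2] := kap01 x ti; by rewrite /kap subr_ge0 (le_trans h2)// gerBl ltW. Qed.

Let kap_le1 t x : ok t -> kap t x <= 1.
Proof. move=> ti; have /andP[h1 h2] := kap01 x ti; by rewrite /kap gerBl. Qed.

Let mkap t : measurable_fun [set: S] (kap t).
Proof. by apply: measurable_funB. Qed.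

Let G (p : S * S) := \sum_i c i * phi i p.1 * phi i p.2 + kap m' p.1 * kap m p.2 / r.

Let mfst (f : S -> R) : measurable_fun [set: S] f ->
  measurable_fun [set: S * S] (fun p => f p.1).
Proof. by move=> mf; exact: (measurableT_comp mf (@measurable_fst _ _ _ _)). Qed.

Let msnd (f : S -> R) : measurable_fun [set: S] f ->
  measurable_fun [set: S * S] (fun p => f p.2).
Proof. by move=> mf; exact: (measurableT_comp mf (@measurable_snd _ _ _ _)). Qed.

Let mG : measurable_fun [set: S * S] G.
Proof.
apply: measurable_funD; last first.
  by apply: measurable_funM => //; apply: measurable_funM; [exact: mfst|exact: msnd].
apply: measurable_sum => i; apply: measurable_funM; last exact: msnd.
by apply: measurable_funM => //; exact: mfst.
Qed.

Let G0 p : 0 <= G p.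
Proof.
rewrite addr_ge0//; first by apply: sumr_ge0 => i _; rewrite !mulr_ge0.
by rewrite divr_ge0// ?mulr_ge0 ?kap_ge0// ltW.
Qed.

(** Covers both marginals of [G]. The cells contribute the sum of the [c i * w i * phi i x], and the
    independent part contributes [kap w x], which is by definition its complement to 1. *)
Let G1 (mu : probability S R) (t w : I -> R) (x : S) :
  ok t ->
  ok w ->
  (forall i, (\int[mu]_x (phi i x)%:E = (w i)%:E)%E) ->
  (\int[mu]_x (kap t x)%:E = r%:E)%E ->
  (\int[mu]_y (\sum_i c i * phi i x * phi i y + kap w x / r * kap t y)%:E = 1)%E.
Proof.
move=> ti wi muw mukap.
have cphi i : 0 <= c i * phi i x by rewrite mulr_ge0.
have kr : 0 <= kap w x / r by rewrite divr_ge0 ?kap_ge0// ltW.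
rewrite int_ge0D//; last 3 first.
- exact: measurable_funM.
- by move=> y; apply: sumr_ge0 => i _; rewrite !mulr_ge0.
- by move=> y; rewrite mulr_ge0// kap_ge0.
rewrite int_ge0Z//; last by move=> y; rewrite kap_ge0.
rewrite mukap int_ge0_sum//; last 2 first.
- by move=> i; exact: measurable_funM.
- by move=> i y; rewrite !mulr_ge0.
under eq_bigr do rewrite int_ge0Z// muw -EFinM mulrAC.
rewrite sumEFin -EFinM divfK ?gt_eqF// -EFinD.
by rewrite /kap addrC subrK.
Qed.

(** The term [e] pays for pairs matched within a cell. The independent remainder is paid through the
    base point [x0]: a constant [2 * a] on mass [r], plus a multiple of the second moment on either
    side. *)
Lemma soft_close_weights : density_close rho al be (e + (2 * a * r + K / (2 * a))).
Proof.
exists G; split => //.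
- move=> x; rewrite -[RHS](G1 x tm tm' be_phi int_kap_be).
  by apply: eq_integral => y _; rewrite /G /= mulrAC.
- move=> y; rewrite -[RHS](G1 y tm' tm al_phi int_kap_al).
  apply: eq_integral => x _; rewrite /G /= [kap m' x * _]mulrC mulrAC.
  by under eq_bigr do rewrite mulrAC.
have mrx : measurable_fun [set: S] (fun x => rho x x0).
  exact: (measurableT_comp mr (pair2_measurable x0)).
pose A x := (4 * a)^-1 * (rho x x0) ^+ 2.
have i4a : 0 <= (4 * a)^-1 by rewrite invr_ge0 mulr_ge0// ltW.
have A0 x : 0 <= A x by rewrite mulr_ge0// sqr_ge0.
have mA : measurable_fun [set: S] A.
  by apply: measurable_funM => //; exact: measurable_funX.
have AK (mu : probability S R) : (\int[mu]_x ((rho x x0) ^+ 2)%:E <= K%:E)%E ->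
    (\int[mu]_x (A x)%:E <= ((4 * a)^-1 * K)%:E)%E.
  move=> muK; rewrite int_ge0Z//.
  - by rewrite EFinM; apply: lee_wpmul2l.
  - exact: measurable_funX.
  - by move=> x; exact: sqr_ge0.
(* Completing the square: with [s = rho x x0], the difference is [(s - 2 * a) ^+ 2 / (4 * a)]. *)
have A2 x : rho x x0 <= a + A x.
  rewrite /A; have := sqr_ge0 (rho x x0 - 2 * a).
  have -> : a + (4 * a)^-1 * rho x x0 ^+ 2 =
    rho x x0 + (4 * a)^-1 * (rho x x0 - 2 * a) ^+ 2 by field; rewrite gt_eqF.
  by move=> h; rewrite lerDl mulr_ge0.
have k'0 x : 0 <= kap m' x by exact: kap_ge0.
have k0 x : 0 <= kap m x by exact: kap_ge0.
have k'1 x : kap m' x <= 1 by exact: kap_le1.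
have k1 x : kap m x <= 1 by exact: kap_le1.
have ri0 : 0 <= r^-1 by rewrite invr_ge0 ltW.
(* [B1] bounds the cell part, [B2] the constant [2 * a] on the remainder. In [B3] and [B4] one
   factor [kap], at most 1, is dropped, so that each integral is a product of a moment and a
   mass. *)
pose B1 (p : S * S) := e * G p.
pose B2 (p : S * S) := (2 * a / r * kap m' p.1) * kap m p.2.
pose B3 (p : S * S) := A p.1 * (r^-1 * kap m p.2).
pose B4 (p : S * S) := r^-1 * kap m' p.1 * A p.2.
have bound p : rho p.1 p.2 * G p <= B1 p + (B2 p + (B3 p + B4 p)).
  rewrite /B1 /G [leLHS]mulrDr (mulrDr e) -addrA; apply: lerD.
    rewrite !mulr_sumr; apply: ler_sum => i _.
    have := phie i p.1 p.2; have := c0 i.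
    rewrite -!mulrA !(mulrCA _ (c i)) => ci h; exact: ler_wpM2l.
  have X0 : 0 <= kap m' p.1 * kap m p.2 / r by rewrite !mulr_ge0.
  have H1 : rho p.1 p.2 <= 2 * a + (A p.1 + A p.2).
    by have := rtri p.1 x0 p.2; have := A2 p.1; have := A2 p.2; rewrite (rC x0); lra.
  have H2 : rho p.1 p.2 * (kap m' p.1 * kap m p.2 / r) <=
     (2 * a + (A p.1 + A p.2)) * (kap m' p.1 * kap m p.2 / r) by exact: ler_wpM2r.

  have H3 : A p.1 * (kap m' p.1 * kap m p.2 / r) <= B3 p.
    rewrite /B3 ler_wpM2l// [leRHS]mulrC -mulrA ler_piMl//.
    by rewrite mulr_ge0.
  have H4 : A p.2 * (kap m' p.1 * kap m p.2 / r) <= B4 p.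
    rewrite /B4 [leRHS]mulrC ler_wpM2l// [leRHS]mulrC ler_wpM2r//.
    by rewrite ler_piMr.
  have H5 : 2 * a * (kap m' p.1 * kap m p.2 / r) = B2 p.
    by rewrite /B2; ring.
  have H6 : 0 <= e * (kap m' p.1 * kap m p.2 / r) by rewrite mulr_ge0.
  have H7 (x1 x2 x3 w : R) : (x1 + (x2 + x3)) * w = x1 * w + (x2 * w + x3 * w) by ring.
  rewrite H7 H5 in H2; apply: (le_trans H2); rewrite -[leLHS]add0r; apply: lerD => //.
  by rewrite lerD2l lerD.
have mB1 : measurable_fun [set: S * S] B1 by exact: measurable_funM.
have mB2 : measurable_fun [set: S * S] B2.
  by apply: measurable_funM; [apply: measurable_funM => //; exact: mfst|exact: msnd].
have mB3 : measurable_fun [set: S * S] B3.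
  by apply: measurable_funM; [exact: mfst|apply: measurable_funM => //; exact: msnd].
have mB4 : measurable_fun [set: S * S] B4.
  by apply: measurable_funM; [apply: measurable_funM => //; exact: mfst|exact: msnd].
have B10 p : 0 <= B1 p by rewrite mulr_ge0.
have B20 p : 0 <= B2 p by rewrite !mulr_ge0// ltW.
have B30 p : 0 <= B3 p by rewrite !mulr_ge0.
have B40 p : 0 <= B4 p by rewrite !mulr_ge0.
apply: (@le_trans _ _ (\int[al \x be]_p (B1 p + (B2 p + (B3 p + B4 p)))%:E)%E).
  apply: int_ge0_le => //.
  - exact: measurable_funM.
  - by apply: measurable_funD => //; apply: measurable_funD => //; exact: measurable_funD.
  - by move=> p; rewrite mulr_ge0.
have mB34 := measurable_funD mB3 mB4.
have B340 p : 0 <= B3 p + B4 p by rewrite addr_ge0.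
rewrite int_ge0D//; last 2 first.
- exact: measurable_funD.
- by move=> p; rewrite !addr_ge0.
rewrite EFinD; apply: leeD.
  rewrite int_ge0Z// tonelli2//.
  under eq_integral => y _.
    rewrite (_ : \int[al]_x _ = 1)%E; last first.
      rewrite -[RHS](G1 y tm' tm al_phi int_kap_al).
      apply: eq_integral => x _; rewrite /G /= [kap m' x * _]mulrC mulrAC.
      by under eq_bigr do rewrite mulrAC.
    over.
  by rewrite (int_cst_prob be 1) mule1.
rewrite int_ge0D// EFinD; apply: leeD.
  rewrite /B2 (@int_prod _ _ _ _ _ al be (fun x => 2 * a / r * kap m' x) (kap m))//; last 2 first.
  - exact: measurable_funM.
  - by move=> x; rewrite !mulr_ge0// ltW.
  rewrite int_kap_be int_ge0Z//; last by rewrite !mulr_ge0// ltW.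
  by rewrite int_kap_al -!EFinM divfK ?gt_eqF.
rewrite int_ge0D// (_ : K / (2 * a) = (4 * a)^-1 * K + (4 * a)^-1 * K); last first.
  by field; rewrite gt_eqF.
rewrite EFinD; apply: leeD.
  rewrite /B3 (@int_prod _ _ _ _ _ al be A (fun y => r^-1 * kap m y))//; last 2 first.
  - exact: measurable_funM.
  - by move=> x; rewrite !mulr_ge0.
  rewrite [X in (_ * X)%E]int_ge0Z// int_kap_be -EFinM mulVf ?gt_eqF// mule1.
  exact: AK.
rewrite /B4 (@int_prod _ _ _ _ _ al be (fun x => r^-1 * kap m' x) A)//; last 2 first.
- exact: measurable_funM.
- by move=> x; rewrite !mulr_ge0.
rewrite int_ge0Z// int_kap_al -EFinM mulVf ?gt_eqF// mul1e.
exact: AK.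
Qed.

End SoftCoupling.

Lemma density_close_le d (S : measurableType d) (R : realType) (rho : S -> S -> R)
    (al be : probability S R) e e' :
  e <= e' -> density_close rho al be e -> density_close rho al be e'.
Proof.
move=> ee [G [h1 h2 h3 h4 h5]]; exists G; split => //.
by apply: le_trans h5 _; rewrite lee_fin.
Qed.

(** * Partitions of unity by tents *)

Section PartitionOfUnity.
Context {R : realType} {S : Type}.
Variables (h : nat -> S -> R).
Hypothesis h01 : forall i x, 0 <= h i x <= 1.

(** The continuous analogue of making a sequence of sets disjoint: part [i] takes the fraction [h i]
    of what the earlier parts have left. *)
Definition unity_part (i : nat) (x : S) := h i x * \prod_(j < i) (1 - h j x).

Let prod01 N x : 0 <= \prod_(j < N) (1 - h j x) <= 1.
Proof.
apply/andP; split.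
  by apply: prodr_ge0 => i _; rewrite subr_ge0; case/andP: (h01 i x).
apply: prodr_ile1 => i _; rewrite subr_ge0 gerBl.
by case/andP: (h01 i x) => -> ->.
Qed.

Lemma unity_part01 i x : 0 <= unity_part i x <= 1.
Proof.
have /andP[a b] := h01 i x; have /andP[c e] := prod01 i x.
by rewrite /unity_part mulr_ge0//= mulr_ile1.
Qed.

(** The sum telescopes: after [N] parts, what is left is the product of the [1 - h j]. *)
Lemma unity_part_sum N x :
  \sum_(i < N) unity_part i x = 1 - \prod_(j < N) (1 - h j x).
Proof.
elim: N => [|N IH]; first by rewrite !big_ord0 subrr.
by rewrite !big_ord_recr /= IH /unity_part; ring.
Qed.

Lemma unity_part_sum_le1 N x : \sum_(i < N) unity_part i x <= 1.
Proof. by rewrite unity_part_sum gerBl; case/andP: (prod01 N x). Qed.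

Lemma unity_part_sum1 N x i : (i < N)%N -> h i x = 1 -> \sum_(i < N) unity_part i x = 1.
Proof.
move=> iN hi; rewrite unity_part_sum (bigD1 (Ordinal iN))//= hi subrr mul0r.
by rewrite subr0.
Qed.

End PartitionOfUnity.

Section Tent.
Context {R : realType}.

(** With [e > 0] and [t] the distance to a center, a Lipschitz substitute for the indicator of a
    ball: 1 up to radius [e], 0 from [2 * e] on, affine between. *)
Definition tent (e t : R) : R := Num.max 0 (Num.min 1 (2 - t / e)).

Lemma tent01 e t : 0 <= tent e t <= 1.
Proof. by rewrite /tent le_max lexx ge_max ler01 ge_min lexx. Qed.

Lemma tent1 e t : 0 < e -> t <= e -> tent e t = 1.
Proof.
move=> e0 te; have : t / e <= 1 by rewrite ler_pdivrMr// mul1r.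
move=> h; rewrite /tent.
have -> : Num.min 1 (2 - t / e) = 1 by apply/min_idPl; lra.
by apply/max_idPr.
Qed.

Lemma tent_neq0 e t : 0 < e -> tent e t != 0 -> t <= 2 * e.
Proof.
move=> e0; apply: contraR; rewrite -ltNge => te.
have h : 2 <= t / e by rewrite ler_pdivlMr// ltW.
rewrite /tent; apply/eqP/max_idPl; rewrite ge_min; apply/orP; right; lra.
Qed.

Lemma tent_lip e s t : 0 < e -> `|tent e s - tent e t| <= `|s - t| / e.
Proof.
move=> e0.
have -> : `|s - t| / e = `|(2 - s / e) - (2 - t / e)|.
  have -> : 2 - s / e - (2 - t / e) = - ((s - t) / e) by ring.
  by rewrite normrN normrM [`|e^-1|]gtr0_norm// invr_gt0.
rewrite /tent; move: (2 - s / e) (2 - t / e) => u v.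
have E (w : R) : [\/ w <= 0 /\ Num.max 0 (Num.min 1 w) = 0,
    0 <= w <= 1 /\ Num.max 0 (Num.min 1 w) = w |
    1 <= w /\ Num.max 0 (Num.min 1 w) = 1].
  have [w1|w1] := leP 1 w; first by constructor 3; split => //; apply/max_idPr.
  have [w0|w0] := leP w 0; first by constructor 1; split => //; apply/max_idPl.
  by constructor 2; rewrite !ltW//; split => //; apply/max_idPr; exact: ltW.
rewrite ler_norml; have := ler_norm (u - v); have := ler_norm (- (u - v)).
rewrite normrN; have := normr_ge0 (u - v); move: `|u - v| => n.
by case: (E u) => -[hu ->]; case: (E v) => -[hv ->]; lra.
Qed.

End Tent.

Lemma near_forall_lt (P : nat -> nat -> Prop) N :
  (forall i, \forall n \near \oo, P i n) ->
  \forall n \near \oo, forall i, (i < N)%N -> P i n.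
Proof.
move=> H; elim: N => [|N IH]; first by apply: nearW.
near=> n => i; rewrite ltnS leq_eqVlt => /orP[/eqP->|]; first by near: n; exact: H.
by move: i; near: n.
Unshelve. all: by end_near. Qed.

(** * From convergence of cell masses to couplings with densities *)

Section DensityCloseEventually.
Context {d : measure_display} {S : measurableType d} {R : realType}.
Variables (rho : S -> S -> R).
Hypothesis mr : measurable_fun [set: S * S] (fun z : S * S => rho z.1 z.2).
Hypothesis r0 : forall x y, 0 <= rho x y.
Hypothesis rC : forall x y, rho x y = rho y x.
Hypothesis rtri : forall x y z, rho x z <= rho x y + rho y z.
Variable z : nat -> S.

Definition tent_part (e : R) (i : nat) (x : S) : R :=
  unity_part (fun j y => tent e (rho y (z j))) i x.

Lemma measurable_metric_center i : measurable_fun [set: S] (fun y => rho y (z i)).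
Proof. exact: (measurableT_comp mr (pair2_measurable (z i))). Qed.

Lemma measurable_tent e i : measurable_fun [set: S] (fun y => tent e (rho y (z i))).
Proof.
apply: measurable_maxr => //; apply: measurable_minr => //.
apply: measurable_funB => //; apply: measurable_funM => //.
exact: measurable_metric_center.
Qed.

Lemma measurable_tent_part e i : measurable_fun [set: S] (tent_part e i).
Proof.
apply: measurable_funM; first exact: measurable_tent.
apply: measurable_prod => j _; apply: measurable_funB => //.
exact: measurable_tent.
Qed.

Lemma tent_part01 e i x : 0 <= tent_part e i x <= 1.
Proof. by apply: unity_part01 => j y; exact: tent01. Qed.

Lemma int_tent_part (mu : probability S R) e i :
  (\int[mu]_x (tent_part e i x)%:E = (fine (\int[mu]_x (tent_part e i x)%:E))%:E)%E.
Proof.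
rewrite fineK// ge0_fin_numE; last first.
  by apply: int_ge0 => x; case/andP: (tent_part01 e i x).
apply: (@le_lt_trans _ _ 1%:E); last exact: ltry.
rewrite -(int_cst_prob mu 1); apply: int_ge0_le => //.
- exact: measurable_tent_part.
- by move=> x; case/andP: (tent_part01 e i x).
- by move=> x; case/andP: (tent_part01 e i x).
Qed.

Lemma int_tent_part_push d' (T : measurableType d') (Q : probability T R) (U : T -> S)
    (mU : measurable_fun [set: T] U) e i :
  (\int[push Q mU]_x (tent_part e i x)%:E = \int[Q]_w (tent_part e i (U w))%:E)%E.
Proof.
rewrite (@integral_push _ _ _ _ _ Q _ mU (fun x => (tent_part e i x)%:E))//.
- by apply/measurable_EFinP; exact: measurable_tent_part.
- by move=> x; rewrite lee_fin; case/andP: (tent_part01 e i x).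
Qed.

Variables (al : nat -> probability S R) (be : probability S R) (D : set S).
Hypothesis mD : measurable D.
Hypothesis beD : be (~` D) = 0%E.
Hypothesis Dz : forall x, D x -> forall e : R, 0 < e -> exists i, rho x (z i) < e.
Variables (x0 : S) (K : R).
Hypothesis K0 : 0 < K.
Hypothesis alK : forall n, (\int[al n]_x ((rho x x0) ^+ 2)%:E <= K%:E)%E.
Hypothesis beK : (\int[be]_x ((rho x x0) ^+ 2)%:E <= K%:E)%E.
Hypothesis cvg_part : forall e i, 0 < e ->
  (fun n => fine (\int[al n]_x (tent_part e i x)%:E)) @ \oo
    --> fine (\int[be]_x (tent_part e i x)%:E).

Let mass e N : R := \sum_(i < N) fine (\int[be]_x (tent_part e i x)%:E).

Let massE e N : ((mass e N)%:E = \int[be]_x (\sum_(i < N) tent_part e i x)%:E)%E.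
Proof.
rewrite int_ge0_sum//; last 2 first.
- by move=> i; exact: measurable_tent_part.
- by move=> i x; case/andP: (tent_part01 e i x).
by rewrite /mass -sumEFin; apply: eq_bigr => i _; rewrite -int_tent_part.
Qed.

(** The balls of radius [e] around the centers cover [D], so finitely many carry almost all the mass
    of [be]. On their union the parts sum to 1. *)
Let mass_cvg1 e t : 0 < e -> 0 < t -> exists N, 1 - t < mass e N.
Proof.
move=> e0 t0.
pose E N := \bigcup_(i in [set i | (i < N)%N]) [set x | rho x (z i) < e].
have mE1 i : measurable [set x : S | rho x (z i) < e].
  rewrite -[X in measurable X]setTI.
  have -> : [set x | rho x (z i) < e] = (fun x => rho x (z i)) @^-1` `]-oo, e[.
    by apply/seteqP; split => y /=; rewrite in_itv.
  exact: measurable_metric_center.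
have mE N : measurable (E N) by apply: bigcup_measurable.
have mEE : measurable (\bigcup_N E N) by exact: bigcupT_measurable.
have beE : be (\bigcup_N E N) = 1%E.
  have H : be (~` \bigcup_N E N) = 0%E.
    apply: (subset_measure0 _ _ _ beD); [exact: measurableC|exact: measurableC|].
    apply: subsetC => x /Dz /(_ e e0)[i xi]; exists i.+1 => //; exists i => //=.
  have := probability_setC be (measurableC mEE); rewrite setCK => ->.
  by rewrite [X in (_ - X)%E](_ : _ = 0%E)// sube0.
have ndE : nondecreasing_seq E.
  by move=> n m nm; apply/subsetPset => x [i /= iN xi]; exists i => //=; exact: leq_trans nm.
have cv : (be \o E) @ \oo --> 1%:E.
  rewrite [X in _ --> X](_ : _ = be (\bigcup_N E N)); last by rewrite -[1%:E]beE.
  exact: nondecreasing_cvg_mu.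
have /fine_cvgP[_ /cvgrPdist_lt/(_ t t0)[N _ HN]] := cv.
exists N; have := HN N (leqnn N); rewrite /= => /ltr_normlP[_].
have fE : be (E N) \is a fin_num by exact: fin_num_measure.
rewrite ltrBlDl -ltrBlDr => h1; apply: (lt_le_trans h1).
rewrite -lee_fin fineK// massE.
apply: (@le_trans _ _ (\int[be]_x (\1_(E N) x)%:E)%E).
  by rewrite integral_indic// setIT.
apply: int_ge0_le => //.
- by apply: measurable_sum => i; exact: measurable_tent_part.
- move=> x; rewrite indicE; have [|_] := boolP (x \in E N); last first.
    by apply: sumr_ge0 => i _; case/andP: (tent_part01 e i x).
  rewrite inE => -[i /= iN xi].
  rewrite (@unity_part_sum1 _ _ _ _ _ i)//; by apply: tent1 => //; exact: ltW.
Qed.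

(** Finitely many small cells carry nearly all of [be], and the mass of each under [al n] converges,
    so all but a mass [t] is eventually matched inside cells. *)
Lemma density_close_eventually (eps : R) : 0 < eps ->
  \forall n \near \oo, density_close rho (al n) be eps.
Proof.
(* A cell has diameter at most [4 * e = eps / 4]; also [K / (2 * a) = eps / 4] and
   [2 * a * t = eps / 4]. The bound [t] on the unmatched mass [r] is shared equally by the mass
   outside the cells, the error [q] summed over the [N] cells, and [eta]. *)
move=> eps0; pose e := eps / 16; pose a := 2 * K / eps; pose t := eps ^+ 2 / (16 * K).
have e0 : 0 < e by rewrite divr_gt0.
have a0 : 0 < a by rewrite divr_gt0// mulr_gt0.
have t0 : 0 < t by rewrite divr_gt0// ?exprn_gt0// mulr_gt0.
pose eta := Num.min 1 (t / 3).
have eta0 : 0 < eta by rewrite lt_min ltr01/= divr_gt0.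
have eta1 : eta <= 1 by rewrite ge_min lexx.
have etat : eta <= t / 3 by rewrite ge_min lexx orbT.
have t30 : 0 < t / 3 by rewrite divr_gt0.
have [N HN] := mass_cvg1 e0 t30.
have [q q0 qN] : exists2 q : R, 0 < q & q * N%:R <= t / 3.
  (* The successor keeps the divisor nonzero when there are no cells. *)
  exists (t / 3 / N.+1%:R); first by rewrite divr_gt0.
  rewrite -mulrA ler_piMr ?(ltW t30)//.
  by rewrite mulrC ler_pdivrMr// mul1r ler_nat.
pose m (mu : probability S R) (i : 'I_N) := fine (\int[mu]_x (tent_part e i x)%:E).
have : \forall n \near \oo, forall i, (i < N)%N ->
   `|fine (\int[be]_x (tent_part e i x)%:E) - fine (\int[al n]_x (tent_part e i x)%:E)|
      < q.
  by apply: near_forall_lt => i; move/cvgrPdist_lt: (@cvg_part e i e0); exact.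
apply: filterS => n Hn.
have m0 mu i : 0 <= m mu i.
  by rewrite fine_ge0//; apply: int_ge0 => x; case/andP: (tent_part01 e i x).
have summin : 1 - 2 * (t / 3) <= \sum_i Num.min (m (al n) i) (m be i).
  have : \sum_i (m be i - q) <= \sum_i Num.min (m (al n) i) (m be i).
    apply: ler_sum => i _; have /ltr_normlP[h1 h2] := Hn i (ltn_ord i).
    rewrite le_min -/(m be i) -/(m (al n) i) in h1 h2 *.
    apply/andP; split; lra.
  rewrite sumrB sumr_const card_ord -mulr_natr => h.
  have h3 : 1 - t / 3 < \sum_i m be i := HN.
  lra.
have summin1 : \sum_i Num.min (m (al n) i) (m be i) <= 1.
  apply: (@le_trans _ _ (mass e N)).
    by apply: ler_sum => i _; rewrite ge_min lexx orbT.
  rewrite -lee_fin massE -(int_cst_prob be 1); apply: int_ge0_le => //.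
  - by apply: measurable_sum => i; exact: measurable_tent_part.
  - by move=> x; apply: sumr_ge0 => i _; case/andP: (tent_part01 e i x).
  - by move=> x; apply: unity_part_sum_le1 => i y; exact: tent01.
pose r := 1 - (1 - eta) * \sum_i Num.min (m (al n) i) (m be i).
have rt : r <= t.
  have : eta * \sum_i Num.min (m (al n) i) (m be i) <= eta by rewrite ler_piMr// ltW.
  rewrite /r mulrBl mul1r; lra.
(* If both masses vanish, the convention on division by 0 gives [c i = 0], and the required
   relations still hold. *)
pose c i := (1 - eta) / Num.max (m (al n) i) (m be i).
have ceta : 0 <= 1 - eta by rewrite subr_ge0.
have c0 i : 0 <= c i by rewrite /c divr_ge0// le_max m0.
have cm_le s i : s <= Num.max (m (al n) i) (m be i) -> c i * s <= 1 - eta.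
  move=> si; have [M0|M0] := leP (Num.max (m (al n) i) (m be i)) 0.
    have -> : c i = 0.
      rewrite /c (_ : Num.max _ _ = 0) ?invr0 ?mulr0//; apply/eqP.
      by rewrite eq_le M0 le_max m0.
    by rewrite mul0r.
  by rewrite /c mulrAC -mulrA ler_piMr// ler_pdivrMr// mul1r.
have cmm i : c i * m (al n) i * m be i = (1 - eta) * Num.min (m (al n) i) (m be i).
  rewrite /c; have [mm|mm] := leP (m (al n) i) (m be i).
    have [m'z|m'n0] := eqVneq (m be i) 0; last by field.
    have mz : m (al n) i = 0 by apply/eqP; rewrite eq_le m0 andbT -m'z.
    by rewrite mz m'z !mulr0.
  have mn0 : m (al n) i != 0 by rewrite gt_eqF// (le_lt_trans _ mm).
  by field.
have := @soft_close_weights _ S R rho (al n) be mr r0 rC rtri 'I_N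
  (fun i => tent_part e i) (m (al n)) (m be) (eps / 4).
move=> /(_ _ _ _ _ _ _ _ x0 K a eta (alK n) beK a0 eta0 eta1 c r c0).
move=> H; apply: (density_close_le _ (H _ _ _ _ _ _ _ _ _ _ _)) => {H}.
- have h1 : 2 * a * r <= 2 * a * t by rewrite ler_wpM2l// mulr_ge0// ltW.
  have h2 : 2 * a * t = eps / 4.
    rewrite /a /t; field; rewrite !gt_eqF//.
  have h3 : K / (2 * a) = eps / 4.
    rewrite /a; field; rewrite !gt_eqF//.
  lra.
- by move=> i; exact: measurable_tent_part.
- by move=> i x; case/andP: (tent_part01 e i x).
- by move=> x; apply: unity_part_sum_le1 => i y; exact: tent01.
- move=> i x y; rewrite /tent_part /unity_part.
  set bx := tent e (rho x _); set by_ := tent e (rho y _).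
  have [->|bx0] := eqVneq bx 0; first by rewrite !mul0r !mulr0.
  have [->|by0] := eqVneq by_ 0; first by rewrite !mul0r !mulr0.
  apply: ler_wpM2r.
    rewrite mulr_ge0//.
    + by case/andP: (tent_part01 e i x).
    + by case/andP: (tent_part01 e i y).
  have := tent_neq0 e0 bx0; have := tent_neq0 e0 by0.
  have := rtri x (z i) y; rewrite (rC (z i)) /e; lra.
- by move=> i; exact: int_tent_part.
- by move=> i; exact: int_tent_part.
- by rewrite divr_ge0// ltW.
- by move=> i; apply: cm_le; rewrite le_max lexx.
- by move=> i; apply: cm_le; rewrite le_max lexx orbT.
- exact: cmm.
- by [].
Qed.

End DensityCloseEventually.

(** * Earth mover's covariance *)

Lemma int_le_full_set d (T : measurableType d) (R : realType)
    (mu : {measure set T -> \bar R}) (D : set T) (f g : T -> R) :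
  measurable D -> mu (~` D) = 0%E -> measurable_fun [set: T] f ->
  measurable_fun [set: T] g -> (forall x, 0 <= f x) -> (forall x, 0 <= g x) ->
  (forall x, D x -> f x <= g x) ->
  (\int[mu]_x (f x)%:E <= \int[mu]_x (g x)%:E)%E.
Proof.
move=> mD muD mf mg f0 g0 fg.
rewrite (integral_full_set mD muD); last by move=> x; rewrite lee_fin.
rewrite [leRHS](integral_full_set mD muD); last by move=> x; rewrite lee_fin.
apply: ge0_le_integral => //.
- by move=> x _; rewrite lee_fin.
- by apply: measurable_funTS; exact/measurable_EFinP.
- by apply: measurable_funTS; exact/measurable_EFinP.
Qed.

Lemma int_eq_full_set d (T : measurableType d) (R : realType)
    (mu : {measure set T -> \bar R}) (D : set T) (f g : T -> R) :
  measurable D -> mu (~` D) = 0%E -> (forall x, 0 <= f x) -> (forall x, 0 <= g x) ->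
  (forall x, D x -> f x = g x) ->
  (\int[mu]_x (f x)%:E = \int[mu]_x (g x)%:E)%E.
Proof.
move=> mD muD f0 g0 fg; apply: (eq_integral_full_set mD muD).
- by move=> x; rewrite lee_fin.
- by move=> x; rewrite lee_fin.
- by move=> x Dx; rewrite fg.
Qed.

Lemma prob0_setU d (T : measurableType d) (R : realType) (mu : probability T R) A B :
  measurable A -> measurable B -> mu A = 0%E -> mu B = 0%E -> mu (A `|` B) = 0%E.
Proof.
move=> mA mB A0 B0; apply/eqP; rewrite eq_le measure_ge0 andbT.
have := measureU2 mu mA mB.
by rewrite [X in (_ <= X + _)%E]A0 [X in (_ <= _ + X)%E]B0 adde0.
Qed.

Section ManhattanMetric.
Context {R : realType} {M : pointedType} (δ : M -> M -> R).
Hypothesis Hδ : is_metric δ.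
Variable z : nat -> M.
Local Notation mm := (mmetric δ z).
Local Notation dm := (dman mm : Borel δ * Borel δ -> Borel δ * Borel δ -> R).

Lemma measurable_mmetric_comp d (T : measurableType d) (f g : T -> Borel δ) :
  measurable_fun [set: T] f -> measurable_fun [set: T] g ->
  measurable_fun [set: T] (fun t => mm (f t) (g t)).
Proof.
move=> mf mg.
exact: (measurableT_comp (measurable_mmetric Hδ z) (measurable_fun_pair mf mg)).
Qed.

Lemma measurable_dman_mmetric :
  measurable_fun [set: (Borel δ * Borel δ) * (Borel δ * Borel δ)]
    (fun p : (Borel δ * Borel δ) * (Borel δ * Borel δ) => dm p.1 p.2).
Proof.
apply: measurable_funD; apply: measurable_mmetric_comp.
- exact: (measurableT_comp (@measurable_fst _ _ _ _) (@measurable_fst _ _ _ _)).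
- exact: (measurableT_comp (@measurable_fst _ _ _ _) (@measurable_snd _ _ _ _)).
- exact: (measurableT_comp (@measurable_snd _ _ _ _) (@measurable_fst _ _ _ _)).
- exact: (measurableT_comp (@measurable_snd _ _ _ _) (@measurable_snd _ _ _ _)).
Qed.

Lemma dman_mmetric_ge0 p q : 0 <= dm p q.
Proof. by rewrite addr_ge0// mmetric_ge0. Qed.

Lemma dman_mmetricC p q : dm p q = dm q p.
Proof. by rewrite /dman (mmetricC Hδ _ p.1) (mmetricC Hδ _ p.2). Qed.

Lemma dman_mmetric_tri p q s : dm p s <= dm p q + dm q s.
Proof.
by rewrite /dman addrACA lerD// mmetric_tri.
Qed.

Lemma similarity_measurable (f : M -> M) : similarity δ f ->
  measurable_fun [set: Borel δ] (f : Borel δ -> Borel δ).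
Proof.
move=> [c [c0 fc]] _ B mB; rewrite setTI.
suff : <<s mopen δ >> `<=` [set A | measurable (f @^-1` A : set (Borel δ))] by exact.
apply: smallest_sub => /=.
  split => /=.
  - by rewrite preimage_set0.
  - move=> A mA; rewrite setTD; rewrite preimage_setC; exact: measurableC.
  - by move=> F mF; rewrite preimage_bigcup; exact: bigcupT_measurable.
move=> A oA; apply: mopen_measurable => x /= /oA[r [r0 rA]].
exists (r / c); split; first by rewrite divr_gt0.
by move=> y; rewrite ltr_pdivlMr// mulrC -fc; exact: rA.
Qed.

End ManhattanMetric.

Section IndependentCopies.
Context {R : realType} {M : pointedType} (δ : M -> M -> R).
Context {d : measure_display} {Om : measurableType d} (P : probability Om R).
Implicit Types X Y : Om -> Borel δ.

(** Hence the infimum over independent copies in [eCov] is taken over copies of one law. *)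
Lemma indep_copy_law_unique X Y (nu nu' : probability (Borel δ * Borel δ)%type R) :
  measurable_fun [set: Om] X -> measurable_fun [set: Om] Y ->
  indep_copy_law P X Y nu -> indep_copy_law P X Y nu' ->
  forall A, measurable A -> nu A = nu' A.
Proof.
move=> mX mY nuE nu'E A mA.
have H (m : probability (Borel δ * Borel δ)%type R) : indep_copy_law P X Y m ->
    (push P mX \x push P mY)%E A = m A.
  by move=> mE; apply: product_measure_unique => // B C mB mC; rewrite mE.
by rewrite -(H nu)// (H nu').
Qed.

Lemma indep_copy_law_push d' (T : measurableType d') (Q : probability T R)
    (p : T -> Borel δ * Borel δ) (mp : measurable_fun [set: T] p) X Y :
  (forall A B, measurable A -> measurable B ->
     Q (p @^-1` (A `*` B)) = (P (X @^-1` A) * P (Y @^-1` B))%E) ->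
  indep_copy_law P X Y (push Q mp).
Proof. by move=> H A B mA mB; rewrite -H. Qed.

Variables (X Y : Om -> Borel δ).
Hypotheses (mX : measurable_fun [set: Om] X) (mY : measurable_fun [set: Om] Y).

Lemma measurable_pair_rv : measurable_fun [set: Om] (fun w => (X w, Y w)).
Proof. exact: measurable_fun_pair. Qed.

Lemma measurable_fst_rv : measurable_fun [set: Om * Om] (fun w => X w.1).
Proof. exact: (measurableT_comp mX (@measurable_fst _ _ _ _)). Qed.

Lemma measurable_snd_rv : measurable_fun [set: Om * Om] (fun w => X w.2).
Proof. exact: (measurableT_comp mX (@measurable_snd _ _ _ _)). Qed.

End IndependentCopies.

Section EarthMoverCovariance.
Context {R : realType} {M : pointedType} (δ : M -> M -> R).
Hypothesis Hδ : is_metric δ.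
Variable z : nat -> M.
Context {d : measure_display} {Om : measurableType d} (P : probability Om R).
Local Notation mm := (mmetric δ z).
Local Notation dm := (dman mm : Borel δ * Borel δ -> Borel δ * Borel δ -> R).
Implicit Types X Y : Om -> Borel δ.

Definition separable_law (X : Om -> Borel δ) :=
  P (X @^-1` (~` mclosure δ z)) = 0%E.

Definition indep_pair (X Y : Om -> Borel δ) (w : Om * Om) : Borel δ * Borel δ :=
  (X w.1, Y w.2).

Lemma measurable_indep_pair X Y :
  measurable_fun [set: Om] X -> measurable_fun [set: Om] Y ->
  measurable_fun [set: Om * Om] (indep_pair X Y).
Proof.
move=> mX mY; apply: measurable_fun_pair.
  exact: measurable_fst_rv.
exact: measurable_snd_rv.
Qed.

Lemma prod_rect (A B : set Om) : measurable A -> measurable B ->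
  ((P \x P) (A `*` B) = P A * P B)%E.
Proof. by move=> mA mB; rewrite product_measure1E. Qed.

Lemma indep_pair_law X Y
  (mX : measurable_fun [set: Om] X) (mY : measurable_fun [set: Om] Y) :
  indep_copy_law P X Y (push (P \x P)%E (measurable_indep_pair mX mY)).
Proof.
apply: indep_copy_law_push => A B mA mB; rewrite -prod_rect//;
  by apply: preimage_measurable.
Qed.

Lemma separable_fst X : measurable_fun [set: Om] X -> separable_law X ->
  measurable ((fun w : Om * Om => X w.1) @^-1` mclosure δ z) /\
  (P \x P)%E (~` ((fun w : Om * Om => X w.1) @^-1` mclosure δ z)) = 0%E.
Proof.
move=> mX sX; have mC := measurable_mclosure Hδ z.
split; first exact: preimage_measurable (measurable_fst_rv mX) mC.
rewrite (_ : ~` _ = (X @^-1` (~` mclosure δ z)) `*` setT); last first.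
  by apply/seteqP; split => [w h|w []]; [split|].
rewrite prod_rect//; last by apply: preimage_measurable => //; exact: measurableC.
by rewrite [X in (X * _)%E]sX mul0e.
Qed.

(** Two simplifications at once: the infimum over [nu] collapses to one concrete law, and the cost
    becomes measurable, since the joint law is carried by the square of [mclosure δ z]. *)
Lemma eCovE X Y (mX : measurable_fun [set: Om] X) (mY : measurable_fun [set: Om] Y) :
  separable_law X -> separable_law Y ->
  eCov P X Y = emd dm (push P (measurable_pair_rv mX mY))
                      (push (P \x P)%E (measurable_indep_pair mX mY)).
Proof.
move=> sX sY; set nu0 := push (P \x P)%E _.
have nu0P : indep_copy_law P X Y nu0 by exact: indep_pair_law.
have E nu : indep_copy_law P X Y nu ->
    @emd R _ (Borel δ * Borel δ)%type (dman δ) (joint_law P X Y) nu =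
    emd dm (push P (measurable_pair_rv mX mY)) nu0.
  move=> nuP; have mC := measurable_mclosure Hδ z.
  rewrite (@emd_cost_ext _ (Borel δ * Borel δ)%type R (dman δ) dm _ _
    ((mclosure δ z : set (Borel δ)) `*` (mclosure δ z : set (Borel δ)))).
  - by apply: emd_ext => // A mA; exact: indep_copy_law_unique nuP nu0P _ mA.
  - exact: measurableX.
  - rewrite /joint_law; set C := mclosure δ z in mC *.
    have mXC : measurable (X @^-1` (~` C)).
      by apply: preimage_measurable => //; exact: measurableC.
    have mYC : measurable (Y @^-1` (~` C)).
      by apply: preimage_measurable => //; exact: measurableC.
    rewrite (_ : _ @^-1` _ = X @^-1` (~` C) `|` Y @^-1` (~` C)); last first.
      apply/seteqP; split => w /=; last by case => h [].
      by move=> /not_andP[]; [left|right].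
    exact: prob0_setU.
  - by move=> p q; rewrite addr_ge0// (is_metric_ge0 Hδ).
  - by move=> p q; exact: dman_mmetric_ge0.
  - by move=> p q [/= h1 h2]; rewrite /dman !mmetricE.
apply/eqP; rewrite eq_le; apply/andP; split.
  by apply: ereal_inf_lbound; exists nu0 => //; exact: E.
by apply/ereal_infP => _ [nu nuP <-]; rewrite E.
Qed.

(** The quantity [V X] of the overview, with the measurable cost in place of [δ]. *)
Definition selfdist (X : Om -> Borel δ) : \bar R :=
  (\int[P \x P]_w (mm (X w.1) (X w.2))%:E)%E.

Lemma measurable_mm_fst_snd X Y :
  measurable_fun [set: Om] X -> measurable_fun [set: Om] Y ->
  measurable_fun [set: Om * Om] (fun w => mm (X w.1) (Y w.2)).
Proof.
move=> mX mY; apply: measurable_mmetric_comp => //.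
  exact: measurable_fst_rv.
exact: measurable_snd_rv.
Qed.

Lemma eCov_le_selfdist X Y (mX : measurable_fun [set: Om] X)
    (mY : measurable_fun [set: Om] Y) :
  separable_law X -> separable_law Y ->
  (eCov P X Y <= selfdist X)%E /\ (eCov P X Y <= selfdist Y)%E.
Proof.
move=> sX sY; rewrite (eCovE mX mY)//.
have mXY : measurable_fun [set: Om * Om] (fun w => (X w.1, Y w.1)).
  by apply: measurable_fun_pair; exact: measurable_fst_rv.
have mXY' : measurable_fun [set: Om * Om] (fun w => (X w.2, Y w.1)).
  by apply: measurable_fun_pair; [exact: measurable_snd_rv|exact: measurable_fst_rv].
have joint A : measurable A ->
    push P (measurable_pair_rv mX mY) A =
    (P \x P)%E ((fun w : Om * Om => (X w.1, Y w.1)) @^-1` A).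
  move=> mA; rewrite [RHS](_ : _ = (P \x P)%E (((fun w => (X w, Y w)) @^-1` A) `*` setT)).
    rewrite prod_rect ?probability_setT ?mule1//.
    by apply: preimage_measurable => //; exact: measurable_pair_rv.
  by congr (_ _); apply/seteqP; split => [w h|w []]; [split|].
(* A realisation of the independent copy that shares [Y w.1] with the pair [(X w.1, Y w.1)]. *)
have swap : indep_copy_law P X Y (push (P \x P)%E mXY').
  apply: indep_copy_law_push => A B mA mB.
  rewrite muleC -prod_rect//; try exact: preimage_measurable.
  by congr (_ _); apply/seteqP; split => w [].
(* The shared coordinate costs nothing only where it lies in the closure, as [mm] need not vanish on
   the rest of the diagonal. *)
have [mYc PYc] := separable_fst mY sY; have [mXc PXc] := separable_fst mX sX.
have dm0 := dman_mmetric_ge0 Hδ z.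
split.
- apply: (@le_trans _ _ (\int[P \x P]_w (dm (X w.1, Y w.1) (X w.2, Y w.1))%:E)%E).
    apply: emd_le_push => //; first exact: measurable_dman_mmetric.
    move=> A mA; apply: indep_copy_law_unique swap _ mA => //; exact: indep_pair_law.
  rewrite (int_eq_full_set mYc PYc (g := fun w => mm (X w.1) (X w.2)))//.
    by move=> w; exact: mmetric_ge0.
  by move=> w /= h; rewrite /dman/= [X in _ + X]mmetricE// is_metric_xx// addr0.
- apply: (@le_trans _ _ (\int[P \x P]_w (dm (X w.1, Y w.1) (X w.1, Y w.2))%:E)%E).
    apply: emd_le_push => //; first exact: measurable_indep_pair.
    exact: measurable_dman_mmetric.
  rewrite (int_eq_full_set mXc PXc (g := fun w => mm (Y w.1) (Y w.2)))//.
    by move=> w; exact: mmetric_ge0.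
  by move=> w /= h; rewrite /dman/= [X in X + _]mmetricE// is_metric_xx// add0r.
Qed.

Lemma selfdist_similarity X (f : M -> M) c : measurable_fun [set: Om] X ->
  separable_law X -> separable_law (fun w => f (X w) : Borel δ) ->
  measurable_fun [set: Borel δ] (f : Borel δ -> Borel δ) ->
  0 < c -> (forall x y, δ (f x) (f y) = c * δ x y) ->
  selfdist (fun w => f (X w) : Borel δ) = (c%:E * selfdist X)%E.
Proof.
move=> mX sX sfX mf c0 fc.
have mfX : measurable_fun [set: Om] (fun w => f (X w) : Borel δ).
  exact: (measurableT_comp mf mX).
rewrite /selfdist -int_ge0Z ?ltW//; last 2 first.
- exact: measurable_mm_fst_snd.
- by move=> w; exact: mmetric_ge0.
have [m1 P1] := separable_fst mX sX; have [m2 P2] := separable_fst mfX sfX.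
apply: (int_eq_full_set (measurableI _ _ m1 m2)).
- by rewrite setCI; apply: prob0_setU => //; exact: measurableC.
- by move=> w; exact: mmetric_ge0.
- by move=> w; rewrite mulr_ge0 ?mmetric_ge0// ltW.
- by move=> w [h1 h2]; rewrite !mmetricE.
Qed.

(* Under any coupling of (X, f X) with an independent copy (u, v), [f u] travels to [f X] and from there to [v]. *)
Lemma selfdist_le_eCov X (f : M -> M) c : measurable_fun [set: Om] X ->
  separable_law X -> separable_law (fun w => f (X w) : Borel δ) ->
  measurable_fun [set: Borel δ] (f : Borel δ -> Borel δ) ->
  0 < c -> (forall x y, δ (f x) (f y) = c * δ x y) ->
  (((Num.max 1 c)^-1)%:E * selfdist (fun w => f (X w) : Borel δ)
    <= eCov P X (fun w => f (X w) : Borel δ))%E.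
Proof.
move=> mX sX sfX mf c0 fc.
have mfX : measurable_fun [set: Om] (fun w => f (X w) : Borel δ).
  exact: (measurableT_comp mf mX).
rewrite (eCovE mX mfX)//; apply/ereal_infP => _ [g gc <-].
set C := Num.max 1 c.
have C1 : 1 <= C by rewrite le_max lexx.
have cC : c <= C by rewrite le_max lexx orbT.
have C0 : 0 < C by exact: lt_le_trans C1.
have iC0 : 0 <= C^-1 by rewrite invr_ge0 ltW.
have iC1 : C^-1 <= 1 by rewrite invf_le1.
have iCc : C^-1 * c <= 1 by rewrite mulrC ler_pdivrMr// mul1r.
pose BB := (Borel δ * Borel δ)%type.
pose F (q : BB) := mm (f q.1) q.2.
have mF : measurable_fun [set: BB] F.
  apply: measurable_mmetric_comp => //.
  exact: (measurableT_comp mf (@measurable_fst _ _ _ _)).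
have F0 q : 0 <= F q by exact: mmetric_ge0.
have mF1 : measurable_fun [set: BB * BB] (fun p => F p.1).
  exact: (measurableT_comp mF (@measurable_fst _ _ _ _)).
have mF2 : measurable_fun [set: BB * BB] (fun p => F p.2).
  exact: (measurableT_comp mF (@measurable_snd _ _ _ _)).
have marg1 (h : BB -> R) : measurable_fun [set: BB] h -> (forall q, 0 <= h q) ->
    (\int[g]_p (h p.1)%:E = \int[P]_w (h (X w, f (X w)))%:E)%E.
  move=> mh h0; have mhE : measurable_fun [set: BB] (EFin \o h) by exact/measurable_EFinP.
  rewrite -(@integral_push _ _ _ _ _ g _ (@measurable_fst _ _ BB BB) (EFin \o h))//.
  rewrite -(@integral_push _ _ _ _ _ P _ (measurable_pair_rv mX mfX) (EFin \o h))//.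
  by apply: eq_measure_integral => A mA _; rewrite [LHS]pushE (gc A mA).1.
have marg2 (h : BB -> R) : measurable_fun [set: BB] h -> (forall q, 0 <= h q) ->
    (\int[g]_p (h p.2)%:E = \int[P \x P]_w (h (X w.1, f (X w.2)))%:E)%E.
  move=> mh h0; have mhE : measurable_fun [set: BB] (EFin \o h) by exact/measurable_EFinP.
  rewrite -(@integral_push _ _ _ _ _ g _ (@measurable_snd _ _ BB BB) (EFin \o h))//.
  rewrite -(@integral_push _ _ _ _ _ (P \x P)%E _ (measurable_indep_pair mX mfX) (EFin \o h))//.
  by apply: eq_measure_integral => A mA _; rewrite [LHS]pushE (gc A mA).2.
(* The first marginal of [g] sits on the graph of [f], where [F] vanishes almost surely. *)
have F1 : (\int[g]_p (F p.1)%:E = 0)%E.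
  rewrite marg1//.
  have mC := measurable_mclosure Hδ z.
  rewrite (int_eq_full_set (D := (fun w => f (X w)) @^-1` mclosure δ z) (g := fun=> 0))//.
  - by rewrite integral0.
  - exact: (preimage_measurable mfX mC).
  - by move=> w h; rewrite /F /= mmetricE// is_metric_xx.
have F2 : (\int[g]_p (F p.2)%:E = selfdist (fun w => f (X w) : Borel δ))%E.
  by rewrite marg2.
rewrite -F2 -int_ge0Z//.
pose D : set (BB * BB) := (fun p => f p.1.1) @^-1` mclosure δ z.
have mf11 : measurable_fun [set: BB * BB] (fun p => f p.1.1 : Borel δ).
  apply: (measurableT_comp mf).
  exact: (measurableT_comp (@measurable_fst _ _ _ _) (@measurable_fst _ _ _ _)).
have mD : measurable D := preimage_measurable mf11 (measurable_mclosure Hδ z).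
have gD : g (~` D) = 0%E.
  pose E : set BB := (fun q => f q.1) @^-1` (~` mclosure δ z).
  have mE : measurable E.
    have mf1 : measurable_fun [set: BB] (fun q => f q.1 : Borel δ).
      exact: (measurableT_comp mf (@measurable_fst _ _ _ _)).
    apply: (preimage_measurable mf1); apply: measurableC; exact: measurable_mclosure.
  by have := (gc E mE).1; rewrite pushE => h; rewrite [LHS]h; exact: sfX.
have mdm := measurable_dman_mmetric Hδ z.
have dm0 := dman_mmetric_ge0 Hδ z.
(* The term [F p.1], of integral 0, is added to make the comparison pointwise. *)
apply: (@le_trans _ _ (\int[g]_p (dm p.1 p.2 + F p.1)%:E)%E); last first.
  by rewrite int_ge0D// F1 adde0.
apply: (int_le_full_set mD gD) => //.
- exact: measurable_funM.
- exact: measurable_funD.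
- by move=> p; rewrite mulr_ge0.
- by move=> p; rewrite addr_ge0.
- move=> [[x y] [u v]]; rewrite /D /F /dman /= => fx.
  (* The route is [f u], [f x], [y], [v]. After division by [C], the maximum of 1 and [c], every
     coefficient is at most 1. *)
  have h1 : mm (f u) v <= c * mm x u + (mm (f x) y + mm y v).
    have := mmetric_tri Hδ z (f x) (f u) v; have := mmetric_tri Hδ z y (f x) v.
    have -> : mm (f u) (f x) = c * δ x u by rewrite mmetricC// mmetricE// fc.
    have : c * δ x u <= c * mm x u by apply: ler_wpM2l; [exact: ltW|exact: metric_le_mmetric].
    lra.
  have g1 : 0 <= mm x u by exact: mmetric_ge0.
  have g2 : 0 <= mm (f x) y by exact: mmetric_ge0.
  have g3 : 0 <= mm y v by exact: mmetric_ge0.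
  apply: (le_trans (ler_wpM2l iC0 h1)); rewrite !mulrDr mulrA.
  have k1 : C^-1 * c * mm x u <= mm x u by rewrite ler_piMl.
  have k2 : C^-1 * mm (f x) y <= mm (f x) y by rewrite ler_piMl.
  have k3 : C^-1 * mm y v <= mm y v by rewrite ler_piMl.
  lra.
Qed.

(** With [V = selfdist X], the upper bounds are [V] and [c * V], the lower bound is [c * V] over the
    maximum of 1 and [c]. They meet, since [c] is the product of its minimum and its maximum with
    1. *)
Lemma eCov_similarity X (f : M -> M) c : measurable_fun [set: Om] X ->
  separable_law X -> separable_law (fun w => f (X w) : Borel δ) ->
  measurable_fun [set: Borel δ] (f : Borel δ -> Borel δ) ->
  0 < c -> (forall x y, δ (f x) (f y) = c * δ x y) ->
  eCov P X (fun w => f (X w) : Borel δ) = ((Num.min 1 c)%:E * selfdist X)%E.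
Proof.
move=> mX sX sfX mf c0 fc.
have mfX : measurable_fun [set: Om] (fun w => f (X w) : Borel δ).
  exact: (measurableT_comp mf mX).
have := selfdist_le_eCov mX sX sfX mf c0 fc.
have [] := eCov_le_selfdist mX mfX sX sfX.
rewrite (selfdist_similarity mX sX sfX mf c0 fc) => h1 h2 h3.
apply/eqP; rewrite eq_le; move: h3; rewrite muleA -EFinM.
have [c1|c1] := leP 1 c.
  by rewrite mulVf ?gt_eqF// mul1e => ->; rewrite h1.
by rewrite invr1 mul1r => ->; rewrite h2.
Qed.

Lemma eVarE X : measurable_fun [set: Om] X -> separable_law X ->
  eVar P X = selfdist X.
Proof.
move=> mX sX; rewrite /eVar (@eCov_similarity X id 1)//.
- by rewrite minxx mul1e.
- by move=> x y; rewrite mul1r.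
Qed.

Lemma selfdist_ge0 X : (0 <= selfdist X)%E.
Proof. by apply: int_ge0 => w; exact: mmetric_ge0. Qed.

Lemma selfdist_lty X : measurable_fun [set: Om] X -> separable_law X ->
  finite_first_moment P X -> (selfdist X < +oo)%E.
Proof.
move=> mX sX [x0 Xx0].
have mXx0 : measurable_fun [set: Om] (fun w => δ (X w) x0).
  exact: (measurableT_comp (measurable_metric1 Hδ x0) mX).
have d0 w : 0 <= δ (X w) x0 by exact: (is_metric_ge0 Hδ).
have m1 : measurable_fun [set: Om * Om] (fun w => δ (X w.1) x0).
  exact: (measurableT_comp mXx0 (@measurable_fst _ _ _ _)).
have m2 : measurable_fun [set: Om * Om] (fun w => δ (X w.2) x0).
  exact: (measurableT_comp mXx0 (@measurable_snd _ _ _ _)).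
have [mc Pc] := separable_fst mX sX.
apply: (@le_lt_trans _ _ (\int[P \x P]_w (δ (X w.1) x0 + δ (X w.2) x0)%:E)%E).
  apply: (int_le_full_set mc Pc) => //.
  - exact: measurable_mm_fst_snd.
  - exact: measurable_funD.
  - by move=> w; exact: mmetric_ge0.
  - by move=> w; rewrite addr_ge0.
  - move=> w h; rewrite mmetricE// (is_metric_sym Hδ (X w.2)); exact: is_metric_tri.
rewrite int_ge0D// tonelli1// tonelli2//=; apply: lte_add_pinfty.
  by under eq_integral do rewrite int_cst_prob.
by under eq_integral do rewrite int_cst_prob.
Qed.

(** If the mean distance is 0, then for almost every [x] the mean distance to [X x] is 0. Fixing one
    such [x] shows that [X] is almost surely the constant [X x]. *)
Lemma selfdist_gt0 X : measurable_fun [set: Om] X -> separable_law X ->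
  Defs.nondegenerate P X -> (0 < selfdist X)%E.
Proof.
move=> mX sX; apply: contra_notP => /negP; rewrite -leNgt => le0.
have : selfdist X = 0%E by apply/eqP; rewrite eq_le le0 selfdist_ge0.
have mm12 := measurable_mm_fst_snd mX mX.
have mm0 (w : Om * Om) : 0 <= mm (X w.1) (X w.2) by exact: mmetric_ge0.
rewrite /selfdist tonelli1//= => h0.
have mI : measurable_fun [set: Om] (fun x => \int[P]_y (mm (X x) (X y))%:E)%E.
  apply: (@measurable_fun_fubini_tonelli_F _ _ _ _ _ P
     (fun w : Om * Om => (mm (X w.1) (X w.2))%:E)) => //.
  exact/measurable_EFinP.
have [N [mN PN HN]] : {ae P, forall x, [set: Om] x -> (\int[P]_y (mm (X x) (X y))%:E = 0)%E}.
  apply/(ae_eq_integral_abs P measurableT mI).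
  rewrite -[RHS]h0; apply: eq_integral => x _; rewrite gee0_abs//.
  by apply: int_ge0 => y; exact: mmetric_ge0.
(* A null set cannot be all of a probability space. *)
have [x Nx] : exists x, ~ N x.
  apply: contrapT => /forallNP NT; have : P N = 1%E.
    by rewrite -(probability_setT P); congr (P _); apply/seteqP; split => // x _; exact: contrapT.
  by rewrite PN => /eqP; rewrite eq_sym onee_eq0.
have Ix : (\int[P]_y (mm (X x) (X y))%:E = 0)%E.
  by apply: contrapT => h; apply: Nx; apply: HN => /(_ I).
have mx : measurable_fun [set: Om] (fun y => mm (X x) (X y)).
  exact: (measurable_mmetric_comp Hδ z (measurable_cst (X x)) mX).
exists (X x).
have [N' [mN' PN' HN']] : {ae P, forall y, [set: Om] y -> ((mm (X x) (X y))%:E = 0%:E)%E}.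
  apply/(ae_eq_integral_abs P measurableT) => //; first exact/measurable_EFinP.
  rewrite -[RHS]Ix; apply: eq_integral => y _; rewrite gee0_abs//.
  by rewrite lee_fin mmetric_ge0.
exists N'; split => //; apply: subset_trans HN' => y /= h1 h2; apply: h1.
apply/esym/(is_metric_eq0 Hδ); have [h3] := h2 I.
apply/eqP; rewrite eq_le (is_metric_ge0 Hδ) andbT -h3; exact: metric_le_mmetric.
Qed.

Lemma eCov_ge0 X Y : measurable_fun [set: Om] X -> measurable_fun [set: Om] Y ->
  separable_law X -> separable_law Y -> (0 <= eCov P X Y)%E.
Proof.
by move=> mX mY sX sY; rewrite (eCovE mX mY)//; apply: emd_ge0; exact: dman_mmetric_ge0.
Qed.

Lemma eCov_fin X Y : measurable_fun [set: Om] X -> measurable_fun [set: Om] Y ->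
  separable_law X -> separable_law Y -> finite_first_moment P X ->
  eCov P X Y \is a fin_num.
Proof.
move=> mX mY sX sY fX; rewrite ge0_fin_numE ?eCov_ge0//.
exact: le_lt_trans (eCov_le_selfdist mX mY sX sY).1 (selfdist_lty mX sX fX).
Qed.

End EarthMoverCovariance.

(** * Vanishing covariance *)

Section OpenRectangles.
Context {R : realType} {M : pointedType} (δ : M -> M -> R).
Hypothesis Hδ : is_metric δ.
Variable z : nat -> M.
Local Notation dm :=
  (dman (mmetric δ z) : Borel δ * Borel δ -> Borel δ * Borel δ -> R).
Variables al be : probability (Borel δ * Borel δ)%type R.

(** Erosion of [U] by radius [r]. Its complement is open for any [U], which gives measurability. *)
Let inner (r : R) (U : set M) : set M := [set x | forall y, δ x y < r -> U y].

Let measurable_inner r U : measurable (inner r U : set (Borel δ)).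
Proof.
rewrite -[inner r U]setCK; apply: measurableC; apply: mopen_measurable.
move=> x /existsNP[y /not_implyP[xy Uy]]; exists (r - δ x y); split; first by lra.
move=> x' xx' /(_ y) H; apply: Uy; apply: H.
by have := is_metric_tri Hδ x x' y; rewrite (is_metric_sym Hδ x' x); lra.
Qed.

(** A plan of tiny cost moves little mass from the eroded rectangle [W n] out of [U] times [V], by
    Markov's inequality. The eroded rectangles increase to the open one. *)
Lemma emd0_open_rect_le (U V : set M) : emd dm al be = 0%E ->
  mopen δ U -> mopen δ V -> (al (U `*` V) <= be (U `*` V))%E.
Proof.
move=> e0 oU oV.
pose r n : R := n.+1%:R^-1.
have r0 n : 0 < r n by rewrite invr_gt0 ltr0Sn.
pose W n : set (Borel δ * Borel δ) := inner (r n) U `*` inner (r n) V.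
have mW n : measurable (W n) by apply: measurableX; exact: measurable_inner.
have mUV : measurable ((U : set (Borel δ)) `*` (V : set (Borel δ))).
  by apply: measurableX; exact: mopen_measurable.
have WE : \bigcup_n W n = U `*` V.
  apply/seteqP; split => [[x y] [n _ [/= h1 h2]]|[x y] [/= Ux Vy]].
    by split; [apply: h1|apply: h2]; rewrite is_metric_xx.
  have [s [s0 Hs]] := oU x Ux; have [t [t0 Ht]] := oV y Vy.
  have st0 : 0 < Num.min s t by rewrite lt_min s0.
  have /cvgrPdist_lt/(_ _ st0)[N _ HN] := @cvg_harmonic R.
  have := HN N (leqnn _); rewrite /= sub0r normrN ger0_norm ?invr_ge0// lt_min => /andP[h1 h2].
  exists N => //; split => /= w xw; first by apply: Hs; exact: lt_trans h1.
  by apply: Ht; exact: lt_trans h2.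
have ndW : nondecreasing_seq W.
  move=> n m nm; apply/subsetPset => -[x y] [/= h1 h2].
  have rnm : r m <= r n by rewrite lef_pV2 ?posrE// ler_nat.
  by split => w xw; [apply: h1|apply: h2]; exact: lt_le_trans rnm.
have mWW : measurable (\bigcup_n W n) by exact: bigcupT_measurable.
have cv : (al \o W) @ \oo --> al (\bigcup_n W n) by exact: nondecreasing_cvg_mu.
rewrite -WE in mUV *; rewrite -(cvg_lim _ cv)//; apply: lime_le.
  by apply/cvg_ex; eexists; exact: cv.
apply: nearW => n /=; apply/lee_addgt0Pr => e ee0.
(* Leaving the rectangle from [W n] costs at least [r n], so a plan of cost below [e * r n] lets at
   most mass [e] escape. *)
have : (emd dm al be < (e * r n)%:E)%E by rewrite e0 lte_fin mulr_gt0.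
move=> /ereal_inf_lt[_ [g gc <-] gr].
have mdm := measurable_dman_mmetric Hδ z.
have dm0 := dman_mmetric_ge0 Hδ z.
pose BB := (Borel δ * Borel δ)%type.
have i0 : 0 <= (r n)^-1 by rewrite invr_ge0 ltW.
have mf1 : measurable (fst @^-1` W n : set (BB * BB)).
  by apply: preimage_measurable => //; exact: measurable_fst.
have mf2 : measurable (snd @^-1` (\bigcup_n W n) : set (BB * BB)).
  by apply: preimage_measurable => //; exact: measurable_snd.
have -> : al (W n) = (\int[g]_p (\1_(fst @^-1` W n) p)%:E)%E.
  rewrite integral_indic// setIT; symmetry; exact: (gc _ (mW n)).1.
have -> : be (\bigcup_n W n) = (\int[g]_p (\1_(snd @^-1` (\bigcup_n W n)) p)%:E)%E.
  rewrite integral_indic// setIT; symmetry; exact: (gc _ mWW).2.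
have mdr : measurable_fun [set: BB * BB] (fun p : BB * BB => (r n)^-1 * dm p.1 p.2).
  exact: measurable_funM.
apply: (@le_trans _ _ (\int[g]_p (\1_(snd @^-1` (\bigcup_n W n)) p
     + (r n)^-1 * dm p.1 p.2)%:E)%E).
  apply: int_ge0_le => //.
    by apply: measurable_funD => //; exact: measurable_indic.
  move=> [p q] /=; rewrite !indicE.
  have [pW|_] := boolP (_ \in fst @^-1` W n); last by rewrite addr_ge0// mulr_ge0.
  have [_|qW] := boolP (_ \in snd @^-1` _); first by rewrite lerDl mulr_ge0.
  rewrite add0r mulrC ler_pdivlMr// mul1r leNgt; apply/negP => pq.
  move: qW; rewrite notin_setE /=; apply; rewrite WE.
  move: pW; rewrite inE /= => -[/= h1 h2].
  have c1 := metric_le_mmetric Hδ z p.1 q.1; have c2 := metric_le_mmetric Hδ z p.2 q.2.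
  have c3 := mmetric_ge0 Hδ z p.1 q.1; have c4 := mmetric_ge0 Hδ z p.2 q.2.
  split.
    apply: h1; apply: le_lt_trans c1 _; apply: le_lt_trans pq.
    by rewrite /dman lerDl.
  apply: h2; apply: le_lt_trans c2 _; apply: le_lt_trans pq.
  by rewrite /dman lerDr.
rewrite int_ge0D//; last by move=> p; rewrite mulr_ge0.
rewrite leeD2l// int_ge0Z//.
apply: (@le_trans _ _ ((r n)^-1%:E * (e * r n)%:E)%E).
  by apply: lee_wpmul2l => //; exact: ltW.
by rewrite -EFinM mulrC mulfK// gt_eqF.
Qed.

End OpenRectangles.

Section ZeroCovariance.
Context {R : realType} {M : pointedType} (δ : M -> M -> R).
Hypothesis Hδ : is_metric δ.

(** Open subsets of [M * M] need not be measurable here, but open rectangles are. They generate the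
    sigma-algebra and are stable under intersection, as uniqueness of measures requires. *)
Lemma measurable_open_rect :
  @measurable _ (Borel δ * Borel δ)%type =
  <<s [set U `*` V | U in mopen δ & V in mopen δ] >>.
Proof.
set G := [set _ `*` _ | _ in _ & _ in _].
have sG := smallest_sigma_algebra setT G.
rewrite measurable_prod_measurableType; apply/seteqP; split; last first.
  apply: smallest_sub; first exact: smallest_sigma_algebra.
  move=> _ [U oU [V oV <-]]; apply: sub_sigma_algebra.
  by exists U; [exact: mopen_measurable|exists V => //; exact: mopen_measurable].
apply: smallest_sub => // _ [A mA [B mB <-]].
rewrite -[A `*` B]/((fst @^-1` A) `&` (snd @^-1` B)).
have gen (f : M * M -> M) : (forall U, mopen δ U -> <<s G >> (f @^-1` U)) ->
    forall A, @measurable _ (Borel δ) A -> <<s G >> (f @^-1` A).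
  move=> fU; apply: smallest_sub => //; split => /=.
  - by rewrite preimage_set0; exact: sigma_algebra0.
  - by move=> C mC; rewrite setTD preimage_setC -setTD; exact: sigma_algebraCD.
  - by move=> F mF; rewrite preimage_bigcup; exact: sigma_algebra_bigcup.
apply: (@measurableI _ (g_sigma_algebraType G)).
  apply: (gen fst) => // U oU; apply: sub_sigma_algebra; exists U => //.
  by exists setT; [exact: mopen_setT|rewrite setXT].
apply: (gen snd) => // U oU; apply: sub_sigma_algebra; exists setT; first exact: mopen_setT.
by exists U => //; rewrite setTX.
Qed.

Lemma open_rect_unique (al be : probability (Borel δ * Borel δ)%type R) :
  (forall U V, mopen δ U -> mopen δ V -> al (U `*` V) = be (U `*` V)) ->
  forall A, measurable A -> al A = be A.
Proof.
move=> H A mA.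
pose G := [set U `*` V | U in mopen δ & V in mopen δ].
have G1 : G setT by exists setT; [exact: mopen_setT|exists setT; [exact: mopen_setT|rewrite setXTT]].
apply: (@measure_unique _ R (Borel δ * Borel δ)%type G (fun=> setT) _ _ _ _ al be) => //.
- exact: measurable_open_rect.
- move=> _ _ [U oU [V oV <-]] [U' oU' [V' oV' <-]].
  exists (U `&` U'); first exact: mopen_setI.
  by exists (V `&` V'); [exact: mopen_setI|rewrite setXI].
- by rewrite bigcup_const//; exists 0%N.
- by move=> _ [U oU [V oV <-]]; exact: H.
- by move=> _; rewrite [ltLHS]probability_setT ltry.
Qed.

Lemma emd0_unique (z : nat -> M) (al be : probability (Borel δ * Borel δ)%type R) :
  @emd R _ (Borel δ * Borel δ)%type (dman (mmetric δ z)) al be = 0%E -> forall A, measurable A -> al A = be A.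
Proof.
move=> e0; apply: open_rect_unique => U V oU oV; apply/eqP; rewrite eq_le.
rewrite !(emd0_open_rect_le Hδ (z := z))//.
rewrite emd_sym//.
- exact: measurable_dman_mmetric.
- exact: dman_mmetric_ge0.
- exact: dman_mmetricC.
Qed.

Context {d : measure_display} {Om : measurableType d} (P : probability Om R).

Lemma eCov_eq0 (z : nat -> M) (X Y : Om -> Borel δ) :
  measurable_fun [set: Om] X -> measurable_fun [set: Om] Y ->
  separable_law z P X -> separable_law z P Y ->
  eCov P X Y = 0%E <-> independent P X Y.
Proof.
move=> mX mY sX sY; rewrite (eCovE Hδ mX mY sX sY); split => [e0 A B mA mB|ind].
  have mAB : measurable (A `*` B) by exact: measurableX.
  exact: etrans (emd0_unique e0 mAB) (indep_pair_law P mX mY mA mB).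
apply/eqP; rewrite eq_le; apply/andP; split; last first.
  by apply: emd_ge0; exact: dman_mmetric_ge0.
(* Under independence the two laws coincide, and coupling [(X, Y)] with itself costs 0. *)
apply: (@le_trans _ _ (\int[P]_w
   (dman (mmetric δ z) (X w, Y w) (X w, Y w))%:E)%E).
  apply: (@emd_le_push _ _ _ _ _ P (fun w => (X w, Y w)) (fun w => (X w, Y w))) => //.
  - exact: measurable_pair_rv.
  - exact: measurable_pair_rv.
  - exact: measurable_dman_mmetric.
  - exact: dman_mmetric_ge0.
  - move=> A mA; have joint : indep_copy_law P X Y (push P (measurable_pair_rv mX mY)).
      by apply: indep_copy_law_push => B C mB mC; exact: ind.
    rewrite -[RHS](pushE P (measurable_pair_rv mX mY)).
    by apply: indep_copy_law_unique joint _ mA => //; exact: indep_pair_law.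
have mC := measurable_mclosure Hδ z.
have mXC := preimage_measurable mX mC; have mYC := preimage_measurable mY mC.
have null : P (~` (X @^-1` mclosure δ z `&` Y @^-1` mclosure δ z)) = 0%E.
  by rewrite setCI; apply: prob0_setU => //; exact: measurableC.
rewrite (int_eq_full_set (measurableI _ _ mXC mYC) null (g := fun=> 0)) ?integral0//.
- by move=> w; exact: dman_mmetric_ge0.
- by move=> w [h1 h2]; rewrite /dman /= (mmetricE Hδ _ h1) (mmetricE Hδ _ h2) !(is_metric_xx Hδ) addr0.
Qed.

End ZeroCovariance.

(** * Similarities *)

Section SimilarityInverse.
Context {R : realType} {M : pointedType} (δ : M -> M -> R).
Hypothesis Hδ : is_metric δ.

Lemma mcompact_setI_closed (K F : set M) :
  mcompact δ K -> mopen δ (~` F) -> mcompact δ (K `&` F).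
Proof.
move=> cK oF u uK; have [phi [x [phi_inc [Kx cvg]]]] := cK u (fun n => (uK n).1).
exists phi, x; split => //; split => //; split => //.
apply: contrapT => /oF[r [r0 H]].
have /cvgrPdist_lt/(_ r r0)[N _ HN] := cvg.
have := HN N (leqnn _); rewrite /= sub0r normrN ger0_norm ?is_metric_ge0//.
by rewrite (is_metric_sym Hδ) => /H; apply; exact: (uK (phi N)).2.
Qed.

Lemma mcompact_image_similarity (f : M -> M) (K : set M) :
  similarity δ f -> mcompact δ K -> mcompact δ (f @` K).
Proof.
move=> [c [c0 fc]] cK u uK.
have ex n : exists x, K x /\ f x = u n by have [x Kx fx] := uK n; exists x.
have [v Hv] := choice ex.
have [phi [x [phi_inc [Kx cvg]]]] := cK v (fun n => (Hv n).1).
exists phi, (f x); split => //; split; first by exists x.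
rewrite (_ : (fun n => _) = (fun n => c * δ (v (phi n)) x)); last first.
  by apply/funext => n; rewrite -(Hv (phi n)).2 fc.
by rewrite -(mulr0 c); exact: cvgMr.
Qed.

Lemma similarity_inj (f : M -> M) : similarity δ f -> injective f.
Proof.
move=> [c [c0 fc]] x y fxy; apply: (is_metric_eq0 Hδ).
have := fc x y; rewrite fxy is_metric_xx// => /esym/eqP.
by rewrite mulf_eq0 gt_eqF//= => /eqP.
Qed.

(** Measurability of the inverse rests on compactness: [f] maps compact sets to compact sets, which
    are closed, so images of closed parts of the [K n] are Borel. *)
Lemma similarity_left_inverse (f : M -> M) (K : nat -> set M) :
  similarity δ f -> (forall n, mcompact δ (K n)) ->
  exists g : M -> M, measurable_fun [set: Borel δ] (g : Borel δ -> Borel δ) /\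
    forall n x, K n x -> g (f x) = x.
Proof.
move=> simf cK; pose KK := \bigcup_n K n.
pose g y := xget point [set x | KK x /\ f x = y].
have gf x : KK x -> g (f x) = x.
  move=> Kx; rewrite /g; case: xgetP => [x' _ [_ /(similarity_inj simf)]//|].
  by move=> /(_ x) []; split.
have gnot y : ~ (f @` KK) y -> g y = point.
  move=> ny; rewrite /g; case: xgetP => // x' _ [Kx' fx'].
  by case: ny; exists x'.
exists g; split; last by move=> n x Kx; apply: gf; exists n.
have mfK n : measurable (f @` K n : set (Borel δ)).
  by apply: (mcompact_measurable Hδ); exact: mcompact_image_similarity.
have fKK : f @` KK = \bigcup_n (f @` K n) by rewrite /KK image_bigcup.
have mfKK : measurable (f @` KK : set (Borel δ)).
  by rewrite fKK; exact: bigcupT_measurable.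
move=> _ B mB; rewrite setTI.
suff : <<s mopen δ >> `<=` [set A | measurable (g @^-1` A : set (Borel δ))] by exact.
apply: smallest_sub => /=.
  split => /=.
  - by rewrite preimage_set0.
  - by move=> A mA; rewrite setTD preimage_setC; exact: measurableC.
  - by move=> F mF; rewrite preimage_bigcup; exact: bigcupT_measurable.
move=> A oA.
have mfKA : measurable (\bigcup_n (f @` K n `\` f @` (K n `&` ~` A)) : set (Borel δ)).
  apply: bigcupT_measurable => n; apply: measurableD => //.
  apply: (mcompact_measurable Hδ); apply: (mcompact_image_similarity simf).
  by apply: (mcompact_setI_closed (cK n)); rewrite setCK.
have E : g @^-1` A `&` f @` KK = \bigcup_n (f @` K n `\` f @` (K n `&` ~` A)).
  apply/seteqP; split => [y [/= Ay [x [n _ Kx] xy]]|y [n _ [[x Kx xy] nA]]].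
    have gx : g (f x) = x by apply: gf; exists n.
    exists n => //; split; first by exists x.
    move=> [x' [Kx' nAx'] x'y]; apply: nAx'.
    by rewrite (similarity_inj simf (etrans x'y (esym xy))) -gx xy.
  have gx : g (f x) = x by apply: gf; exists n.
  split; last by exists x => //; exists n.
  rewrite /= -xy gx; apply: contrapT => Ax; apply: nA; exists x => //.
rewrite /= -(setIT (g @^-1` A)) -(setvU (f @` KK)) setIUr; apply: measurableU; last first.
  by rewrite E.
(* Off the image [g] is constantly [point], so the complement belongs to the preimage entirely or
   not at all. *)
have [Ap|nAp] := pselect (A point).
  rewrite (_ : _ `&` _ = ~` (f @` KK)); first exact: measurableC.
  by apply/seteqP; split => [y []//|y ny]; split => //=; rewrite gnot.
rewrite (_ : _ `&` _ = set0)//.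
by apply/seteqP; split => // y [/= Ay ny]; apply: nAp; rewrite -(gnot y ny).
Qed.

End SimilarityInverse.

(** * Covariance as a function of laws, and its behaviour under maps *)

Section CovarianceOfLaws.
Context {R : realType} {M : pointedType} (δ : M -> M -> R).
Hypothesis Hδ : is_metric δ.
Context {d : measure_display} {Om : measurableType d} (P : probability Om R).
Implicit Types X Y : Om -> Borel δ.

Lemma prob_ae_eq (A B N : set Om) : measurable A -> measurable B -> measurable N ->
  P N = 0%E -> (forall w, ~ N w -> A w <-> B w) -> P A = P B.
Proof.
move=> mA mB mN PN AB.
have H (C D : set Om) : measurable C -> measurable D ->
    (forall w, ~ N w -> C w -> D w) -> (P C <= P D)%E.
  move=> mC mD CD; apply: (@le_trans _ _ (P (D `|` N))).
    apply: le_measure; rewrite ?inE//; first exact: measurableU.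
    by move=> w Cw; have [Nw|Nw] := pselect (N w); [right|left; exact: CD].
  have := measureU2 P mD mN; by rewrite [X in (_ <= _ + X)%E]PN adde0.
by apply/eqP; rewrite eq_le !H// => w /AB [].
Qed.

(** [eCov] depends only on the joint and marginal laws, which do not see null sets. *)
Lemma eCov_ae_eq X Y X' Y' : measurable_fun [set: Om] X -> measurable_fun [set: Om] Y ->
  measurable_fun [set: Om] X' -> measurable_fun [set: Om] Y' ->
  {ae P, forall w, X w = X' w} -> {ae P, forall w, Y w = Y' w} ->
  eCov P X Y = eCov P X' Y'.
Proof.
move=> mX mY mX' mY' [N1 [mN1 PN1 H1]] [N2 [mN2 PN2 H2]].
have H1' w : ~ N1 w -> X w = X' w by move=> h; apply: contrapT => /H1.
have H2' w : ~ N2 w -> Y w = Y' w by move=> h; apply: contrapT => /H2.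
have lX A : measurable A -> law P X A = law P X' A.
  move=> mA; apply: (@prob_ae_eq _ _ N1) => //; try exact: preimage_measurable.
  by move=> w /H1' h /=; rewrite h.
have lY A : measurable A -> law P Y A = law P Y' A.
  move=> mA; apply: (@prob_ae_eq _ _ N2) => //; try exact: preimage_measurable.
  by move=> w /H2' h /=; rewrite h.
rewrite /eCov; congr ereal_inf.
rewrite (_ : [set nu | indep_copy_law P X Y nu] = [set nu | indep_copy_law P X' Y' nu]).
  apply: eq_imagel => nu _; apply: emd_ext => // A mA; rewrite /joint_law.
  apply: (@prob_ae_eq _ _ (N1 `|` N2)).
  - by apply: preimage_measurable => //; exact: measurable_pair_rv.
  - by apply: preimage_measurable => //; exact: measurable_pair_rv.
  - exact: measurableU.
  - exact: prob0_setU.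
  - by move=> w /not_orP[/H1' h1 /H2' h2] /=; rewrite h1 h2.
by apply/seteqP; split => nu H A B mA mB; rewrite H// lX// lY.
Qed.

Lemma separable_law_le (z z' : nat -> M) X : measurable_fun [set: Om] X ->
  mclosure δ z `<=` mclosure δ z' -> separable_law z P X -> separable_law z' P X.
Proof.
move=> mX zz' sX; apply: (subset_measure0 _ _ _ sX).
- by apply: preimage_measurable => //; apply: measurableC; exact: measurable_mclosure.
- by apply: preimage_measurable => //; apply: measurableC; exact: measurable_mclosure.
- by move=> w /= nz' /zz'.
Qed.

Lemma separable_law_similarity (z : nat -> M) X f : similarity δ f ->
  measurable_fun [set: Om] X -> separable_law z P X ->
  separable_law (f \o z) P (fun w => f (X w) : Borel δ).
Proof.
move=> simf mX sX; have mf := similarity_measurable simf; apply: (subset_measure0 _ _ _ sX).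
- apply: preimage_measurable; first exact: (measurableT_comp mf mX).
  by apply: measurableC; exact: measurable_mclosure.
- by apply: preimage_measurable => //; apply: measurableC; exact: measurable_mclosure.
- move=> w /= nz h; apply: nz => e e0; have [c [c0 fc]] := simf.
  have [i hi] := h (e / c) (divr_gt0 e0 c0); exists i.
  by rewrite /= fc mulrC -ltr_pdivlMr.
Qed.

Variable z : nat -> M.
Local Notation mm := (mmetric δ z).
Local Notation dm := (dman mm : Borel δ * Borel δ -> Borel δ * Borel δ -> R).

(** Every plan is pushed forward by [h] in all coordinates. Scaling is required only on a set [B] of
    full measure, so that the statement applies both to a similarity and to its Borel left
    inverse. *)
Lemma eCov_map_le X Y (h : Borel δ -> Borel δ) (c : R) (B : set (Borel δ)) :
  measurable_fun [set: Om] X -> measurable_fun [set: Om] Y ->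
  measurable_fun [set: Borel δ] h ->
  separable_law z P X -> separable_law z P Y ->
  separable_law z P (h \o X) -> separable_law z P (h \o Y) ->
  0 < c -> measurable B -> P (X @^-1` (~` B)) = 0%E -> P (Y @^-1` (~` B)) = 0%E ->
  (forall x y, B x -> B y -> mm (h x) (h y) = c * mm x y) ->
  (eCov P (h \o X) (h \o Y) <= c%:E * eCov P X Y)%E.
Proof.
move=> mX mY mh sX sY shX shY c0 mB PX PY hc.
have mhX : measurable_fun [set: Om] (h \o X) by exact: measurableT_comp.
have mhY : measurable_fun [set: Om] (h \o Y) by exact: measurableT_comp.
pose BB := (Borel δ * Borel δ)%type.
have mhh : measurable_fun [set: BB] (fun q : BB => (h q.1, h q.2)).
  apply: measurable_fun_pair.
    exact: (measurableT_comp mh (@measurable_fst _ _ _ _)).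
  exact: (measurableT_comp mh (@measurable_snd _ _ _ _)).
have mXB : measurable (X @^-1` (~` B)).
  by apply: preimage_measurable => //; exact: measurableC.
have mYB : measurable (Y @^-1` (~` B)).
  by apply: preimage_measurable => //; exact: measurableC.
rewrite (eCovE Hδ mhX mhY shX shY) (eCovE Hδ mX mY sX sY).
rewrite -lee_pdivrMl//; apply/ereal_infP => _ [g gc <-].
rewrite lee_pdivrMl//.
have mdm := measurable_dman_mmetric Hδ z.
have dm0 := dman_mmetric_ge0 Hδ z.
have mH1 : measurable_fun [set: BB * BB] (fun p : BB * BB => (h p.1.1, h p.1.2)).
  exact: (measurableT_comp mhh (@measurable_fst _ _ _ _)).
have mH2 : measurable_fun [set: BB * BB] (fun p : BB * BB => (h p.2.1, h p.2.2)).
  exact: (measurableT_comp mhh (@measurable_snd _ _ _ _)).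
apply: (@le_trans _ _ (\int[g]_p (dm (h p.1.1, h p.1.2) (h p.2.1, h p.2.2))%:E)%E).
  apply: (@emd_le_push _ _ _ _ _ g _ _ dm) => //.
  - move=> A mA; have mA' := preimage_measurable mhh mA.
    by symmetry; exact: (gc _ mA').1.
  - move=> A mA; have mA' := preimage_measurable mhh mA.
    by symmetry; exact: (gc _ mA').2.
rewrite -int_ge0Z//; last exact: ltW.
have mBB : measurable (B `*` B) by exact: measurableX.
have mD1 : measurable (fst @^-1` (B `*` B) : set (BB * BB)).
  by apply: preimage_measurable => //; exact: measurable_fst.
have mD2 : measurable (snd @^-1` (B `*` B) : set (BB * BB)).
  by apply: preimage_measurable => //; exact: measurable_snd.
rewrite le_eqVlt; apply/orP; left; apply/eqP.
apply: (int_eq_full_set (measurableI _ _ mD1 mD2)) => //.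
- rewrite setCI; apply: prob0_setU; try exact: measurableC.
    have := (gc _ (measurableC mBB)).1; rewrite pushE => e1; rewrite [LHS]e1.
    rewrite (_ : _ @^-1` _ = X @^-1` (~` B) `|` Y @^-1` (~` B)); last first.
      apply/seteqP; split => w /=; last by case => k [].
      by move=> /not_andP[]; [left|right].
    exact: prob0_setU.
  have := (gc _ (measurableC mBB)).2; rewrite pushE => e1; rewrite [LHS]e1.
  (* The second marginal of the plan is a product law; it misses [B] times [B] on a union of two
     null strips. *)
  rewrite (_ : _ @^-1` _ = ((X @^-1` (~` B)) `*` setT) `|` (setT `*` (Y @^-1` (~` B)))).
    apply: prob0_setU; [by apply: measurableX|by apply: measurableX| |].
      by apply: etrans (prod_rect P mXB measurableT) _; rewrite [X in (X * _)%E]PX mul0e.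
    by apply: etrans (prod_rect P measurableT mYB) _; rewrite [X in (_ * X)%E]PY mule0.
  apply/seteqP; split => [[w w'] /= |[w w'] /=]; last by case=> -[k l] [].
  by move=> /not_andP[k|k]; [left|right].
- by move=> p; rewrite mulr_ge0// ltW.
- by move=> [[x y] [u v]] [[/= Bx By] [/= Bu Bv]]; rewrite /dman /= !hc// mulrDr.
Qed.

End CovarianceOfLaws.

(** * Independence, invariance and maximal correlation *)

Section CorrelationProperties.
Context {R : realType} {M : pointedType} (δ : M -> M -> R).
Hypothesis Hδ : is_metric δ.
Context {d : measure_display} {Om : measurableType d} (P : probability Om R).
Implicit Types X Y : Om -> Borel δ.

Lemma admissible_eVar (z : nat -> M) X : admissible P X -> separable_law z P X ->
  [/\ eVar P X = selfdist z P X, eVar P X \is a fin_num & 0 < fine (eVar P X)].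
Proof.
move=> [mX nX fX rX] sX; have E := eVarE Hδ mX sX.
have lty := selfdist_lty Hδ mX sX fX; have gt0 := selfdist_gt0 Hδ mX sX nX.
split => //; first by rewrite E gt0_fin_numE.
by rewrite E fine_gt0// gt0.
Qed.

Lemma eCor_eq0 X Y : admissible P X -> admissible P Y ->
  eCor P X Y = 0 <-> independent P X Y.
Proof.
move=> aX aY; have [mX _ fX rX] := aX; have [mY _ _ rY] := aY.
have [zX sX0] := radon_separable Hδ mX rX; have [zY sY0] := radon_separable Hδ mY rY.
have [z Hz] := mclosure_bigcup δ (fun n => if n is 0%N then zX else zY).
have sX : separable_law z P X := separable_law_le Hδ mX (Hz 0%N) sX0.
have sY : separable_law z P Y := separable_law_le Hδ mY (Hz 1%N) sY0.
rewrite -(eCov_eq0 Hδ mX mY sX sY) /eCor.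
have [_ _ vX] := admissible_eVar aX sX; have [_ _ vY] := admissible_eVar aY sY.
have m0 : Num.min (fine (eVar P X)) (fine (eVar P Y)) != 0.
  by rewrite gt_eqF// lt_min vX.
have fin := eCov_fin Hδ mX mY sX sY fX.
split => [/eqP|->]; last by rewrite mul0r.
rewrite mulf_eq0 invr_eq0 (negbTE m0) orbF => /eqP h.
by rewrite -(fineK fin) h.
Qed.

(** [eCov_map_le] is used twice, with [f] and ratio [c], then with the left inverse and ratio
    [c^-1], because [X] and [Y] are almost surely recovered from their images. *)
Lemma eCov_similarity_image X Y (f : M -> M) c : admissible P X -> admissible P Y ->
  0 < c -> (forall x y, δ (f x) (f y) = c * δ x y) ->
  eCov P (fun w => f (X w) : Borel δ) (fun w => f (Y w) : Borel δ) =
  (c%:E * eCov P X Y)%E.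
Proof.
move=> aX aY c0 fc; have [mX _ _ rX] := aX; have [mY _ _ rY] := aY.
have simf : similarity δ f by exists c.
have mf := similarity_measurable simf.
have mfX : measurable_fun [set: Om] (fun w => f (X w) : Borel δ).
  exact: (measurableT_comp mf mX).
have mfY : measurable_fun [set: Om] (fun w => f (Y w) : Borel δ).
  exact: (measurableT_comp mf mY).
have [zX sX0] := radon_separable Hδ mX rX; have [zY sY0] := radon_separable Hδ mY rY.
have sfX0 := separable_law_similarity Hδ simf mX sX0.
have sfY0 := separable_law_similarity Hδ simf mY sY0.
have [z Hz] := mclosure_bigcup δ (fun n =>
  if n is 0%N then zX else if n is 1%N then zY else if n is 2%N then f \o zX else f \o zY).
have sX : separable_law z P X := separable_law_le Hδ mX (Hz 0%N) sX0.
have sY : separable_law z P Y := separable_law_le Hδ mY (Hz 1%N) sY0.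
have sfX := separable_law_le Hδ mfX (Hz 2%N) sfX0.
have sfY := separable_law_le Hδ mfY (Hz 3%N) sfY0.
have mC := measurable_mclosure Hδ z.
have mfC := preimage_measurable mf mC.
apply/eqP; rewrite eq_le; apply/andP; split.
  apply: (@eCov_map_le _ _ _ Hδ _ _ P z X Y f c (mclosure δ z `&` f @^-1` mclosure δ z)) => //.
  - exact: measurableI.
  - rewrite setCI preimage_setU; apply: prob0_setU => //.
    + by apply: preimage_measurable => //; exact: measurableC.
    + by apply: preimage_measurable => //; exact: measurableC.
  - rewrite setCI preimage_setU; apply: prob0_setU => //.
    + by apply: preimage_measurable => //; exact: measurableC.
    + by apply: preimage_measurable => //; exact: measurableC.
  - by move=> x y [h1 h2] [h3 h4]; rewrite !mmetricE.
have [KX [cKX PKX]] := radon_sigma_compact Hδ mX rX.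
have [KY [cKY PKY]] := radon_sigma_compact Hδ mY rY.
(* Interleaving the compact sets of [X] and [Y] gives one left inverse that serves both. *)
pose K n := if odd n then KX n./2 else KY n./2.
have cK n : mcompact δ (K n) by rewrite /K; case: ifP.
have [g [mg gf]] := similarity_left_inverse Hδ simf cK.
have mKK : measurable (\bigcup_n (f @` K n) : set (Borel δ)).
  apply: bigcupT_measurable => n.
  by apply: (mcompact_measurable Hδ); exact: mcompact_image_similarity.
have mKU (L : nat -> set M) : (forall n, mcompact δ (L n)) ->
    measurable (\bigcup_n L n : set (Borel δ)).
  by move=> cL; apply: bigcupT_measurable => n; exact: mcompact_measurable.
have KXK x : (\bigcup_n KX n) x -> exists n, K n x.
  by move=> [n _ h]; exists n.*2.+1; rewrite /K /= odd_double /= uphalf_double.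
have KYK x : (\bigcup_n KY n) x -> exists n, K n x.
  by move=> [n _ h]; exists n.*2; rewrite /K /= odd_double /= doubleK.
have nullXK : P (X @^-1` (~` \bigcup_n KX n)) = 0%E by [].
have mgfX : measurable_fun [set: Om] ((g : Borel δ -> Borel δ) \o (fun w => f (X w) : Borel δ)).
  exact: measurableT_comp.
have mgfY : measurable_fun [set: Om] ((g : Borel δ -> Borel δ) \o (fun w => f (Y w) : Borel δ)).
  exact: measurableT_comp.
have aeX : {ae P, forall w, X w = ((g : Borel δ -> Borel δ) \o (fun w => f (X w) : Borel δ)) w}.
  exists (X @^-1` (~` \bigcup_n KX n)); split => //.
    by apply: preimage_measurable => //; apply: measurableC; exact: mKU.
  by move=> w /= h1 /KXK[n Kn]; apply: h1; rewrite (gf n).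
have aeY : {ae P, forall w, Y w = ((g : Borel δ -> Borel δ) \o (fun w => f (Y w) : Borel δ)) w}.
  exists (Y @^-1` (~` \bigcup_n KY n)); split => //.
    by apply: preimage_measurable => //; apply: measurableC; exact: mKU.
  by move=> w /= h1 /KYK[n Kn]; apply: h1; rewrite (gf n).
rewrite (eCov_ae_eq mX mY mgfX mgfY aeX aeY).
(* On the images of the compact sets [g] inverts [f]. The other two conditions let [mm] be read as
   [δ] before and after applying [g]. *)
pose B : set (Borel δ) := \bigcup_n (f @` K n) `&` (mclosure δ z `&` g @^-1` mclosure δ z).
have mgC := preimage_measurable mg mC.
have mXn : measurable (X @^-1` (~` mclosure δ z)).
  by apply: preimage_measurable => //; exact: measurableC.
have mYn : measurable (Y @^-1` (~` mclosure δ z)).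
  by apply: preimage_measurable => //; exact: measurableC.
have sgfX : separable_law z P ((g : Borel δ -> Borel δ) \o (fun w => f (X w) : Borel δ)).
  have [N [mN PN HN]] := aeX; apply: (subset_measure0 _ _ _ (prob0_setU mXn mN sX PN)).
  - by apply: preimage_measurable => //; exact: measurableC.
  - exact: measurableU.
  - move=> w /= h; have [Nw|Nw] := pselect (N w); [by right|left => hX; apply: h].
    by have := contrapT (fun k => Nw (HN w k)) => /= <-.
have sgfY : separable_law z P ((g : Borel δ -> Borel δ) \o (fun w => f (Y w) : Borel δ)).
  have [N [mN PN HN]] := aeY; apply: (subset_measure0 _ _ _ (prob0_setU mYn mN sY PN)).
  - by apply: preimage_measurable => //; exact: measurableC.
  - exact: measurableU.
  - move=> w /= h; have [Nw|Nw] := pselect (N w); [by right|left => hY; apply: h].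
    by have := contrapT (fun k => Nw (HN w k)) => /= <-.
rewrite -lee_pdivlMl//; last first.
apply: (@eCov_map_le _ _ _ Hδ _ _ P z _ _ g c^-1 B) => //.
- by rewrite invr_gt0.
- by apply: measurableI => //; exact: measurableI.
- rewrite /B !setCI !preimage_setU; apply: prob0_setU.
  + by apply: preimage_measurable => //; exact: measurableC.
  + by apply: measurableU; apply: preimage_measurable => //; exact: measurableC.
  + apply: (subset_measure0 _ _ _ PKX).
    * by apply: preimage_measurable => //; exact: measurableC.
    * by apply: preimage_measurable => //; apply: measurableC; exact: mKU.
    * by move=> w /= h /KXK[n Kn]; apply: h; exists n => //; exists (X w).
  + by apply: prob0_setU => //; apply: preimage_measurable => //; exact: measurableC.
- rewrite /B !setCI !preimage_setU; apply: prob0_setU.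
  + by apply: preimage_measurable => //; exact: measurableC.
  + by apply: measurableU; apply: preimage_measurable => //; exact: measurableC.
  + apply: (subset_measure0 _ _ _ PKY).
    * by apply: preimage_measurable => //; exact: measurableC.
    * by apply: preimage_measurable => //; apply: measurableC; exact: mKU.
    * by move=> w /= h /KYK[n Kn]; apply: h; exists n => //; exists (Y w).
  + by apply: prob0_setU => //; apply: preimage_measurable => //; exact: measurableC.
- move=> x y [[n _ [x' Kx' <-]] [h1 h2]] [[m _ [y' Ky' <-]] [h3 h4]].
  rewrite !mmetricE// (gf n)// (gf m)// fc mulrA mulVf ?mul1r// gt_eqF//.
Qed.

Lemma eCor_similarity X Y (f : M -> M) : admissible P X -> admissible P Y ->
  similarity δ f ->
  eCor P (fun w => f (X w) : Borel δ) (fun w => f (Y w) : Borel δ) = eCor P X Y.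
Proof.
move=> aX aY [c [c0 fc]]; have [mX _ fX rX] := aX; have [mY _ fY rY] := aY.
have [z sX] := radon_separable Hδ mX rX; have [z' sY] := radon_separable Hδ mY rY.
have [_ finX vX] := admissible_eVar aX sX; have [_ finY vY] := admissible_eVar aY sY.
rewrite /eCor /eVar !(@eCov_similarity_image _ _ f c)//.
rewrite !fineM//=; last first.
  have [w Hw] := mclosure_bigcup δ (fun n => if n is 0%N then z else z').
  apply: (eCov_fin Hδ (z := w)) => //; first exact: separable_law_le (Hw 0%N) sX.
  exact: separable_law_le (Hw 1%N) sY.
by rewrite -minr_pMr ?(ltW c0)// invfM mulrACA divff ?gt_eqF// mul1r.
Qed.

(** The variances are [V] and [c * V], whose minimum is the value already found for the
    covariance. *)
Lemma eCor_similar X Y (f : M -> M) : admissible P X -> admissible P Y ->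
  similarity δ f -> {ae P, forall w, Y w = f (X w)} -> eCor P X Y = 1.
Proof.
move=> aX aY simf YfX; have [c [c0 fc]] := simf.
have [mX _ _ rX] := aX; have [mY _ _ rY] := aY.
have mf := similarity_measurable simf.
have mfX : measurable_fun [set: Om] (fun w => f (X w) : Borel δ).
  exact: (measurableT_comp mf mX).
have [zX sX0] := radon_separable Hδ mX rX.
have sfX0 := separable_law_similarity Hδ simf mX sX0.
have [z Hz] := mclosure_bigcup δ (fun n => if n is 0%N then zX else f \o zX).
have sX : separable_law z P X := separable_law_le Hδ mX (Hz 0%N) sX0.
have sfX := separable_law_le Hδ mfX (Hz 1%N) sfX0.
have aeX : {ae P, forall w, X w = X w} by apply: aeW.
have [VX finX vX] := admissible_eVar aX sX.
rewrite /eCor (eCov_ae_eq mX mY mX mfX aeX YfX).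
rewrite [eVar P Y](eCov_ae_eq mY mY mfX mfX YfX YfX).
rewrite -[eCov P _ _ in X in Num.min _ (fine X)]/(eVar P (fun w => f (X w) : Borel δ)).
rewrite (eVarE Hδ mfX sfX) (selfdist_similarity Hδ mX sX sfX mf c0 fc).
rewrite (eCov_similarity Hδ mX sX sfX mf c0 fc) -VX !fineM//=.
have m1c : 0 < Num.min 1 c by rewrite lt_min ltr01.
have -> : Num.min (fine (eVar P X)) (c * fine (eVar P X)) = Num.min 1 c * fine (eVar P X).
  by rewrite minr_pMl ?mul1r// ltW.
by rewrite divff// gt_eqF// mulr_gt0.
Qed.

End CorrelationProperties.

(** * Continuity *)

Section DensityCloseProduct.
Context {d : measure_display} {S : measurableType d} {R : realType}.
Variable rho : S -> S -> R.
Hypothesis mr : measurable_fun [set: S * S] (fun z : S * S => rho z.1 z.2).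
Hypothesis r0 : forall x y, 0 <= rho x y.
Local Notation SS := (S * S)%type.

(** The laws of independent copies are products of marginals; this makes them close as soon as the
    marginals are. The density is the product of the two densities. *)
Lemma density_close_prod (al al' be be' : probability S R) e e' :
  density_close rho al be e -> density_close rho al' be' e' ->
  density_close (fun p q : SS => rho p.1 q.1 + rho p.2 q.2)
    (al \x al')%E (be \x be')%E (e + e').
Proof.
move=> [G [mG G0 G1 G2 Ge]] [G' [mG' G'0 G'1 G'2 G'e]].
exists (fun p => G (p.1.1, p.2.1) * G' (p.1.2, p.2.2)).
have m11 : measurable_fun [set: SS * SS] (fun p : SS * SS => p.1.1).
  exact: (measurableT_comp (@measurable_fst _ _ _ _) (@measurable_fst _ _ _ _)).
have m12 : measurable_fun [set: SS * SS] (fun p : SS * SS => p.1.2).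
  exact: (measurableT_comp (@measurable_snd _ _ _ _) (@measurable_fst _ _ _ _)).
have m21 : measurable_fun [set: SS * SS] (fun p : SS * SS => p.2.1).
  exact: (measurableT_comp (@measurable_fst _ _ _ _) (@measurable_snd _ _ _ _)).
have m22 : measurable_fun [set: SS * SS] (fun p : SS * SS => p.2.2).
  exact: (measurableT_comp (@measurable_snd _ _ _ _) (@measurable_snd _ _ _ _)).
have mp1 := measurable_fun_pair m11 m21.
have mp2 := measurable_fun_pair m12 m22.
have mGG1 : measurable_fun [set: SS * SS] (fun p : SS * SS => G (p.1.1, p.2.1)).
  exact: (measurableT_comp mG mp1).
have mGG2 : measurable_fun [set: SS * SS] (fun p : SS * SS => G' (p.1.2, p.2.2)).
  exact: (measurableT_comp mG' mp2).
have mGx x : measurable_fun [set: S] (fun y => G (x, y)).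
  exact: (measurableT_comp mG (pair1_measurable x)).
have mGy y : measurable_fun [set: S] (fun x => G (x, y)).
  exact: (measurableT_comp mG (pair2_measurable y)).
have mG'x x : measurable_fun [set: S] (fun y => G' (x, y)).
  exact: (measurableT_comp mG' (pair1_measurable x)).
have mG'y y : measurable_fun [set: S] (fun x => G' (x, y)).
  exact: (measurableT_comp mG' (pair2_measurable y)).
have mrx x : measurable_fun [set: S] (fun y => rho x y).
  exact: (measurableT_comp mr (pair1_measurable x)).
have mrG : measurable_fun [set: SS] (fun z : SS => rho z.1 z.2 * G z).
  exact: measurable_funM.
have mrG' : measurable_fun [set: SS] (fun z : SS => rho z.1 z.2 * G' z).
  exact: measurable_funM.
have mr1 : measurable_fun [set: SS * SS] (fun p : SS * SS => rho p.1.1 p.2.1).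
  exact: (measurableT_comp mr mp1).
have mr2 : measurable_fun [set: SS * SS] (fun p : SS * SS => rho p.1.2 p.2.2).
  exact: (measurableT_comp mr mp2).
split.
- exact: measurable_funM.
- by move=> p; rewrite mulr_ge0.
- move=> p /=; rewrite (@int_prod _ _ S S R be be' _ _ (mGx p.1) (mG'x p.2))//.
  by rewrite G1 G'1 mule1.
- move=> p /=; rewrite (@int_prod _ _ S S R al al' _ _ (mGy p.1) (mG'y p.2))//.
  by rewrite G2 G'2 mule1.
(* The cost splits into one term per coordinate; in each term the density of the other coordinate
   integrates to 1. *)
pose f1 (p : SS * SS) := (rho p.1.1 p.2.1 * G (p.1.1, p.2.1)) * G' (p.1.2, p.2.2).
pose f2 (p : SS * SS) := G (p.1.1, p.2.1) * (rho p.1.2 p.2.2 * G' (p.1.2, p.2.2)).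
have mf1 : measurable_fun [set: SS * SS] f1.
  by apply: measurable_funM => //; exact: measurable_funM.
have mf2 : measurable_fun [set: SS * SS] f2.
  by apply: measurable_funM => //; exact: measurable_funM.
have f10 p : 0 <= f1 p by rewrite !mulr_ge0.
have f20 p : 0 <= f2 p by rewrite !mulr_ge0.
rewrite (eq_integral (fun p => (f1 p + f2 p)%:E)); last first.
  by move=> p _; congr EFin; rewrite /f1 /f2; ring.
have mF (mu : probability S R) (h : SS -> R) : measurable_fun [set: SS] h ->
    (forall z, 0 <= h z) ->
    measurable_fun [set: S] (fun x => \int[mu]_y (h (x, y))%:E)%E.
  move=> mh h0.
  apply: (@measurable_fun_fubini_tonelli_F _ _ _ _ _ mu (EFin \o h)) => //.
  exact/measurable_EFinP.
have intc (mu : probability S R) (c : \bar R) : (\int[mu]_y c = c)%E.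
  by rewrite integral_cst// [X in (_ * X)%E](_ : _ = 1%E) ?mule1//; exact: probability_setT.
rewrite int_ge0D// EFinD; apply: leeD.
  apply: le_trans Ge; rewrite !tonelli1//; last by move=> z; rewrite mulr_ge0.
  rewrite (eq_integral (fun p : SS => \int[be]_y (rho p.1 y * G (p.1, y))%:E)%E); last first.
    move=> p _; rewrite /f1 /=.
    rewrite (@int_prod _ _ S S R be be' (fun y => rho p.1 y * G (p.1, y)) _ _ (mG'x p.2))//.
    - by rewrite G'1 mule1.
    - exact: measurable_funM.
    - by move=> y; rewrite mulr_ge0.
  rewrite fubini_tonelli1//.
  - by rewrite /fubini_F/=; under eq_integral do rewrite intc.
  - apply: (measurableT_comp (mF be _ mrG _) (@measurable_fst _ _ _ _)).
    by move=> z; rewrite mulr_ge0.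
  - by move=> p; apply: int_ge0 => y; rewrite mulr_ge0.
apply: le_trans G'e; rewrite !tonelli1//; last by move=> z; rewrite mulr_ge0.
rewrite (eq_integral (fun p : SS => \int[be']_y (rho p.2 y * G' (p.2, y))%:E)%E); last first.
  move=> p _; rewrite /f2 /=.
  rewrite (@int_prod _ _ S S R be be' _ (fun y => rho p.2 y * G' (p.2, y)) (mGx p.1))//.
  - by rewrite G1 mul1e.
  - exact: measurable_funM.
  - by move=> y; rewrite mulr_ge0.
rewrite fubini_tonelli1//.
- by rewrite /fubini_F/= intc.
- apply: (measurableT_comp (mF be' _ mrG' _) (@measurable_snd _ _ _ _)).
  by move=> z; rewrite mulr_ge0.
- by move=> p; apply: int_ge0 => y; rewrite mulr_ge0.
Qed.

End DensityCloseProduct.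

(** * Lipschitz test functions *)

Section LipschitzTests.
Context {R : realType} {M : pointedType} (δ : M -> M -> R).
Hypothesis Hδ : is_metric δ.

Lemma lipschitz_mcontinuous (g : M * M -> R) (L : R) : 0 <= L ->
  (forall p q, `|g p - g q| <= L * dman δ p q) -> mcontinuous_pair δ g.
Proof.
move=> L0 gL p e e0; have L1 : 0 < L + 1 by rewrite ltr_wpDl.
exists (e / (L + 1)); split; first by rewrite divr_gt0.
move=> q; rewrite ltr_pdivlMr// mulrC => pq; apply: le_lt_trans (gL p q) _.
apply: le_lt_trans pq; rewrite ler_wpM2r ?lerDl//.
by rewrite addr_ge0// is_metric_ge0.
Qed.

(** A part is a product of [i + 1] factors in the unit interval, each varying by at most [D];
    replacing them one at a time adds up the variations. *)
Lemma unity_part_lipschitz (S : Type) (h : nat -> S -> R) (p q : S) (D : R) :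
  (forall i x, 0 <= h i x <= 1) -> (forall i, `|h i p - h i q| <= D) ->
  forall i, `|unity_part h i p - unity_part h i q| <= i.+1%:R * D.
Proof.
move=> h01 hD i.
have bnd (a b a' b' : R) : 0 <= a <= 1 -> 0 <= b' <= 1 ->
    `|a * b - a' * b'| <= `|a - a'| + `|b - b'|.
  move=> /andP[a0 a1] /andP[b0 b1].
  have -> : a * b - a' * b' = a * (b - b') + (a - a') * b' by ring.
  apply: (le_trans (ler_normD _ _)); rewrite addrC !normrM.
  apply: lerD.
    by rewrite (ger0_norm b0) ler_piMr.
  by rewrite (ger0_norm a0) ler_piMl.
have prod01 n x : 0 <= \prod_(j < n) (1 - h j x) <= 1.
  apply/andP; split.
    by apply: prodr_ge0 => j _; rewrite subr_ge0; case/andP: (h01 j x).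
  apply: prodr_ile1 => j _; rewrite subr_ge0 gerBl.
  by case/andP: (h01 j x) => -> ->.
have H n : `|\prod_(j < n) (1 - h j p) - \prod_(j < n) (1 - h j q)| <= n%:R * D.
  elim: n => [|n IH]; first by rewrite !big_ord0 subrr normr0 mul0r.
  rewrite !big_ord_recr /=; apply: (le_trans (bnd _ _ _ _ (prod01 n p) _)).
    by rewrite subr_ge0 gerBl; case/andP: (h01 n q) => -> ->.
  rewrite -natr1 mulrDl mul1r; apply: lerD => //.
  have -> : 1 - h n p - (1 - h n q) = - (h n p - h n q) by ring.
  by rewrite normrN.
apply: (le_trans (bnd _ _ _ _ (h01 i p) (prod01 i q))).
by rewrite -natr1 mulrDl mul1r addrC; apply: lerD.
Qed.

(* All tests of weak convergence below are of this shape, [F i] being the distance to the [i]-th center. *)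
Lemma tent_part_mcontinuous (F : nat -> M * M -> R) (e : R) i : 0 < e ->
  (forall j p q, `|F j p - F j q| <= dman δ p q) ->
  mcontinuous_pair δ (unity_part (fun j p => tent e (F j p)) i).
Proof.
move=> e0 FL; apply: (@lipschitz_mcontinuous _ (i.+1%:R * e^-1)).
  by rewrite mulr_ge0// invr_ge0 ltW.
move=> p q; rewrite -mulrA; apply: unity_part_lipschitz.
  by move=> j x; exact: tent01.
move=> j; apply: (le_trans (tent_lip _ _ e0)).
by rewrite mulrC ler_wpM2l// invr_ge0 ltW.
Qed.

Lemma dist_lipschitz x y a : `|δ x a - δ y a| <= δ x y.
Proof.
rewrite ler_norml; have := is_metric_tri Hδ y x a; have := is_metric_tri Hδ x y a.
rewrite (is_metric_sym Hδ y x); lra.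
Qed.

Lemma dman_lipschitz p q c : `|dman δ p c - dman δ q c| <= dman δ p q.
Proof.
have -> : dman δ p c - dman δ q c = (δ p.1 c.1 - δ q.1 c.1) + (δ p.2 c.2 - δ q.2 c.2).
  by rewrite /dman; ring.
by apply: (le_trans (ler_normD _ _)); apply: lerD; exact: dist_lipschitz.
Qed.

End LipschitzTests.

Lemma emd_close2 d (S : measurableType d) (R : realType) (rho : S -> S -> R)
    (al be al' be' : probability S R) e e' :
  measurable_fun [set: S * S] (fun z : S * S => rho z.1 z.2) ->
  (forall x y, 0 <= rho x y) -> (forall x y, rho x y = rho y x) ->
  (forall x y z, rho x z <= rho x y + rho y z) ->
  density_close rho al al' e -> density_close rho be be' e' ->
  (emd rho al be <= emd rho al' be' + (e + e')%:E)%E.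
Proof.
move=> mr r0 rC rtri ca cb.
apply: (le_trans (emd_close be mr r0 rtri ca)).
rewrite (emd_sym al' be mr r0 rC) (emd_sym al' be' mr r0 rC).
rewrite EFinD addeA addeAC; apply: leeD => //.
exact: emd_close.
Qed.

Lemma int_le_cst d (T : measurableType d) (R : realType) (P : probability T R)
    (g : T -> R) (C : R) : measurable_fun [set: T] g -> (forall x, 0 <= g x <= C) ->
  (\int[P]_x (g x)%:E <= C%:E)%E.
Proof.
move=> mg gC; rewrite -(int_cst_prob P C); apply: int_ge0_le => //.
- by move=> x; case/andP: (gC x).
- by move=> x; case/andP: (gC x).
Qed.

(** * Convergence of the covariance *)

Section WeakConvergence.
Context {R : realType} {M : pointedType} (δ : M -> M -> R).
Hypothesis Hδ : is_metric δ.
Variable z : nat -> M.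
Local Notation mm := (mmetric δ z : Borel δ -> Borel δ -> R).
Local Notation dm := (dman (mmetric δ z) : Borel δ * Borel δ -> Borel δ * Borel δ -> R).
Unset Implicit Arguments.
Variables (dn : nat -> measure_display) (On : forall n, measurableType (dn n))
  (Pn : forall n, probability (On n) R) (Xn Yn : forall n, On n -> Borel δ)
  (d : measure_display) (Om : measurableType d) (P : probability Om R)
  (X Y : Om -> Borel δ).
Hypothesis mXn : forall n, measurable_fun [set: On n] (Xn n).
Hypothesis mYn : forall n, measurable_fun [set: On n] (Yn n).
Hypothesis mX : measurable_fun [set: Om] X.
Hypothesis mY : measurable_fun [set: Om] Y.
Hypothesis sXn : forall n, separable_law z (Pn n) (Xn n).
Hypothesis sYn : forall n, separable_law z (Pn n) (Yn n).
Hypothesis sX : separable_law z P X.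
Hypothesis sY : separable_law z P Y.
Variables (x0 y0 : M) (K : R).
Hypothesis K0 : 0 < K.
Hypothesis momn : forall n,
  (\int[Pn n]_w ((δ (Xn n w) x0) ^+ 2 + (δ (Yn n w) y0) ^+ 2)%:E <= K%:E)%E.
Set Implicit Arguments.
Hypothesis cvgXY :
  cvg_in_distribution δ Pn (fun n w => (Xn n w, Yn n w)) P (fun w => (X w, Y w)).

Let meas_dist d' (T : measurableType d') (U : T -> Borel δ) (a : M) :
  measurable_fun [set: T] U -> measurable_fun [set: T] (fun w => δ (U w) a).
Proof. by move=> mU; exact: (measurableT_comp (measurable_metric1 Hδ a) mU). Qed.

(** Truncating the distances at [k] before squaring yields bounded Lipschitz tests, so the bound
    passes to the limit law for each [k], and then to the full moment by monotone convergence. *)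
Lemma limit_second_moment :
  (\int[P]_w ((δ (X w) x0) ^+ 2 + (δ (Y w) y0) ^+ 2)%:E <= K%:E)%E.
Proof.
pose t (k : nat) (s : R) := Num.min k%:R s.
have t0 k s : 0 <= s -> 0 <= t k s by move=> s0; rewrite /t le_min ler0n.
have tk k s : t k s <= k%:R by rewrite /t ge_min lexx.
have tlip k s u : 0 <= s -> 0 <= u -> `|(t k s) ^+ 2 - (t k u) ^+ 2| <= 2 * k%:R * `|s - u|.
  move=> s0 u0; rewrite subr_sqr normrM mulrC.
  have h1 : `|t k s - t k u| <= `|s - u|.
    have H (a b : R) : a <= b -> `|t k a - t k b| <= `|a - b|.
      move=> ab; rewrite distrC [leRHS]distrC (ger0_norm (x := b - a)) ?subr_ge0//.
      rewrite /t; case: (leP k%:R a) => h1; case: (leP k%:R b) => h2;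
        rewrite ger0_norm; lra.
    by have [su|/ltW us] := leP s u; [exact: H|rewrite distrC [leRHS]distrC; exact: H].
  have h2 : `|t k s + t k u| <= 2 * k%:R.
    rewrite ger0_norm ?addr_ge0 ?t0//.
    by have := tk k s; have := tk k u; lra.
  by apply: ler_pM.
pose g (k : nat) (p : M * M) := (t k (δ p.1 x0)) ^+ 2 + (t k (δ p.2 y0)) ^+ 2.
have d0 := is_metric_ge0 Hδ.
have gc k : mcontinuous_pair δ (g k).
  apply: (@lipschitz_mcontinuous _ _ δ Hδ _ (2 * k%:R)); first by rewrite mulr_ge0.
  move=> p q; rewrite /g opprD addrACA; apply: (le_trans (ler_normD _ _)).
  rewrite /dman mulrDr; apply: lerD; apply: (le_trans (tlip _ _ _ (d0 _ _) (d0 _ _)));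
    by rewrite ler_wpM2l ?mulr_ge0// dist_lipschitz.
have g0 k p : 0 <= g k p by rewrite addr_ge0// sqr_ge0.
have gb k p : g k p <= k%:R ^+ 2 + k%:R ^+ 2.
  by apply: lerD; rewrite lerXn2r ?nnegrE ?t0 ?ler0n.
have mg d' (T : measurableType d') (U V : T -> Borel δ) k : measurable_fun [set: T] U ->
    measurable_fun [set: T] V -> measurable_fun [set: T] (fun w => g k (U w, V w)).
  move=> mU mV; apply: measurable_funD; apply: measurable_funX; apply: measurable_minr => //;
    exact: meas_dist.
have gsq k p : g k p <= (δ p.1 x0) ^+ 2 + (δ p.2 y0) ^+ 2.
  by apply: lerD; rewrite lerXn2r ?nnegrE ?t0 ?d0// /t ge_min lexx orbT.
have gK k : (\int[P]_w (g k (X w, Y w))%:E <= K%:E)%E.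
  have fin : (\int[P]_w (g k (X w, Y w))%:E)%E \is a fin_num.
    rewrite ge0_fin_numE; last by apply: int_ge0.
    apply: (le_lt_trans (int_le_cst (C := k%:R ^+ 2 + k%:R ^+ 2) _ _ _)); last exact: ltry.
    - exact: mg.
    - by move=> w; rewrite g0 gb.
  have bnd : exists C : R, forall p, `|g k p| <= C.
    by exists (k%:R ^+ 2 + k%:R ^+ 2) => p; rewrite ger0_norm.
  have cv := cvgXY (gc k) bnd.
  rewrite -(fineK fin) lee_fin -(cvg_lim _ cv)//.
  apply: limr_le; first by apply/cvg_ex; eexists; exact: cv.
  apply: nearW => n; rewrite -lee_fin fineK.
    apply: le_trans (momn n); apply: int_ge0_le => //.
    - exact: mg.
    - by apply: measurable_funD; apply: measurable_funX; exact: meas_dist.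
  rewrite ge0_fin_numE; last by apply: int_ge0.
  apply: (le_lt_trans (int_le_cst (C := k%:R ^+ 2 + k%:R ^+ 2) _ _ _)); last exact: ltry.
  - exact: mg.
  - by move=> w; rewrite g0 gb.
pose G k w := (g k (X w, Y w))%:E.
have limG w : limn (G ^~ w) = ((δ (X w) x0) ^+ 2 + (δ (Y w) y0) ^+ 2)%:E.
  apply: cvg_lim => //; apply: cvg_near_cst.
  (* From this index on, neither distance is truncated. *)
  exists (Num.truncn (δ (X w) x0 + δ (Y w) y0)).+1 => // k /= hk.
  have h : δ (X w) x0 + δ (Y w) y0 <= k%:R.
    by apply: (le_trans (ltW (Num.Theory.truncnS_gt _))); rewrite ler_nat.
  have h1 := d0 (X w) x0; have h2 := d0 (Y w) y0.
  rewrite /G /g /t /=; congr (_%:E); congr (_ ^+ 2 + _ ^+ 2); apply/min_idPr; lra.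
have := @cvg_monotone_convergence _ _ _ P setT measurableT G.
move=> H; have {}H : (\int[P]_w G k w)%E @[k --> \oo] --> (\int[P]_w limn (G ^~ w))%E.
  apply: H.
  - by move=> k; apply/measurable_EFinP; exact: mg.
  - by move=> k w _; rewrite lee_fin.
  - move=> w _ k l kl; rewrite lee_fin; apply: lerD; rewrite lerXn2r ?nnegrE ?t0 ?d0//;
      by rewrite /t le_min !ge_min lexx orbT andbT ler_nat kl.
rewrite -(eq_integral _ _ (fun w _ => limG w)) -(cvg_lim _ H)//.
apply: lime_le; first by apply/cvg_ex; eexists; exact: H.
by apply: nearW => k; exact: gK.
Qed.

(** For the pair, the square of a sum is at most twice the sum of the squares, whence [2 * K]. *)
Let moment_joint d' (T : measurableType d') (Q : probability T R) (U V : T -> Borel δ)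
    (mU : measurable_fun [set: T] U) (mV : measurable_fun [set: T] V) :
  separable_law z Q U -> separable_law z Q V ->
  (\int[Q]_w ((δ (U w) x0) ^+ 2 + (δ (V w) y0) ^+ 2)%:E <= K%:E)%E ->
  [/\ (\int[push Q (measurable_pair_rv mU mV)]_p ((dm p (x0, y0)) ^+ 2)%:E <= (2 * K)%:E)%E,
      (\int[push Q mU]_x ((mm x x0) ^+ 2)%:E <= K%:E)%E &
      (\int[push Q mV]_x ((mm x y0) ^+ 2)%:E <= K%:E)%E].
Proof.
move=> sU sV mom; have mC := measurable_mclosure Hδ z.
have mUC := preimage_measurable mU mC; have mVC := preimage_measurable mV mC.
have d0 := is_metric_ge0 Hδ.
have mU2 : measurable_fun [set: T] (fun w => (δ (U w) x0) ^+ 2).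
  by apply: measurable_funX; exact: meas_dist.
have mV2 : measurable_fun [set: T] (fun w => (δ (V w) y0) ^+ 2).
  by apply: measurable_funX; exact: meas_dist.
have mmm a : measurable_fun [set: Borel δ] (fun x : Borel δ => (mm x a) ^+ 2).
  apply: measurable_funX; apply: measurable_mmetric_comp => //.
have mdd : measurable_fun [set: Borel δ * Borel δ]
    (fun p : Borel δ * Borel δ => (dm p (x0, y0)) ^+ 2).
  apply: measurable_funX.
  by apply: measurable_funD; apply: measurable_mmetric_comp.
split.
- rewrite (@integral_push _ _ _ _ _ Q _ (measurable_pair_rv mU mV)
    (fun p => ((dm p (x0, y0)) ^+ 2)%:E)); last 2 first.
  + exact/measurable_EFinP.
  + by move=> p; rewrite lee_fin sqr_ge0.
  apply: (@le_trans _ _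
    (\int[Q]_w (2 * ((δ (U w) x0) ^+ 2 + (δ (V w) y0) ^+ 2))%:E)%E).
    apply: (int_le_full_set (measurableI _ _ mUC mVC)).
    + by rewrite setCI; apply: prob0_setU => //; exact: measurableC.
    + exact: (measurableT_comp mdd (measurable_pair_rv mU mV)).
    + by apply: measurable_funM => //; exact: measurable_funD.
    + by move=> w; exact: sqr_ge0.
    + by move=> w; rewrite mulr_ge0// addr_ge0// sqr_ge0.
    + move=> w [h1 h2]; rewrite /dman /= (mmetricE Hδ _ h1) (mmetricE Hδ _ h2).
      rewrite -subr_ge0; apply: (@le_trans _ _ ((δ (U w) x0 - δ (V w) y0) ^+ 2)).
        exact: sqr_ge0.
      by rewrite le_eqVlt; apply/orP; left; apply/eqP; ring.
  rewrite int_ge0Z//.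
  + by rewrite EFinM; apply: lee_wpmul2l.
  + exact: measurable_funD.
  + by move=> w; rewrite addr_ge0// sqr_ge0.
- rewrite (@integral_push _ _ _ _ _ Q _ mU (fun x => ((mm x x0) ^+ 2)%:E)); last 2 first.
  + exact/measurable_EFinP.
  + by move=> p; rewrite lee_fin sqr_ge0.
  apply: le_trans mom; apply: (int_le_full_set mUC) => //.
  + exact: (measurableT_comp (mmm x0) mU).
  + exact: measurable_funD.
  + by move=> w; exact: sqr_ge0.
  + by move=> w; rewrite addr_ge0// sqr_ge0.
  + by move=> w h; rewrite (mmetricE Hδ _ h) lerDl sqr_ge0.
- rewrite (@integral_push _ _ _ _ _ Q _ mV (fun x => ((mm x y0) ^+ 2)%:E)); last 2 first.
  + exact/measurable_EFinP.
  + by move=> p; rewrite lee_fin sqr_ge0.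
  apply: le_trans mom; apply: (int_le_full_set mVC) => //.
  + exact: (measurableT_comp (mmm y0) mV).
  + exact: measurable_funD.
  + by move=> w; exact: sqr_ge0.
  + by move=> w; rewrite addr_ge0// sqr_ge0.
  + by move=> w h; rewrite (mmetricE Hδ _ h) lerDr sqr_ge0.
Qed.

Let cvg_tent (F : nat -> M * M -> R) e i : 0 < e ->
  (forall j p q, `|F j p - F j q| <= dman δ p q) ->
  (fun n => fine (\int[Pn n]_w (unity_part (fun j p => tent e (F j p)) i
     (Xn n w, Yn n w))%:E)) @ \oo
  --> fine (\int[P]_w (unity_part (fun j p => tent e (F j p)) i (X w, Y w))%:E).
Proof.
move=> e0 FL; apply: cvgXY; first exact: tent_part_mcontinuous.
exists 1 => p; have /andP[h0 h1] := @unity_part01 _ _ (fun j p => tent e (F j p))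
  (fun j x => tent01 e (F j x)) i p.
by rewrite ger0_norm.
Qed.

(** Tents are built from [mm], while convergence in distribution is tested with functions continuous
    for [δ]. The two distances agree at the centers. *)
Let mm_center x i : mm x (z i) = δ x (z i).
Proof.
have zi : mclosure δ z (z i) by move=> e e0; exists i; rewrite is_metric_xx.
by rewrite (mmetricC Hδ z x) (mmetricE Hδ x zi) (is_metric_sym Hδ (z i)).
Qed.

Let mm0 : forall x y, 0 <= mm x y.
Proof. by move=> x y; exact: mmetric_ge0. Qed.
Let mmC : forall x y, mm x y = mm y x.
Proof. by move=> x y; exact: mmetricC. Qed.
Let mmT : forall x y w, mm x w <= mm x y + mm y w.
Proof. by move=> x y w; exact: mmetric_tri. Qed.

Let Dz x : mclosure δ z x -> forall e : R, 0 < e -> exists i, mm x (z i) < e.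
Proof. by move=> zx e /zx[i xi]; exists i; rewrite mm_center. Qed.

Lemma density_close_fst eps : 0 < eps ->
  \forall n \near \oo, density_close mm (push (Pn n) (mXn n)) (push P mX) eps.
Proof.
have [_ beK _] := moment_joint mX mY sX sY limit_second_moment.
apply: (@density_close_eventually _ (Borel δ) R mm (measurable_mmetric Hδ z) mm0 mmC mmT
  z (fun n => push (Pn n) (mXn n)) (push P mX) (mclosure δ z)
  (measurable_mclosure Hδ z) sX Dz x0 K K0).
- by move=> n; have [_ ? _] := moment_joint (mXn n) (mYn n) (sXn n) (sYn n) (momn n).
- exact: beK.
move=> e i e0.
have mmm := measurable_mmetric Hδ z : measurable_fun setT (fun p => mm p.1 p.2).
rewrite (int_tent_part_push mmm); under eq_fun do rewrite (int_tent_part_push mmm).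
apply: (@cvg_tent (fun j p => mm p.1 (z j)) e i e0) => j p q.
rewrite !mm_center; apply: (le_trans (dist_lipschitz Hδ _ _ _)).
by rewrite /dman lerDl is_metric_ge0.
Qed.

Lemma density_close_snd eps : 0 < eps ->
  \forall n \near \oo, density_close mm (push (Pn n) (mYn n)) (push P mY) eps.
Proof.
have [_ _ beK] := moment_joint mX mY sX sY limit_second_moment.
apply: (@density_close_eventually _ (Borel δ) R mm (measurable_mmetric Hδ z) mm0 mmC mmT
  z (fun n => push (Pn n) (mYn n)) (push P mY) (mclosure δ z)
  (measurable_mclosure Hδ z) sY Dz y0 K K0).
- by move=> n; have [_ _ ?] := moment_joint (mXn n) (mYn n) (sXn n) (sYn n) (momn n).
- exact: beK.
move=> e i e0.
have mmm := measurable_mmetric Hδ z : measurable_fun setT (fun p => mm p.1 p.2).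
rewrite (int_tent_part_push mmm); under eq_fun do rewrite (int_tent_part_push mmm).
apply: (@cvg_tent (fun j p => mm p.2 (z j)) e i e0) => j p q.
rewrite !mm_center; apply: (le_trans (dist_lipschitz Hδ _ _ _)).
by rewrite /dman lerDr is_metric_ge0.
Qed.

Lemma density_close_pair eps : 0 < eps ->
  \forall n \near \oo, density_close dm
    (push (Pn n) (measurable_pair_rv (mXn n) (mYn n))) (push P (measurable_pair_rv mX mY)) eps.
Proof.
have [beK _ _] := moment_joint mX mY sX sY limit_second_moment.
(* The centers in the product are all pairs of centers, enumerated through their codes; other
   integers receive a harmless default pair. *)
pose c (k : nat) : Borel δ * Borel δ :=
  if unpickle k is Some (i, j) then (z i, z j) else (z 0%N, z 0%N).
have cE k p : dm p (c k) = dman δ p (c k).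
  by rewrite /dman /c; case: unpickle => [[i j]|] /=; rewrite !mm_center.
have mC := measurable_mclosure Hδ z.
have K20 : 0 < 2 * K by rewrite mulr_gt0.
apply: (@density_close_eventually _ (Borel δ * Borel δ)%type R dm
  (measurable_dman_mmetric Hδ z) (dman_mmetric_ge0 Hδ z) (dman_mmetricC Hδ z)
  (fun p q s => dman_mmetric_tri Hδ z p q s) c
  (fun n => push (Pn n) (measurable_pair_rv (mXn n) (mYn n)))
  (push P (measurable_pair_rv mX mY))
  ((mclosure δ z : set (Borel δ)) `*` (mclosure δ z : set (Borel δ))) _ _ _ (x0, y0)
  (2 * K) K20).
- exact: measurableX.
- have mXC := preimage_measurable mX mC; have mYC := preimage_measurable mY mC.
  apply: etrans (prob0_setU (measurableC mXC) (measurableC mYC) sX sY).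
  by rewrite -setCI.
- move=> [x y] [/= zx zy] e e0; have e2 : 0 < e / 2 by rewrite divr_gt0.
  have [i xi] := Dz zx e2; have [j yj] := Dz zy e2.
  exists (pickle (i, j)); rewrite /c pickleK /dman /=.
  by rewrite [ltRHS](splitr e); apply: ltrD.
- by move=> n; have [? _ _] := moment_joint (mXn n) (mYn n) (sXn n) (sYn n) (momn n).
- exact: beK.
move=> e i e0.
have mdm := measurable_dman_mmetric Hδ z.
rewrite (int_tent_part_push mdm); under eq_fun do rewrite (int_tent_part_push mdm).
apply: (@cvg_tent (fun j p => dm p (c j)) e i e0) => j p q.
by rewrite !cE; exact: dman_lipschitz.
Qed.

(** The law of the independent copy is rewritten as a product of marginals, the form that
    [density_close_prod] handles. *)
Let eCov_push d' (T : measurableType d') (Q : probability T R) (U V : T -> Borel δ)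
  (mU : measurable_fun [set: T] U) (mV : measurable_fun [set: T] V) :
  separable_law z Q U -> separable_law z Q V ->
  eCov Q U V = emd dm (push Q (measurable_pair_rv mU mV)) (push Q mU \x push Q mV)%E.
Proof.
move=> sU sV; rewrite (eCovE Hδ mU mV sU sV); apply: emd_ext => // A mA.
have H : indep_copy_law Q U V (push Q mU \x push Q mV)%E.
  by move=> B C mB mC; apply: product_measure1E.
exact: indep_copy_law_unique (indep_pair_law Q mU mV) H _ mA.
Qed.

Unset Implicit Arguments.
Hypothesis finn : forall n, eCov (Pn n) (Xn n) (Yn n) \is a fin_num.
Set Implicit Arguments.
Hypothesis fin : eCov P X Y \is a fin_num.

Lemma eCov_cvg :
  (fun n => fine (eCov (Pn n) (Xn n) (Yn n))) @ \oo --> fine (eCov P X Y).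
Proof.
(* The joint laws contribute one [t], the products of marginals two, so each inequality has error
   [3 * t], less than [e]. *)
apply/cvgrPdist_lt => e e0; pose t := e / 4.
have t0 : 0 < t by rewrite divr_gt0.
near=> n.
have c1 : density_close mm (push (Pn n) (mXn n)) (push P mX) t.
  by near: n; exact: density_close_fst.
have c2 : density_close mm (push (Pn n) (mYn n)) (push P mY) t.
  by near: n; exact: density_close_snd.
have c3 : density_close dm (push (Pn n) (measurable_pair_rv (mXn n) (mYn n)))
    (push P (measurable_pair_rv mX mY)) t.
  by near: n; exact: density_close_pair.
have mmm := measurable_mmetric Hδ z.
have mdm := measurable_dman_mmetric Hδ z.
have dm0 := dman_mmetric_ge0 Hδ z.
have dmC := dman_mmetricC Hδ z.
have dmT p q s := dman_mmetric_tri Hδ z p q s.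
have c4 := density_close_prod mmm mm0 c1 c2.
have h1 := emd_close2 mdm dm0 dmC dmT c3 c4.
have h2 := emd_close2 mdm dm0 dmC dmT (density_close_sym mdm dm0 dmC c3)
  (density_close_sym mdm dm0 dmC c4).
move: h1 h2.
rewrite -(eCov_push mX mY sX sY) -(eCov_push (mXn n) (mYn n) (sXn n) (sYn n)).
rewrite -(fineK fin) -(fineK (finn n)) -!EFinD !lee_fin => h1 h2.
rewrite ltr_norml /t in h1 h2 *; apply/andP; split; lra.
Unshelve. all: by end_near. Qed.

End WeakConvergence.

(** * Convergence of the correlation *)

Section CorrelationContinuity.
Context {R : realType} {M : pointedType} (δ : M -> M -> R).
Hypothesis Hδ : is_metric δ.
Unset Implicit Arguments.
Variables (dn : nat -> measure_display) (On : forall n, measurableType (dn n))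
  (Pn : forall n, probability (On n) R) (Xn Yn : forall n, On n -> Borel δ)
  (d : measure_display) (Om : measurableType d) (P : probability Om R)
  (X Y : Om -> Borel δ).
Hypothesis aXn : forall n, admissible (Pn n) (Xn n).
Hypothesis aYn : forall n, admissible (Pn n) (Yn n).
Hypothesis aX : admissible P X.
Hypothesis aY : admissible P Y.
Variables (x0 y0 : M) (K : R).
Hypothesis K0 : 0 < K.
Hypothesis momn : forall n,
  (\int[Pn n]_w ((δ (Xn n w) x0) ^+ 2 + (δ (Yn n w) y0) ^+ 2)%:E <= K%:E)%E.
Set Implicit Arguments.
Hypothesis cvgXY :
  cvg_in_distribution δ Pn (fun n w => (Xn n w, Yn n w)) P (fun w => (X w, Y w)).

(** Meant for the maps that duplicate one coordinate: they turn the convergence of the pairs into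
    that of [(Xn, Xn)] or [(Yn, Yn)]. Duplication at most doubles [dman], hence the factor 2. *)
Let cvg_diag (k : M * M -> M * M) :
  (forall p q, dman δ (k p) (k q) <= 2 * dman δ p q) ->
  cvg_in_distribution δ Pn (fun n w => k (Xn n w, Yn n w)) P (fun w => k (X w, Y w)).
Proof.
move=> kL g gc [C gC]; apply: (cvgXY (g := g \o k)); last by exists C => p; exact: gC.
move=> p e e0; have [r [r0 H]] := gc (k p) e e0; exists (r / 2).
split; first by rewrite divr_gt0.
move=> q pq; apply: H; apply: le_lt_trans (kL p q) _.
by rewrite mulrC -ltr_pdivlMr.
Qed.

Lemma eCor_cvg : (fun n => eCor (Pn n) (Xn n) (Yn n)) @ \oo --> eCor P X Y.
Proof.
have mXn n : measurable_fun [set: On n] (Xn n) by have [] := aXn n.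
have mYn n : measurable_fun [set: On n] (Yn n) by have [] := aYn n.
have [mX _ fX rX] := aX; have [mY _ fY rY] := aY.
have exXn n : exists z, separable_law z (Pn n) (Xn n).
  by have [m _ _ r] := aXn n; exact: (radon_separable Hδ m r).
have exYn n : exists z, separable_law z (Pn n) (Yn n).
  by have [m _ _ r] := aYn n; exact: (radon_separable Hδ m r).
have [zXn HXn] := choice exXn; have [zYn HYn] := choice exYn.
have [zX HX] := radon_separable Hδ mX rX; have [zY HY] := radon_separable Hδ mY rY.
have [z1 Hz1] := mclosure_bigcup δ zXn; have [z2 Hz2] := mclosure_bigcup δ zYn.
(* A single sequence must carry the limit laws and all the laws indexed by [n], since the cost may
   not vary with [n]. *)
have [z Hz] := mclosure_bigcup δ (fun n =>
  if n is 0%N then zX else if n is 1%N then zY else if n is 2%N then z1 else z2).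
have sX : separable_law z P X := separable_law_le Hδ mX (Hz 0%N) HX.
have sY : separable_law z P Y := separable_law_le Hδ mY (Hz 1%N) HY.
have sXn n : separable_law z (Pn n) (Xn n).
  by apply: (separable_law_le Hδ (mXn n) _ (HXn n)); exact: subset_trans (Hz1 n) (Hz 2%N).
have sYn n : separable_law z (Pn n) (Yn n).
  by apply: (separable_law_le Hδ (mYn n) _ (HYn n)); exact: subset_trans (Hz2 n) (Hz 3%N).
have d0 := is_metric_ge0 Hδ.
have md n (U : On n -> Borel δ) (a : M) : measurable_fun [set: On n] U ->
    measurable_fun [set: On n] (fun w => (δ (U w) a) ^+ 2).
  move=> mU; apply: measurable_funX.
  exact: (measurableT_comp (measurable_metric1 Hδ a) mU).
have K20 : 0 < 2 * K by rewrite mulr_gt0.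
(* For a duplicated variable the moment of the pair counts the same square twice, so the bound
   becomes [2 * K]. *)
have mom2 n (U : On n -> Borel δ) (a : M) : measurable_fun [set: On n] U ->
    (forall w, (δ (U w) a) ^+ 2 <= (δ (Xn n w) x0) ^+ 2 + (δ (Yn n w) y0) ^+ 2) ->
    (\int[Pn n]_w ((δ (U w) a) ^+ 2 + (δ (U w) a) ^+ 2)%:E <= (2 * K)%:E)%E.
  move=> mU UXY; have mU2 := md n U a mU.
  have UK : (\int[Pn n]_w ((δ (U w) a) ^+ 2)%:E <= K%:E)%E.
    apply: le_trans (momn n); apply: int_ge0_le => //.
    - by apply: measurable_funD; exact: md.
    - by move=> w; exact: sqr_ge0.
  rewrite int_ge0D//; try by move=> w; exact: sqr_ge0.
  by rewrite mulr_natl mulr2n EFinD; apply: leeD.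
have cov : (fun n => fine (eCov (Pn n) (Xn n) (Yn n))) @ \oo --> fine (eCov P X Y).
  apply: (@eCov_cvg _ _ _ Hδ z dn On Pn Xn Yn d Om P X Y mXn mYn mX mY sXn sYn sX sY
    x0 y0 K K0 momn cvgXY).
    by move=> n; have [_ _ f _] := aXn n; exact: (eCov_fin Hδ (mXn n) (mYn n) (sXn n) (sYn n) f).
  exact: (eCov_fin Hδ mX mY sX sY fX).
have varX : (fun n => fine (eVar (Pn n) (Xn n))) @ \oo --> fine (eVar P X).
  apply: (@eCov_cvg _ _ _ Hδ z dn On Pn Xn Xn d Om P X X mXn mXn mX mX sXn sXn sX sX
    x0 x0 (2 * K) K20).
  - by move=> n; apply: mom2 => // w; rewrite lerDl sqr_ge0.
  - apply: (@cvg_diag (fun p => (p.1, p.1))) => p q; rewrite /dman /=.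
    have := d0 p.2 q.2; lra.
  - by move=> n; have [_ _ f _] := aXn n; exact: (eCov_fin Hδ (mXn n) (mXn n) (sXn n) (sXn n) f).
  - exact: (eCov_fin Hδ mX mX sX sX fX).
have varY : (fun n => fine (eVar (Pn n) (Yn n))) @ \oo --> fine (eVar P Y).
  apply: (@eCov_cvg _ _ _ Hδ z dn On Pn Yn Yn d Om P Y Y mYn mYn mY mY sYn sYn sY sY
    y0 y0 (2 * K) K20).
  - by move=> n; apply: mom2 => // w; rewrite lerDr sqr_ge0.
  - apply: (@cvg_diag (fun p => (p.2, p.2))) => p q; rewrite /dman /=.
    have := d0 p.1 q.1; lra.
  - by move=> n; have [_ _ f _] := aYn n; exact: (eCov_fin Hδ (mYn n) (mYn n) (sYn n) (sYn n) f).
  - exact: (eCov_fin Hδ mY mY sY sY fY).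
have [_ _ vX] := admissible_eVar Hδ aX sX; have [_ _ vY] := admissible_eVar Hδ aY sY.
apply: cvgM => //; apply: cvgV; first by rewrite gt_eqF// lt_min vX.
(* Writing the minimum with an absolute value reduces its limit to those of sums, differences and
   norms. *)
rewrite minr_absE; under eq_fun do rewrite minr_absE.
by apply: cvgMl; apply: cvgB; [exact: cvgD|apply: cvg_norm; exact: cvgB].
Qed.

End CorrelationContinuity.

Unset Implicit Arguments.
Set Strict Implicit.

Theorem theorem7 (R : realType) (M : pointedType) (δ : M -> M -> R)
  (Hδ : is_metric δ) :
  (* (a) *)
  (forall (d : measure_display) (Om : measurableType d) (P : probability Om R)
          (X Y : Om -> Borel δ),
     admissible P X -> admissible P Y ->
     (eCor P X Y = 0 <-> independent P X Y)) /\
  (* part b-star *)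
  (forall (d : measure_display) (Om : measurableType d) (P : probability Om R)
          (X Y : Om -> Borel δ) (f : M -> M),
     admissible P X -> admissible P Y -> similarity δ f ->
     eCor P (fun w => f (X w) : Borel δ) (fun w => f (Y w) : Borel δ) = eCor P X Y) /\
  (* part c-star *)
  (forall (d : measure_display) (Om : measurableType d) (P : probability Om R)
          (X Y : Om -> Borel δ) (f : M -> M),
     admissible P X -> admissible P Y -> similarity δ f ->
     {ae P, forall w, Y w = f (X w)} ->
     eCor P X Y = 1) /\
  (* (d) *)
  (forall (dn : nat -> measure_display) (On : forall n, measurableType (dn n))
          (Pn : forall n, probability (On n) R) (Xn Yn : forall n, On n -> Borel δ)
          (d : measure_display) (Om : measurableType d) (P : probability Om R)
          (X Y : Om -> Borel δ),
     (forall n, admissible (Pn n) (Xn n)) -> (forall n, admissible (Pn n) (Yn n)) ->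
     admissible P X -> admissible P Y ->
     (exists (x0 y0 : M) (K : R), 0 < K /\
        forall n, (\int[Pn n]_w ((δ (Xn n w) x0) ^+ 2 + (δ (Yn n w) y0) ^+ 2)%:E
                   <= K%:E)%E) ->
     cvg_in_distribution δ Pn (fun n w => (Xn n w, Yn n w)) P (fun w => (X w, Y w)) ->
     (fun n => eCor (Pn n) (Xn n) (Yn n)) @ \oo --> eCor P X Y).
Proof.
split; first by move=> d Om P X Y; exact: eCor_eq0.
split; first by move=> d Om P X Y f; exact: eCor_similarity.
split; first by move=> d Om P X Y f; exact: eCor_similar.
move=> dn On Pn Xn Yn d Om P X Y aXn aYn aX aY [x0 [y0 [K [K0 mom]]]] cv.
exact: (@eCor_cvg _ _ _ Hδ dn On Pn Xn Yn d Om P X Y aXn aYn aX aY x0 y0 K K0 mom cv).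
Qed.
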